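(* Fix $N,n\ge1$, $K_{\rm feat}>0$, and $\beta,\gamma>0$. Let $W\in\mathbb R^N$ be a $(K_{\rm feat},\tau)$-regular feature with covariance matrix $\Sigma$, and set $\lambda_\Sigma=\|\Sigma\|_{\mathrm{op}}>0$. Let $G$ be the centered Gaussian vector in $\mathbb R^N$ with covariance $\Sigma$, and let $W_1,\dots,W_n$ and $G_1,\dots,G_n$ be independent arrays of i.i.d. copies of $W$ and $G$, respectively. There are constants $C,n_0<\infty$, depending only on $K_{\rm feat}$, with the following property. Let $\mathcal D\subset\mathbb R^N$ be nonempty, bounded, convex, and relatively open in its affine hull, and let $\mathcal B:\mathcal D\to[0,\infty)$ be a $\vartheta$-self-concordant barrier for some $\vartheta\ge1$. Define $$\Lambda_{\rm ref}:=\Big(1+\frac1\beta\Big)\Big(1+\inf_{\theta\in\mathcal D}\{\lambda_\Sigma\|\theta\|_2^2+\gamma\mathcal B(\theta)\}\Big).$$ If $n\gamma\ge n_0$, then $$\Big|\mathbb E\Phi_W(\mathcal D,\mathcal B;\beta,\gamma)-\mathbb E\Phi_G(\mathcal D,\mathcal B;\beta,\gamma)\Big|\le C\Lambda_{\rm ref}^2\left(\frac1{\sqrt{n\gamma}}+\frac{\sqrt{\dim\mathsf V_{\mathcal D}}\,(\tau/\lambda_\Sigma+1)}{n}\right).$$ Moreover, $$\operatorname{Var}\big(\Phi_W(\mathcal D,\mathcal B;\beta,\gamma)\big)+\operatorname{Var}\big(\Phi_G(\mathcal D,\mathcal B;\beta,\gamma)\big)\le C\frac{\Lambda_{\rm ref}^2}{n},$$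 and hence, for every $t>0$, $$\mathbb P\left(\big|\Phi_W(\mathcal D,\mathcal B;\beta,\gamma)-\Phi_G(\mathcal D,\mathcal B;\beta,\gamma)\big|>C\Lambda_{\rm ref}^2\Big(\frac1{\sqrt{n\gamma}}+\frac{\sqrt{\dim\mathsf V_{\mathcal D}}\,(\tau/\lambda_\Sigma+1)}{n}\Big)+t\right)\le\frac{C\Lambda_{\rm ref}^2}{nt^2}.$$
   Context: Regular feature: for $K_{\rm feat}>0$ and $\tau\ge0$, a random vector $Z\in\mathbb R^N$ is a $(K_{\rm feat},\tau)$-regular feature if $\mathbb E[Z]=0$, $\operatorname{Cov}(Z)=\Sigma$ with $\lambda_\Sigma=\|\Sigma\|_{\mathrm{op}}>0$, and: (F1) for every fixed $\theta\in\mathbb R^N$, $\big(\mathbb E\langle Z,\theta\rangle^4\big)^{1/2}\le K_{\rm feat}^2\lambda_\Sigma\|\theta\|_2^2$; (F2) for every fixed symmetric $T\in\mathbb R^{N\times N}$, $\operatorname{Var}(Z^\top TZ)\le\tau^2\|T\|_F^2$. Regularized values: for an array $Z=(Z_i)_{i\le n}$ in $\mathbb R^N$ (with common covariance $\Sigma$), $$F_Z(\theta,b;\beta)=\frac1{2n}\sum_{i=1}^n(b-\langle Z_i,\theta\rangle)^2+\beta(\lambda_\Sigma\|\theta\|_2^2+b^2),\qquad \Phi_Z(\mathcal D,\mathcal B;\beta,\gamma)=\inf_{\theta\in\mathcal D,\ b\in\mathbb R}\{F_Z(\theta,b;\beta)+\gamma\mathcal B(\theta)\}.$$ $\Phi_W,\Phi_G$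 denote this for the arrays $(W_i)$, $(G_i)$. Barriers: for a convex $\Omega\subset\mathbb R^N$ relatively open in its affine hull, let $\mathsf V_\Omega=\operatorname{span}\{z-z':z,z'\in\Omega\}$. Let $\Psi:\Omega\to\mathbb R$ be convex and $C^3$ along line segments in $\Omega$, and set $\|h\|_{\Psi,z}^2=\mathrm D^2\Psi(z)[h,h]$. For $\vartheta\ge1$, $\Psi$ is a $\vartheta$-self-concordant barrier for $\Omega$ if $\Psi(z)\to\infty$ as $z$ approaches the relative boundary of $\Omega$ and, for every $z\in\Omega$, $h\in\mathsf V_\Omega$: $|\mathrm D^3\Psi(z)[h,h,h]|\le2\|h\|_{\Psi,z}^3$ and $|\mathrm D\Psi(z)[h]|\le\sqrt\vartheta\,\|h\|_{\Psi,z}$. *)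

(* Defs.v *)
From HB Require Import structures.
From mathcomp Require Import all_boot all_order all_algebra.
From mathcomp Require Import all_classical all_reals all_analysis.

Set Implicit Arguments.
Unset Strict Implicit.
Unset Printing Implicit Defensive.

Import Order.TTheory GRing.Theory Num.Theory.
Import numFieldNormedType.Exports.

Local Open Scope classical_set_scope.
Local Open Scope ring_scope.

(* R^N is the type 'rV[R]_N of row vectors: a matrix acts on the right, so the
   quadratic form z^T A z reads z *m A *m z^T. The library norm on 'rV[R]_N is
   the sup norm, hence the explicit Euclidean, Frobenius and operator norms. *)

Section Euclidean.
Variables (R : realType) (N : nat).
Implicit Types (x y : 'rV[R]_N) (A : 'M[R]_N).

Definition dot x y : R := \sum_(j < N) x 0 j * y 0 j.

Definition quad A x : R := (x *m A *m x^T) 0 0.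

Definition norm2 x : R := Num.sqrt (dot x x).

Definition normF A : R := Num.sqrt (\sum_(i < N) \sum_(j < N) A i j ^+ 2).

Definition op_norm A : R :=
  sup [set norm2 (x *m A) | x in [set x | norm2 x <= 1]].

End Euclidean.

(* 'rV[R]_N with its Borel sigma-algebra *)
Definition borel_rV (R : realType) (N : nat) :=
  g_sigma_algebraType (@open 'rV[R]_N).

Section RandomVectors.
Context d (T : measurableType d) (R : realType) (P : probability T R) (N : nat).
Local Notation vec := (borel_rV R N).

Definition same_law (X Y : {RV P >-> vec}) : Prop :=
  forall A : set vec, measurable A ->
    distribution P X A = distribution P Y A.

Definition mutually_independent (I : finType) (X : I -> {RV P >-> vec}) : Prop :=
  forall (J : {set I}) (A : I -> set vec), (forall i, measurable (A i)) ->
    P (\bigcap_(i in [set` J]) (X i @^-1` A i)) =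
    (\prod_(i in J) P (X i @^-1` A i))%E.

Definition centered (Z : {RV P >-> vec}) : Prop :=
  forall j : 'I_N, ('E_P[fun w => ((Z w : 'rV[R]_N) 0%R j)] = 0)%E.

Definition has_covariance (Z : {RV P >-> vec}) (Sigma : 'M[R]_N) : Prop :=
  forall i j : 'I_N,
    covariance P (fun w => (Z w : 'rV[R]_N) 0 i)
                 (fun w => (Z w : 'rV[R]_N) 0 j) = (Sigma i j)%:E.

Definition regular_feature (K tau : R) (Sigma : 'M[R]_N)
    (Z : {RV P >-> vec}) : Prop :=
  [/\ centered Z,
      has_covariance Z Sigma,
      0 < op_norm Sigma,
      forall theta : 'rV[R]_N,
        (sqrte 'E_P[fun w => (dot (Z w) theta ^+ 4)%R]
           <= (K ^+ 2 * op_norm Sigma * norm2 theta ^+ 2)%:E)%E &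
      forall S : 'M[R]_N, S^T = S ->
        ('V_P[fun w => quad S (Z w)] <= (tau ^+ 2 * normF S ^+ 2)%:E)%E].

(* normal_prob takes the standard deviation, and normal_prob _ 0 is not the
   point mass, so the degenerate case is separated. *)
Definition normal_law (m v : R) (A : set R) : \bar R :=
  if v == 0 then \d_m A else normal_prob m (Num.sqrt v) A.

(* A random vector is Gaussian when all its one-dimensional projections are. *)
Definition centered_gaussian (Sigma : 'M[R]_N) (Z : {RV P >-> vec}) : Prop :=
  forall (theta : 'rV[R]_N) (A : set R), measurable A ->
    P ((fun w => dot (Z w) theta) @^-1` A) = normal_law 0 (quad Sigma theta) A.

End RandomVectors.

Section Span.
Variables (R : realType) (V : vectType R).

Definition lin_span (A : set V) : set V :=
  [set v | exists2 s : seq V, (forall x, x \in s -> A x) & v \in << s >>%VS].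

Definition vspan (A : set V) : {vspace V} :=
  xget 0%VS [set U | [set` U] = lin_span A].

Lemma vspanP (A : set V) : [set` vspan A] = lin_span A.
Proof.
rewrite /vspan; case: xgetP => [U _ //|noU].
pose Q k := `[< exists2 s : seq V, (forall x, x \in s -> A x)
                & \dim << s >>%VS = k >].
have Q0 : exists k, Q k.
  by exists (\dim <<[::] : seq V>>%VS); apply/asboolP; exists [::].
have Qub k : Q k -> (k <= \dim {:V})%N.
  by move=> /asboolP[s _ <-]; exact/dimvS/subvf.
have [k /asboolP[s sA sk] kmax] := ex_maxnP Q0 Qub.
case: (noU << s >>%VS); apply/seteqP; split => v /= vs; first by exists s.
have [t tA vt] := vs.
have stA x : x \in s ++ t -> A x by rewrite mem_cat => /orP[/sA|/tA].
have /kmax dle : Q (\dim << s ++ t >>%VS) by apply/asboolP; exists (s ++ t).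
have /eqP -> : << s >>%VS == << s ++ t >>%VS.
  by rewrite eqEdim span_cat addvSl /= -span_cat sk.
by rewrite span_cat; apply: subvP vt; exact: addvSr.
Qed.

End Span.

Section Barrier.
Variables (R : realType) (N : nat).
Implicit Types (D : set 'rV[R]_N) (Psi : 'rV[R]_N -> R) (z h : 'rV[R]_N).

Definition affine_hull D : set 'rV[R]_N :=
  [set x | exists (k : nat) (p : 'I_k -> 'rV[R]_N) (a : 'I_k -> R),
     [/\ forall i, D (p i), \sum_i a i = 1 & x = \sum_i a i *: p i]].

Definition relatively_open D : Prop :=
  exists2 U : set 'rV[R]_N, open U & D = affine_hull D `&` U.

Definition direction D : {vspace 'rV[R]_N} :=
  vspan [set v | exists z z', [/\ D z, D z' & v = z - z']].

Definition along Psi z h : R -> R := fun t => Psi (z + t *: h).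

(* D^kPsi(z)[h,...,h] *)
Definition Dk (k : nat) Psi z h : R := derive1n k (along Psi z h) 0.

(* For D relatively open, z in D and h in direction D, the set of t with
   z + t h in D is open, so the derivatives only see Psi on D. *)
Definition C3_along_segments D Psi : Prop :=
  forall z h (t : R), D z -> h \in direction D -> D (z + t *: h) ->
    (forall k, (k < 3)%N -> derivable (derive1n k (along Psi z h)) t 1) /\
    {for t, continuous (derive1n 3 (along Psi z h))}.

Definition local_norm Psi z h : R := Num.sqrt (Dk 2 Psi z h).

(* Since D is relatively open, its relative boundary is closure D `\` D. *)
Definition self_concordant_barrier (vartheta : R) D Psi : Prop :=
  [/\ convex_function (E := 'rV[R]_N) D Psi,
      C3_along_segments D Psi,
      forall x, (closure D `\` D) x -> Psi @ within D (nbhs x) --> +oo &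
      forall z h, D z -> h \in direction D ->
        `|Dk 3 Psi z h| <= 2 * local_norm Psi z h ^+ 3 /\
        `|Dk 1 Psi z h| <= Num.sqrt vartheta * local_norm Psi z h].

End Barrier.

Section RegularizedValue.
Variables (R : realType) (N n : nat) (lambda : R).
Implicit Types (D : set 'rV[R]_N) (B : 'rV[R]_N -> R) (beta gamma : R).

Definition objective (Z : 'I_n -> 'rV[R]_N) (theta : 'rV[R]_N) (b beta : R) : R :=
  (2 * n%:R)^-1 * \sum_(i < n) (b - dot (Z i) theta) ^+ 2
  + beta * (lambda * norm2 theta ^+ 2 + b ^+ 2).

Definition Phi D B beta gamma (Z : 'I_n -> 'rV[R]_N) : R :=
  inf [set objective Z theta b beta + gamma * B theta
        | theta in D & b in [set: R]].

Definition Lambda_ref D B beta gamma : R :=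
  (1 + beta^-1) *
  (1 + inf [set lambda * norm2 theta ^+ 2 + gamma * B theta | theta in D]).

Definition rate D tau gamma : R :=
  (Num.sqrt (n%:R * gamma))^-1
  + Num.sqrt (\dim (direction D))%:R * (tau / lambda + 1) / n%:R.

End RegularizedValue.

(* Main.v *)
Require Import Defs.
From HB Require Import structures.
From mathcomp Require Import all_boot all_order all_algebra.
From mathcomp Require Import all_classical all_reals all_analysis.
From mathcomp Require Import measurable_realfun lra.

(** The regularized values of the two arrays are compared by replacing one sample at a time, as
   in Lindeberg's proof of the central limit theorem. Fix all samples but one and let Phi0 be the
   value of the problem without that sample, with the normalisation 1 / (2 n) kept. Its objective
   is a quadratic polynomial in (theta, b) plus gamma times the barrier, hence self-concordant with
   constant gamma^(-1/2) ([sc_quadratic_barrier]), and it is minimised at some v = (theta, b)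
   ([barrier_minimiser], [partial_minimiser]). Putting the sample z back adds the square of a
   linear form of (theta, b). A self-concordant function is so well approximated by its quadratic
   model at the minimum that the new value is
<<
     Phi0 + x^2 / (2 (n + g)) + O (|x|^3 / (n sqrt (n gamma))),
>>
   where x = b - <z, theta> is the residual of z at v, and g is the inverse Hessian at v evaluated
   at z, a quadratic polynomial in z ([perturbed_ge], [perturbed_le], [quadratic_model],
   [partial_expansion]). When |x| / sqrt (n gamma) is not small, the cubic term exceeds the crude
   bounds 0 and x^2 / (2 n) on the increase, so the expansion holds in all cases.

   Now average over z. The mean of x^2 depends on the covariance only. The polynomial g fluctuates
   little: the Frobenius norm of its quadratic part is at most sqrt (dim V) / (2 beta lambda), so
   (F2) for W, and Wick's formula for G, bound its variance, and this is the origin of the factor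
   sqrt (dim V) (tau / lambda + 1). Replacing g by its mean, which is the same for both laws, makes
   the main term the same for W and G ([one_coordinate]). What is left involves the square of
   Phi0 / beta, whose mean is at most a multiple of Lambda_ref^2, as one sees by testing the
   objective at a nearly optimal theta with b = 0 ([fourth_bound_mean]). The sum over the n samples
   is the first assertion ([value_comparison]). For the variances, the Efron-Stein inequality is
   applied with the values that leave out one sample as comparison functions: the increase is at
   most x^2 / (2 n), so each of the n terms is of order Lambda_ref^2 / n^2 ([value_variance]).
   Chebyshev's inequality for the difference gives the tail bound.

   Two points need care. The barrier is differentiable along line segments only, and that its
   second derivative is a quadratic form in the direction has to be derived from the bound on the
   third derivative ([sc_parallelogram], [parallelogram_quad], [barrier_hessian]). And the
   minimiser v depends on the other samples in an uncontrolled way; all estimates on one sample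
   are therefore made for fixed values of the others, so that only the values themselves have to
   be measurable, and they are because their sublevel sets are open
   ([measurable_open_sublevel]). *)

Set Implicit Arguments.
Unset Strict Implicit.
Unset Printing Implicit Defensive.

Import Order.TTheory GRing.Theory Num.Theory.
Import numFieldNormedType.Exports.

Local Open Scope classical_set_scope.
Local Open Scope ring_scope.

(** * Bilinear forms and the Euclidean, Frobenius and operator norms *)

Section Forms.
Context {R : realType}.

(** Quadratic forms, scalar products and matrix entries are all values of one bilinear form, so
   the algebra below is done once, by bilinearity. *)
Definition bil (m p : nat) (A : 'M[R]_(m, p)) (x : 'rV[R]_m) (y : 'rV[R]_p) : R :=
  (x *m A *m y^T) 0 0.

Lemma bilDl m p (A : 'M[R]_(m, p)) x x' y : bil A (x + x') y = bil A x y + bil A x' y.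
Proof. by rewrite /bil !mulmxDl mxE. Qed.

Lemma bilDr m p (A : 'M[R]_(m, p)) x y y' : bil A x (y + y') = bil A x y + bil A x y'.
Proof. by rewrite /bil linearD /= mulmxDr mxE. Qed.

Lemma bilZl m p (A : 'M[R]_(m, p)) c x y : bil A (c *: x) y = c * bil A x y.
Proof. by rewrite /bil -!scalemxAl mxE. Qed.

Lemma bilZr m p (A : 'M[R]_(m, p)) c x y : bil A x (c *: y) = c * bil A x y.
Proof. by rewrite /bil linearZ /= -scalemxAr mxE. Qed.

Lemma bilC m (A : 'M[R]_m) x y : A^T = A -> bil A x y = bil A y x.
Proof.
move=> sA; rewrite /bil.
have -> : x *m A *m y^T = (y *m A *m x^T)^T by rewrite !trmx_mul trmxK sA mulmxA.
by rewrite mxE.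
Qed.

Lemma bil_mulmxl m p q (B : 'M[R]_(q, m)) (A : 'M[R]_(m, p)) x y :
  bil A (x *m B) y = bil (B *m A) x y.
Proof. by rewrite /bil !mulmxA. Qed.

Lemma bil_mulmxr m p q (B : 'M[R]_(q, p)) (A : 'M[R]_(m, p)) x y :
  bil A x (y *m B) = bil (A *m B^T) x y.
Proof. by rewrite /bil trmx_mul !mulmxA. Qed.

Lemma bil_sum m p (A : 'M[R]_(m, p)) x y :
  bil A x y = \sum_i \sum_j x 0 i * A i j * y 0 j.
Proof.
rewrite /bil mxE exchange_big /=; apply: eq_bigr => j _.
by rewrite mxE mulr_suml; apply: eq_bigr => i _; rewrite !mxE.
Qed.

Lemma quadE m (A : 'M[R]_m) x : quad A x = bil A x x. Proof. by []. Qed.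

Lemma dotE m (x y : 'rV[R]_m) : dot x y = bil 1%:M x y.
Proof. by rewrite /bil mulmx1 mxE; apply: eq_bigr => j _; rewrite !mxE. Qed.

Lemma dotC m (x y : 'rV[R]_m) : dot x y = dot y x.
Proof. by rewrite !dotE bilC // trmx1. Qed.

Lemma dotDl m (x x' y : 'rV[R]_m) : dot (x + x') y = dot x y + dot x' y.
Proof. by rewrite !dotE bilDl. Qed.

Lemma dotDr m (x y y' : 'rV[R]_m) : dot x (y + y') = dot x y + dot x y'.
Proof. by rewrite !dotE bilDr. Qed.

Lemma dotZl m c (x y : 'rV[R]_m) : dot (c *: x) y = c * dot x y.
Proof. by rewrite !dotE bilZl. Qed.

Lemma dotZr m c (x y : 'rV[R]_m) : dot x (c *: y) = c * dot x y.
Proof. by rewrite !dotE bilZr. Qed.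

Lemma dotNr m (x y : 'rV[R]_m) : dot x (- y) = - dot x y.
Proof. by rewrite -scaleN1r dotZr mulN1r. Qed.

Lemma dotBr m (x y z : 'rV[R]_m) : dot x (y - z) = dot x y - dot x z.
Proof. by rewrite dotDr dotNr. Qed.

Lemma dot0r m (x : 'rV[R]_m) : dot x 0 = 0.
Proof. by rewrite -(scale0r 0) dotZr mul0r. Qed.

Lemma bil_dot m p (A : 'M[R]_(m, p)) x y : bil A x y = dot (x *m A) y.
Proof. by rewrite dotE bil_mulmxl mulmx1. Qed.

Lemma dot_mulmxl m p (A : 'M[R]_(m, p)) x y : dot (x *m A) y = dot x (y *m A^T).
Proof. by rewrite -bil_dot dotE bil_mulmxr mul1mx trmxK. Qed.

Lemma dotxx_ge0 m (x : 'rV[R]_m) : 0 <= dot x x.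
Proof. by apply: sumr_ge0 => j _; rewrite -expr2 sqr_ge0. Qed.

Lemma dotxx_eq0 m (x : 'rV[R]_m) : (dot x x == 0) = (x == 0).
Proof.
apply/idP/eqP => [|->]; last by rewrite dot0r.
rewrite psumr_eq0 => [/allP x0|j _]; last by rewrite -expr2 sqr_ge0.
apply/rowP => j; rewrite mxE; have := x0 j; rewrite mem_index_enum => /(_ isT).
by rewrite mulf_eq0 orbb => /eqP.
Qed.

Lemma norm2_ge0 m (x : 'rV[R]_m) : 0 <= norm2 x. Proof. exact: sqrtr_ge0. Qed.

Lemma norm2_sqr m (x : 'rV[R]_m) : norm2 x ^+ 2 = dot x x.
Proof. by rewrite sqr_sqrtr// dotxx_ge0. Qed.

Lemma normF_sqr m (A : 'M[R]_m) : normF A ^+ 2 = \tr (A *m A^T).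
Proof.
rewrite sqr_sqrtr; last by do 2!apply: sumr_ge0 => ? _; rewrite sqr_ge0.
by apply: eq_bigr => i _; rewrite mxE; apply: eq_bigr => j _; rewrite mxE -expr2.
Qed.

Lemma normF_sqr_rows m (A : 'M[R]_m) : normF A ^+ 2 = \sum_i dot (row i A) (row i A).
Proof.
rewrite normF_sqr; apply: eq_bigr => i _; rewrite mxE /dot.
by apply: eq_bigr => j _; rewrite !mxE.
Qed.

(** Evaluate at the vertex; when c = 0 the polynomial is affine, and b must vanish. *)
Lemma discr_le0 (a b c : R) : (forall t, 0 <= a + 2 * b * t + c * t ^+ 2) -> b ^+ 2 <= a * c.
Proof.
move=> h; have [c0|c0] := eqVneq c 0.
  rewrite c0 mulr0; have [->|b0] := eqVneq b 0; first by rewrite expr0n.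
  have := h (- (a + 1) * (2 * b)^-1); rewrite c0 mul0r addr0.
  rewrite mulrCA divff ?mulf_neq0// mulr1 => ?; lra.
have cge0 : 0 <= c.
  rewrite leNgt; apply/negP => clt0.
  have a0 : 0 <= a by have := h 0; rewrite expr0n /= !mulr0 !addr0.
  have c2 : 0 < (- c)^-1 by rewrite invr_gt0 oppr_gt0.
  have cc : c * (- c)^-1 = -1 by rewrite -[X in X * _]opprK mulNr mulfV ?oppr_eq0.
  have := h (1 + (a + 1) * (- c)^-1); have := h (- (1 + (a + 1) * (- c)^-1)).
  set u := _^-1 in c2 cc *; set t := 1 + _ => h1 h2.
  have ct : c * t = c - (a + 1).
    rewrite /t; have -> : c * (1 + (a + 1) * u) = c + (a + 1) * (c * u).
      lra.
    by rewrite cc; lra.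
  have t1 : 1 <= t by rewrite lerDl mulr_ge0// ?addr_ge0// ltW.
  have : 0 <= a + (c * t) * t by lra.
  by rewrite ct => ?; nra.
have cgt0 : 0 < c by rewrite lt0r c0.
have := h (- b / c).
have cc : c * c^-1 = 1 by rewrite divff.
set u := c^-1 in cc *.
have -> : a + 2 * b * (- b * u) + c * (- b * u) ^+ 2
    = a - 2 * (b ^+ 2) * u + b ^+ 2 * u * (c * u) by lra.
rewrite cc => h1; have : 0 <= (a - b ^+ 2 * u) * c by apply: mulr_ge0; lra.
have -> : (a - b ^+ 2 * u) * c = a * c - b ^+ 2 * (c * u) by lra.
by rewrite cc; lra.
Qed.

(** Apply the discriminant bound to the form restricted to the line x + t y. *)
Lemma bil_CS m (A : 'M[R]_m) x y : A^T = A -> (forall z, 0 <= quad A z) ->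
  bil A x y ^+ 2 <= quad A x * quad A y.
Proof.
move=> sA pA; apply: discr_le0 => t; have := pA (x + t *: y).
rewrite !quadE bilDl !bilDr !(bilZl, bilZr) (bilC y x sA).
by rewrite [X in 0 <= X -> _](_ : _ = bil A x x + 2 * bil A x y * t + bil A y y * t ^+ 2)//; lra.
Qed.

Lemma dot_CS m (x y : 'rV[R]_m) : dot x y ^+ 2 <= dot x x * dot y y.
Proof.
rewrite !dotE; apply: bil_CS => [|z]; first by rewrite trmx1.
by rewrite quadE -dotE dotxx_ge0.
Qed.

(** Makes the supremum that defines the operator norm finite. *)
Lemma norm2_mul_le m (A : 'M[R]_m) x : norm2 (x *m A) <= normF A * norm2 x.
Proof.
rewrite -(@ler_pXn2r _ 2)// ?nnegrE ?mulr_ge0 ?sqrtr_ge0// exprMn !norm2_sqr.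
have -> : normF A ^+ 2 = \sum_j dot (col j A)^T (col j A)^T.
  rewrite sqr_sqrtr; last by do 2!apply: sumr_ge0 => ? _; rewrite sqr_ge0.
  rewrite exchange_big; apply: eq_bigr => j _.
  by apply: eq_bigr => i _; rewrite !mxE expr2.
rewrite [leLHS]/dot mulr_suml; apply: ler_sum => j _.
have -> : (x *m A) 0 j = dot x (col j A)^T by rewrite mxE; apply: eq_bigr => k _; rewrite !mxE.
by rewrite -expr2 (le_trans (dot_CS _ _))// mulrC.
Qed.

Lemma norm2Z m c (x : 'rV[R]_m) : norm2 (c *: x) = `|c| * norm2 x.
Proof. by rewrite /norm2 dotZl dotZr mulrA -expr2 sqrtrM ?sqr_ge0// sqrtr_sqr. Qed.

Lemma op_norm_bound m (A : 'M[R]_m) x : norm2 (x *m A) <= op_norm A * norm2 x.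
Proof.
have [/eqP x0|x0] := boolP (norm2 x == 0).
  by rewrite (le_trans (norm2_mul_le _ _))// x0 !mulr0.
have x1 : 0 < norm2 x by rewrite lt0r x0 norm2_ge0.
rewrite -ler_pdivrMr//.
have -> : norm2 (x *m A) / norm2 x = norm2 ((norm2 x)^-1 *: x *m A).
  by rewrite -scalemxAl norm2Z gtr0_norm ?invr_gt0// mulrC.
apply: sup_upper_bound; last first.
  exists ((norm2 x)^-1 *: x) => //=.
  by rewrite norm2Z gtr0_norm ?invr_gt0// mulVf.
split.
  by exists (norm2 (0 *m A)); exists 0 => //=; rewrite /norm2 dot0r sqrtr0.
exists (normF A) => _ [y /= y1 <-].
by rewrite (le_trans (norm2_mul_le _ _))// ler_piMr// sqrtr_ge0.
Qed.

(** The form is a scalar product with x A, so Cauchy-Schwarz and the operator norm bound it. *)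
Lemma quad_op_norm m (A : 'M[R]_m) x : quad A x <= op_norm A * dot x x.
Proof.
rewrite quadE bil_dot.
have CS : dot (x *m A) x <= norm2 (x *m A) * norm2 x.
  rewrite (le_trans (ler_norm _))// -(@ler_pXn2r _ 2)// ?nnegrE ?mulr_ge0 ?norm2_ge0//.
  by rewrite exprMn !norm2_sqr real_normK ?num_real// dot_CS.
rewrite (le_trans CS)// -norm2_sqr expr2 mulrA ler_wpM2r ?norm2_ge0//.
exact: op_norm_bound.
Qed.

End Forms.

(** * Inverting a positive form on a subspace *)

Section Projection.
Context {R : realType} (N : nat).

(** With E the matrix whose rows are a basis of V, the projection is E^T (E E^T)^-1 E; its
   squared Frobenius norm is its trace, the dimension. *)
Lemma orthogonal_projection (V : {vspace 'rV[R]_N}) :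
  exists Pi : 'M[R]_N, [/\ Pi^T = Pi, Pi *m Pi = Pi,
    forall h, h \in V <-> h *m Pi = h & normF Pi ^+ 2 = (\dim V)%:R].
Proof.
pose E : 'M[R]_(\dim V, N) := \matrix_i (vbasis V)`_i.
have mulE (x : 'rV_(\dim V)) : x *m E = \sum_i x 0 i *: (vbasis V)`_i.
  by rewrite mulmx_sum_row; apply: eq_bigr => i _; rewrite rowK.
have injE (x : 'rV_(\dim V)) : x *m E = 0 -> x = 0.
  move=> xE; have /freeP := basis_free (vbasisP V) => /(_ (fun i => x 0 i)).
  by rewrite -mulE => /(_ xE) x0; apply/rowP => i; rewrite x0 mxE.
pose M := E *m E^T.
have uM : M \in unitmx.
  rewrite -row_free_unit; apply: inj_row_free => x xM0; apply: injE.
  apply/eqP; rewrite -dotxx_eq0 dot_mulmxl -mulmxA -/M xM0.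
  by rewrite dot0r.
have sM : M^T = M by rewrite /M trmx_mul trmxK.
have EV i : (vbasis V)`_i \in V.
  have [ik|ik] := ltnP i (\dim V); last by rewrite nth_default ?mem0v// size_tuple.
  by apply: vbasis_mem; rewrite mem_nth// size_tuple.
exists (E^T *m invmx M *m E); split.
- by rewrite !trmx_mul trmx_inv trmxK sM mulmxA.
- rewrite !mulmxA -(mulmxA (E^T *m invmx M)) -/M.
  by rewrite -(mulmxA E^T) mulVmx// mulmx1.
- move=> h; split => [hV|<-].
    have -> : h = (\row_i coord (vbasis V) i h) *m E.
      rewrite mulE [LHS](coord_vbasis hV).
      by apply: eq_bigr => i _; rewrite mxE.
    by rewrite !mulmxA -(mulmxA _ E) -/M -(mulmxA _ M) mulmxV// mulmx1.
  by rewrite mulmxA mulE; apply: memv_suml => i _; apply: memvZ.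
- rewrite normF_sqr !trmx_mul trmx_inv sM trmxK !mulmxA.
  rewrite -(mulmxA (E^T *m invmx M)) -/M -(mulmxA E^T) mulVmx// mulmx1.
  by rewrite mxtrace_mulC mulmxA -/M mulmxV// mxtrace1.
Qed.

End Projection.

Section QuadraticModel.
Context {R : realType} (N : nat).
Implicit Types (h z : 'rV[R]_N) (c : R).

(** The unknown is the pair (theta, b), and the sample z acts on it through the vector (-z, 1).
   *)
Definition augment h c : 'rV[R]_(N + 1) := row_mx h c%:M.

Lemma augmentD h h' c c' : augment (h + h') (c + c') = augment h c + augment h' c'.
Proof. by rewrite /augment raddfD /= add_row_mx. Qed.

Lemma augmentZ t h c : augment (t *: h) (t * c) = t *: augment h c.
Proof. by rewrite /augment scale_row_mx scale_scalar_mx. Qed.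

Lemma dot_augment h h' c c' : dot (augment h c) (augment h' c') = dot h h' + c * c'.
Proof.
rewrite /dot big_split_ord /= big_ord1; congr (_ + _).
  by apply: eq_bigr => j _; rewrite !row_mxEl.
by rewrite !row_mxEr !mxE /= !mulr1n.
Qed.

Lemma augment_surj (v : 'rV[R]_(N + 1)) : exists h c, v = augment h c.
Proof.
exists (lsubmx v), (rsubmx v 0 0).
by rewrite /augment -mx11_scalar hsubmxK.
Qed.

(** Square-completion form of the inequality: the inverse of a form above lam I is below I /
   lam. *)
Lemma complete_square (a b p lam : R) : 0 < lam -> 0 <= a - 2 * lam * p + lam ^+ 2 * b ->
  2 * p - lam * b <= a / lam.
Proof. by move=> l0 ab; rewrite ler_pdivlMr//; lra. Qed.

(** The Newton decrement of a sample. Let H be a form on V x R that dominates 2 bet (lam |h|^2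
   + c^2), and let a_z be the functional (h, c) -> c - <z, h>. Then g(z) is the inverse of H
   evaluated at a_z: it is attained at H^-1 a_z and satisfies the Cauchy-Schwarz bound of the
   last clause. It is a quadratic polynomial in z, and its coefficients are blocks of the
   inverse of H on V x R; since these vanish off V, their Frobenius norms only see the
   dimension of V, which is where the factor sqrt (dim V) of the theorem comes from. *)
Lemma quadratic_model (V : {vspace 'rV[R]_N}) (lam bet : R) (H : 'M[R]_(N + 1)) :
  0 < lam -> 0 < bet -> H^T = H ->
  (forall h c, h \in V -> 2 * bet * (lam * dot h h + c ^+ 2) <= quad H (augment h c)) ->
  exists (T : 'M[R]_N) (u : 'rV[R]_N) (e : R),
  [/\ T^T = T,
      normF T ^+ 2 <= (\dim V)%:R / (2 * bet * lam) ^+ 2,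
      dot u u <= (\dim V)%:R / (4 * bet ^+ 2 * lam) &
      forall z, let g := quad T z - 2 * dot u z + e in
        (exists h c, [/\ h \in V, c - dot z h = g & quad H (augment h c) = g])
        /\ (forall h c, h \in V -> (c - dot z h) ^+ 2 <= g * quad H (augment h c))].
Proof.
move=> lam0 bet0 sH Hge.
have [Pi [sPi iPi PiV trPi]] := orthogonal_projection V.
pose P := block_mx Pi 0 0 (1%:M : 'M[R]_1).
(* H is controlled on V only: compress it to V by P and complete it by a multiple of the
   identity on the orthogonal complement, which makes it invertible and keeps the lower bound.
   *)
pose Q := block_mx ((2 * bet * lam) *: (1%:M - Pi)) 0 0 (0 : 'M[R]_1).
have sP : P^T = P by rewrite /P tr_block_mx sPi !trmx0 trmx1.
have iP : P *m P = P.
  by rewrite /P mulmx_block !mulmx0 !mul0mx !addr0 add0r iPi mulmx1.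
have aP h c : augment h c *m P = augment (h *m Pi) c.
  by rewrite /P /augment mul_row_block !mulmx0 addr0 add0r mulmx1.
have QP : Q *m P = 0.
  rewrite /Q /P mulmx_block !mulmx0 !mul0mx !addr0 -scalemxAl mulmxBl mul1mx iPi.
  by rewrite subrr scaler0 -block_mx0.
have sQ : Q^T = Q.
  by rewrite /Q tr_block_mx linearZ /= linearB /= sPi trmx1 !trmx0.
have PQ : P *m Q = 0 by rewrite -[LHS]trmxK trmx_mul sP sQ QP trmx0.
pose H' := P *m H *m P + Q.
have sH' : H'^T = H' by rewrite /H' linearD /= !trmx_mul sP sH sQ mulmxA.
have quadQ h c : quad Q (augment h c) = 2 * bet * lam * (dot h h - dot (h *m Pi) (h *m Pi)).
  rewrite quadE bil_dot /Q /augment mul_row_block !mulmx0 !addr0.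
  have -> : row_mx (h *m (2 * bet * lam *: (1%:M - Pi))) (0 : 'rV_1)
     = augment (h *m (2 * bet * lam *: (1%:M - Pi))) 0.
    by rewrite /augment; congr row_mx; apply/rowP => i; rewrite !mxE mul0rn.
  rewrite dot_augment mul0r addr0 -scalemxAr dotZl mulmxBr mulmx1; congr (_ * _).
  rewrite (dot_mulmxl Pi h (h *m Pi)) sPi -mulmxA iPi.
  by rewrite dotC dotBr; congr (_ - _); rewrite dotC.
have quadH' v : quad H' v = quad H (v *m P) + quad Q v.
  rewrite /quad /H' mulmxDr mulmxDl mxE; congr (_ + _).
  by rewrite trmx_mul sP !mulmxA.
have H'ge h c : 2 * bet * (lam * dot h h + c ^+ 2) <= quad H' (augment h c).
  rewrite quadH' quadQ aP.
  have /PiV hV : (h *m Pi) *m Pi = h *m Pi by rewrite -mulmxA iPi.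
  by have := Hge _ c hV; lra.
have pH' v : 0 <= quad H' v.
  have [h [c ->]] := augment_surj v; apply: le_trans (H'ge h c).
  apply: mulr_ge0; first by lra.
  by apply: addr_ge0; [apply: mulr_ge0; [exact: ltW|exact: dotxx_ge0]|exact: sqr_ge0].
have uH' : H' \in unitmx.
  rewrite -row_free_unit; apply: inj_row_free => v vH0.
  have [h [c vE]] := augment_surj v.
  have := H'ge h c; rewrite -vE quadE bil_dot vH0 dotC dot0r => hc0.
  have [h0 c0] : dot h h = 0 /\ c ^+ 2 = 0.
    have := dotxx_ge0 h; have := sqr_ge0 c.
    have bl : 0 < bet * lam by rewrite mulr_gt0.
    by move=> ? ?; split; nra.
  move/eqP: h0; rewrite dotxx_eq0 => /eqP h0; move/eqP: c0; rewrite sqrf_eq0 => /eqP c0.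
  by rewrite vE h0 c0 /augment raddf0 row_mx0.
pose A := invmx H'.
have sA : A^T = A by rewrite /A trmx_inv sH'.
have H'A : H' *m A = 1%:M by rewrite mulmxV.
have AH' : A *m H' = 1%:M by rewrite mulVmx.
have H'P : H' *m P = P *m H'.
  by rewrite /H' mulmxDl mulmxDr QP PQ !addr0 -!mulmxA iP !mulmxA iP.
have AP : A *m P = P *m A.
  by rewrite -[LHS]mulmx1 -H'A mulmxA -(mulmxA A) -H'P !mulmxA AH' mul1mx.
have quadA v : quad H' (v *m A) = quad A v.
  by rewrite /quad trmx_mul sA -!mulmxA (mulmxA H') H'A mul1mx.
have Ale h c : quad A (augment h c) <= (2 * bet)^-1 * (dot h h / lam + c ^+ 2).
  have [h1 [c1 vA]] := augment_surj (augment h c *m A).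
  have q1 : quad A (augment h c) = dot h h1 + c * c1.
    by rewrite quadE bil_dot vA dotC dot_augment.
  have q2 := H'ge h1 c1; rewrite -vA quadA in q2.
  have sq : 0 <= dot h h - 2 * (2 * bet * lam) * dot h h1 + (2 * bet * lam) ^+ 2 * dot h1 h1.
    have := dotxx_ge0 (h - (2 * bet * lam) *: h1).
    rewrite dotBr !dotZr dotC dotBr (dotC _ h1) dotBr !dotZr (dotC h1 h).
    by move=> /le_trans; apply; lra.
  have bl : 0 < 2 * bet * lam by rewrite !mulr_gt0.
  have b2 : 0 < 2 * bet by rewrite !mulr_gt0.
  have s1 := complete_square bl sq.
  have s2 : 2 * (c * c1) - 2 * bet * c1 ^+ 2 <= c ^+ 2 / (2 * bet).
    by apply: complete_square => //; have := sqr_ge0 (c - 2 * bet * c1); lra.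
  have -> : (2 * bet)^-1 * (dot h h / lam + c ^+ 2)
    = dot h h / (2 * bet * lam) + c ^+ 2 / (2 * bet).
    by rewrite mulrDr [in RHS]invfM; lra.
  by rewrite q1 in q2 *; lra.
have pA v : 0 <= quad A v by rewrite -quadA.
pose B := P *m A *m P.
have sB : B^T = B by rewrite /B !trmx_mul sP sA mulmxA.
have quadB v : quad B v = quad A (v *m P).
  by rewrite /quad trmx_mul sP !mulmxA.
have pB v : 0 <= quad B v by rewrite quadB.
have Ble h c : quad B (augment h c) <= (2 * bet)^-1 * (dot h h / lam + c ^+ 2).
  rewrite quadB aP (le_trans (Ale _ _))// ler_pM2l ?invr_gt0 ?mulr_gt0//.
  rewrite lerD2r ler_pM2r ?invr_gt0//.
  have := dotxx_ge0 (h *m (1%:M - Pi)).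
  have -> : dot (h *m (1%:M - Pi)) (h *m (1%:M - Pi)) = dot h (h *m ((1%:M - Pi) *m (1%:M - Pi))).
    by rewrite dot_mulmxl [X in _ *m X](_ : _ = 1%:M - Pi) ?mulmxA// linearB /= sPi trmx1.
  have -> : (1%:M - Pi) *m (1%:M - Pi) = 1%:M - Pi.
    by rewrite mulmxBr mulmx1 mulmxBl mul1mx iPi subrr subr0.
  by rewrite mulmxBr mulmx1 dotBr subr_ge0 dot_mulmxl sPi -mulmxA iPi.
pose J : 'M[R]_(N, N + 1) := row_mx 1%:M 0.
have zJ z : z *m J = augment z 0.
  rewrite /J mul_mx_row mulmx1 mulmx0 /augment; congr row_mx.
  by apply/rowP => i; rewrite !mxE mul0rn.
have JP : J *m P = Pi *m J.
  by rewrite /J /P mul_row_block mul_mx_row !mulmx0 !mul1mx !mulmx1 addr0 add0r.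
have BP : B *m P = B by rewrite /B -!mulmxA iP.
have PB : P *m B = B by rewrite /B !mulmxA iP.
clearbody B.
pose w := augment 0 1.
pose T := J *m B *m J^T.
pose u := w *m B *m J^T.
pose e := quad B w.
have sT : T^T = T by rewrite /T !trmx_mul trmxK sB mulmxA.
have PJT : P *m J^T = J^T *m Pi by rewrite -[LHS]trmxK trmx_mul trmxK sP JP trmx_mul sPi.
have TPi : T *m Pi = T by rewrite /T -mulmxA -PJT mulmxA -(mulmxA J) BP.
have PiT : Pi *m T = T by rewrite -[LHS]trmxK trmx_mul sT sPi TPi sT.
have uPi : u *m Pi = u by rewrite /u -mulmxA -PJT mulmxA -(mulmxA w) BP.
have quadT z : quad T z = quad B (augment z 0).
  by rewrite -zJ /quad trmx_mul !mulmxA.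
have dotu z : dot u z = bil B w (augment z 0).
  by rewrite -zJ bil_mulmxr bil_dot mulmxA.
have bl : 0 < 2 * bet * lam by rewrite !mulr_gt0.
have Tle z : quad T z <= (2 * bet * lam)^-1 * dot z z.
  by rewrite quadT (le_trans (Ble _ _))// expr0n addr0 [in leRHS]invfM mulrA mulrAC.
have ele : e <= (2 * bet)^-1.
  by rewrite /e (le_trans (Ble _ _))// dot0r mul0r add0r expr1n mulr1.
exists T, u, e; split => //.
- have key (x : 'rV[R]_N) : dot (x *m T) (x *m T) <= dot x x / (2 * bet * lam) ^+ 2.
    set y := x *m T.
    have [->|y0] := eqVneq (dot y y) 0.
      by rewrite divr_ge0 ?dotxx_ge0 ?sqr_ge0.
    have ygt0 : 0 < dot y y by rewrite lt0r y0 dotxx_ge0.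
    have : dot y y ^+ 2 <= quad T x * quad T y.
      by rewrite -{1}/y {1}/y -bil_dot bil_CS// => z; rewrite quadT.
    move=> /le_trans /(_ (ler_pM _ _ (Tle x) (Tle y))).
    rewrite !quadT !pB => /(_ isT isT).
    by rewrite expr2 mulrACA mulrA ler_pM2r// -invfM -expr2 mulrC.
  rewrite normF_sqr_rows -trPi normF_sqr_rows mulr_suml; apply: ler_sum => i _.
  rewrite -[in leLHS]PiT row_mul; exact: key.
- have [k0|k0] := eqVneq (\dim V) 0%N.
    have : u \in V by apply/PiV.
    move/eqP: k0; rewrite dimv_eq0 => /eqP ->; rewrite memv0 => /eqP ->.
    by rewrite dot0r divr_ge0// !mulr_ge0 ?sqr_ge0 ?ltW.
  have [->|u0] := eqVneq (dot u u) 0.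
    by rewrite divr_ge0// !mulr_ge0 ?sqr_ge0 ?ltW.
  have ugt0 : 0 < dot u u by rewrite lt0r u0 dotxx_ge0.
  have : dot u u ^+ 2 <= quad B w * quad T u.
    by rewrite {1}dotu quadT bil_CS.
  move=> /le_trans /(_ (ler_pM _ _ ele (Tle u))).
  rewrite quadT !pB => /(_ isT isT).
  rewrite expr2 mulrA ler_pM2r// => /le_trans; apply.
  have k1 : 1 <= (\dim V)%:R :> R by rewrite ler1n lt0n.
  rewrite -invfM (_ : 2 * bet * (2 * bet * lam) = 4 * bet ^+ 2 * lam); last by lra.
  by rewrite ler_peMl// invr_ge0 !mulr_ge0 ?sqr_ge0// ltW.
- move=> z g.
  pose a := augment (- z) 1.
  have aE : a = w - z *m J.
    by rewrite zJ -scaleN1r -augmentZ -augmentD mulr0 addr0 scaleN1r add0r.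
  have gE : g = quad B a.
    rewrite aE quadE -(scaleN1r (z *m J)) bilDl !bilDr !(bilZl, bilZr) zJ /g quadT dotu /e !quadE.
    by rewrite (bilC (augment z 0) w sB); lra.
  have la h c : c - dot z h = dot a (augment h c).
    by rewrite dot_augment mul1r (dotC (- z)) dotNr (dotC h) addrC.
  have fixP h c : h \in V -> augment h c *m P = augment h c.
    by move=> /PiV hV; rewrite aP hV.
  have HH' h c : h \in V -> quad H (augment h c) = quad H' (augment h c).
    move=> hV; rewrite quadH' fixP// quadQ.
    by move/PiV: hV => ->; rewrite subrr mulr0 addr0.
  split.
    have [h [c yE]] := augment_surj (a *m P *m A).
    have hV : h \in V.
      apply/PiV; have : augment h c *m P = augment h c.
        by rewrite -yE -!mulmxA AP !mulmxA -(mulmxA a P P) iP.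
      by rewrite aP /augment => /eq_row_mx[].
    exists h, c; split => //.
      rewrite la -yE gE quadB quadE bil_dot [RHS]dotC dot_mulmxl sP.
      by rewrite -(mulmxA (a *m P)) AP mulmxA -(mulmxA a P P) iP.
    by rewrite HH'// -yE quadA gE quadB.
  move=> h c hV; rewrite la HH'// gE quadB.
  have -> : dot a (augment h c) = bil H' (a *m P *m A) (augment h c).
    rewrite bil_dot -(mulmxA _ A) AH' mulmx1 dot_mulmxl sP fixP//.
  by rewrite -quadA bil_CS.
Qed.

End QuadraticModel.

(** * Taylor bounds for self-concordant functions of one variable *)

Section OneVariable.
Context {R : realType}.
Implicit Types (f g p : R -> R) (a c e k l t : R).

Lemma is_derive_translate f t a l : is_derive (t + a) 1 f l ->
  is_derive t 1 (fun s => f (s + a)) l.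
Proof.
move=> df; have -> : (fun s => f (s + a)) = f \o (fun s => s + a) by [].
rewrite -[l]mulr1; apply: is_derive1_comp.
rewrite -[X in is_derive _ _ _ X]addr0; exact: is_deriveD.
Qed.

Lemma is_derive_dilate f t a l : is_derive (t * a) 1 f l ->
  is_derive t 1 (fun s => f (s * a)) (a * l).
Proof.
move=> df; have -> : (fun s => f (s * a)) = f \o (fun s => s * a) by [].
rewrite mulrC; apply: is_derive1_comp.
have -> : (fun s => s * a) = a \*: (@id R) by apply/funext => s /=; rewrite mulrC.
have := is_deriveZ (a : R^o) (is_derive_id t (1 : R)).
by rewrite /GRing.scale /= mulr1.
Qed.

Lemma le_of_derive_ge0 f g : (forall t, 0 <= t <= 1 -> is_derive t 1 f (g t)) ->
  (forall t, 0 <= t <= 1 -> 0 <= g t) -> forall t, 0 <= t <= 1 -> f 0 <= f t.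
Proof.
move=> df g0 t /andP[t0 t1]; rewrite -subr_ge0.
have sub s : s \in `[0, t] -> 0 <= s <= 1.
  by rewrite in_itv /= => /andP[-> /le_trans]; apply.
have [s st ->] : exists2 s, s \in `[0, t]%R & f t - f 0 = g s * (t - 0).
  apply: MVT_segment => //.
    by move=> s; rewrite in_itv /= => /andP[s0 st]; apply/df/sub; rewrite in_itv /= !ltW.
  apply: derivable_within_continuous => s /sub s01.
  exact: (@ex_derive _ _ _ _ _ _ _ (df s s01)).
by rewrite subr0 mulr_ge0// g0// sub.
Qed.

(** One-sided difference quotients suffice to bound a derivative; used at minima and for convex
   functions. *)
Lemma derive_le_slope f t l c e : is_derive t 1 f l -> 0 < e ->
  (forall s, 0 < s < e -> f (t + s) - f t <= c * s) -> l <= c.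
Proof.
move=> [df <-] e0 fc; rewrite leNgt; apply/negP => cl.
have /cvgr_gt/(_ c cl) [e' /= e'0 h] : (fun h => h^-1 *: ((f \o shift t) (h *: 1) - f t)) @ 0^' --> 'D_1 f t := df.
pose s := Num.min e e' / 2.
have s0 : 0 < s by rewrite divr_gt0// lt_min e0.
have se : s < Num.min e e' by rewrite gtr_pMr ?lt_min ?e0// invf_lt1// ltr1n.
have := fc s; rewrite s0 (lt_le_trans se) ?ge_min ?lexx// => /(_ isT).
apply/negP; rewrite -ltNge.
have := h s; rewrite /ball /= sub0r normrN gtr0_norm// (lt_le_trans se) ?ge_min ?lexx ?orbT//.
move=> /(_ isT (lt0r_neq0 s0)).
by rewrite /= /GRing.scale /= mulr1 (addrC s t) mulrC ltr_pdivlMr.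
Qed.

(** The inequality |p'| <= 2 k p^(3/2) says that p^(-1/2) is k-Lipschitz. *)
Lemma sqrt_self_concordant p (p' : R -> R) k : 0 <= k ->
  (forall t, 0 <= t <= 1 -> is_derive t 1 p (p' t)) ->
  (forall t, 0 <= t <= 1 -> 0 < p t) ->
  (forall t, 0 <= t <= 1 -> `|p' t| <= 2 * k * Num.sqrt (p t) ^+ 3) ->
  forall t, 0 <= t <= 1 ->
  Num.sqrt (p 0) <= Num.sqrt (p t) * (1 + k * Num.sqrt (p 0) * t) /\
  Num.sqrt (p t) * (1 - k * Num.sqrt (p 0) * t) <= Num.sqrt (p 0).
Proof.
move=> k0 dp p0 p'le t t01.
pose q (t : R) : R := (Num.sqrt (p t))^-1.
pose q' (t : R) : R := - (Num.sqrt (p t)) ^- 2 * ((2 * Num.sqrt (p t))^-1 * p' t).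
have sp (s : R) : 0 <= s <= 1 -> 0 < Num.sqrt (p s) by move=> /p0; rewrite sqrtr_gt0.
have dq (s : R) : 0 <= s <= 1 -> is_derive s 1 q (q' s).
  move=> s01; apply: is_deriveV; first by rewrite lt0r_neq0// sp.
  apply: (@is_derive1_comp _ Num.sqrt p).
  - exact: is_derive1_sqrt (p0 s s01).
  - exact: dp.
have q'le (s : R) : 0 <= s <= 1 -> `|q' s| <= k.
  move=> s01; rewrite /q' mulrA normrM mulNr normrN -invfM.
  have s0 := sp s s01.
  have a0 : 0 < Num.sqrt (p s) ^+ 2 * (2 * Num.sqrt (p s)) by rewrite !mulr_gt0 ?exprn_gt0.
  rewrite normfV (gtr0_norm a0) ler_pdivrMl//.
  by have := p'le s s01; lra.
have h0 : 0 <= (0 : R) <= 1 by rewrite lexx ler01.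
have q1 : q 0 + k * 0 <= q t + k * t.
  apply: (le_of_derive_ge0 (f := fun s => q s + k * s) (g := fun s => q' s + k * 1)) => //.
    by move=> s s01; exact: (is_deriveD (dq s s01) (is_deriveZ k (is_derive_id s (1 : R)))).
  by move=> s s01; have := q'le s s01; rewrite ler_norml mulr1; lra.
have q2 : - q 0 + k * 0 <= - q t + k * t.
  apply: (le_of_derive_ge0 (f := fun s => - q s + k * s) (g := fun s => - q' s + k * 1)) => //.
    by move=> s s01; exact: (is_deriveD (is_deriveN (dq s s01)) (is_deriveZ k (is_derive_id s (1 : R)))).
  by move=> s s01; have := q'le s s01; rewrite ler_norml mulr1; lra.
have s0 := sp 0 h0; have st := sp t t01.
have e0 : Num.sqrt (p 0) * q 0 = 1 by rewrite divff// lt0r_neq0.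
have et : Num.sqrt (p t) * q t = 1 by rewrite divff// lt0r_neq0.
move: q1 q2 e0 et s0 st; set a := Num.sqrt (p 0); set b := Num.sqrt (p t).
move: (q 0) (q t) => x y q1 q2 e0 et s0 st.
have ab : 0 < a * b by rewrite mulr_gt0.
have r1 : (a * b) * (x + k * 0) <= (a * b) * (y + k * t) by rewrite ler_pM2l.
have r2 : (a * b) * (- x + k * 0) <= (a * b) * (- y + k * t) by rewrite ler_pM2l.
have xa : a * b * x = b by rewrite mulrAC e0 mul1r.
have yb : a * b * y = a by rewrite -mulrA et mulr1.
by split; lra.
Qed.

(** Integrate an affine lower bound of the second derivative twice. *)
Lemma taylor2_ge f (f1 : R -> R) p a c :
  (forall t, 0 <= t <= 1 -> is_derive t 1 f (f1 t)) ->
  (forall t, 0 <= t <= 1 -> is_derive t 1 f1 (p t)) ->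
  (forall t, 0 <= t <= 1 -> a + c * t <= p t) ->
  f 0 + f1 0 + a / 2 + c / 6 <= f 1.
Proof.
move=> df df1 lep.
have dX (t : R) n : is_derive t 1 (fun s => s ^+ n.+1) (n.+1%:R * t ^+ n).
  have -> : (fun s : R => s ^+ n.+1) = id ^+ n.+1 by apply/funext => s; rewrite exprfctE.
  have := is_deriveX n.+1 (is_derive_id t (1 : R)).
  by move=> /is_derive_eq; apply; rewrite /GRing.scale /= mulr1.
have dP (b1 b2 b3 t : R) : is_derive t 1 (fun s => b1 * s + b2 * s ^+ 2 + b3 * s ^+ 3)
    (b1 + 2 * b2 * t + 3 * b3 * t ^+ 2).
  have D2 := is_deriveZ b1 (is_derive_id t (1 : R)).
  have D3 := is_deriveZ b2 (dX t 1%N); have D4 := is_deriveZ b3 (dX t 2).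
  have := is_deriveD (is_deriveD D2 D3) D4.
  by move=> /is_derive_eq; apply; rewrite /GRing.scale /= expr1; lra.
have g1 (t : R) : 0 <= t <= 1 -> f1 0 + a * t + c / 2 * t ^+ 2 <= f1 t.
  move=> t01.
  have := @le_of_derive_ge0 (fun s => f1 s - (a * s + c / 2 * s ^+ 2 + 0 * s ^+ 3))
    (fun s => p s - (a + 2 * (c / 2) * s + 3 * 0 * s ^+ 2)).
  rewrite /= => /(_ _ _ t t01) H; have := H _ _; rewrite !expr0n /= => {}H.
  suff : f1 0 - (a * 0 + c / 2 * 0 + 0 * 0) <= f1 t - (a * t + c / 2 * t ^+ 2 + 0 * t ^+ 3) by lra.
  apply: H => s s01; first exact: (is_deriveB (df1 s s01) (dP _ _ _ _)).
  by have := lep s s01; lra.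
have := @le_of_derive_ge0 (fun s => f s - (f1 0 * s + a / 2 * s ^+ 2 + c / 6 * s ^+ 3))
    (fun s => f1 s - (f1 0 + 2 * (a / 2) * s + 3 * (c / 6) * s ^+ 2)).
rewrite /= => H; have := H _ _ 1; rewrite !expr0n !expr1n /= lexx ler01 => {}H.
suff : f 0 - (f1 0 * 0 + a / 2 * 0 + c / 6 * 0) <= f 1 - (f1 0 * 1 + a / 2 * 1 + c / 6 * 1) by lra.
apply: H => // s s01; first exact: (is_deriveB (df s s01) (dP _ _ _ _)).
by have := g1 s s01; lra.
Qed.

(** Since p^(-1/2) is k-Lipschitz, p stays between r^2 / (1 + k r t)^2 and r^2 / (1 - k r t)^2,
   which affine functions of t bound from below for all r, and from above as long as k r <=
   1/2. *)
Lemma taylor_self_concordant f (f1 : R -> R) p (p' : R -> R) k : 0 <= k ->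
  (forall t, 0 <= t <= 1 -> is_derive t 1 f (f1 t)) ->
  (forall t, 0 <= t <= 1 -> is_derive t 1 f1 (p t)) ->
  (forall t, 0 <= t <= 1 -> is_derive t 1 p (p' t)) ->
  (forall t, 0 <= t <= 1 -> 0 < p t) ->
  (forall t, 0 <= t <= 1 -> `|p' t| <= 2 * k * Num.sqrt (p t) ^+ 3) ->
  let r := Num.sqrt (p 0) in
  f 0 + f1 0 + r ^+ 2 / 2 - k * r ^+ 3 / 3 <= f 1 /\
  (k * r <= 2^-1 -> f 1 <= f 0 + f1 0 + r ^+ 2 / 2 + k * r ^+ 3).
Proof.
move=> k0 df df1 dp p0 p'le r.
have bd := sqrt_self_concordant k0 dp p0 p'le.
have h0 : 0 <= (0 : R) <= 1 by rewrite lexx ler01.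
have r0 : 0 < r by rewrite sqrtr_gt0 p0.
have r20 : 0 < r ^+ 2 by rewrite exprn_gt0.
have sq (t : R) : 0 <= t <= 1 -> Num.sqrt (p t) ^+ 2 = p t.
  by move=> t01; rewrite sqr_sqrtr// ltW// p0.
split.
  suff lo (t : R) : 0 <= t <= 1 -> r ^+ 2 + (- 2 * k * r ^+ 3) * t <= p t.
    by have := taylor2_ge df df1 lo; lra.
  move=> t01; have [+ _] := bd t t01; rewrite -/r.
  set u := k * r * t; set b := Num.sqrt (p t) => rb.
  have u0 : 0 <= u by case/andP: t01 => ? _; rewrite !mulr_ge0// ltW.
  have b0 : 0 < b by rewrite sqrtr_gt0 p0.
  have : r ^+ 2 <= (b * (1 + u)) ^+ 2 by rewrite ler_sqr ?nnegrE ?(ltW r0)//; apply: mulr_ge0; lra.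
  rewrite exprMn (sq t t01) => r2.
  rewrite (_ : _ + _ = r ^+ 2 * (1 - 2 * u)); last by rewrite /u; lra.
  have u3 : 0 <= u ^+ 3 by rewrite exprn_ge0.
  have u1 : 0 < (1 + u) ^+ 2 by rewrite exprn_gt0//; lra.
  rewrite -(ler_pM2r u1); apply: le_trans r2.
  rewrite -mulrA ler_piMr ?(ltW r20)//.
  by have := sqr_ge0 u; lra.
move=> kr.
suff hi (t : R) : 0 <= t <= 1 -> - r ^+ 2 + (- 6 * k * r ^+ 3) * t <= - p t.
  have df' t : 0 <= t <= 1 -> is_derive t 1 (fun s => - f s) (- f1 t) by move=> /df ?; exact: is_deriveN.
  have df1' t : 0 <= t <= 1 -> is_derive t 1 (fun s => - f1 s) (- p t) by move=> /df1 ?; exact: is_deriveN.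
  by have := taylor2_ge df' df1' hi; rewrite /=; lra.
move=> t01; have [_] := bd t t01; rewrite -/r.
set u := k * r * t; set b := Num.sqrt (p t) => rb.
have u0 : 0 <= u by case/andP: t01 => ? _; rewrite !mulr_ge0// ltW.
have u2 : u <= 2^-1.
  case/andP: t01 => ? ?; apply: le_trans kr.
  by rewrite ler_piMr// mulr_ge0// ltW.
have b0 : 0 < b by rewrite sqrtr_gt0 p0.
have : (b * (1 - u)) ^+ 2 <= r ^+ 2.
  have bu : 0 <= b * (1 - u) by apply: mulr_ge0; lra.
  by rewrite ler_sqr ?nnegrE ?(ltW r0)//; lra.
rewrite exprMn (sq t t01) => r2.
rewrite (_ : _ + _ = - (r ^+ 2 * (1 + 6 * u))); last by rewrite /u; lra.
rewrite lerN2.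
have u1 : 0 < (1 - u) ^+ 2 by rewrite exprn_gt0//; lra.
rewrite -(ler_pM2r u1); apply: (le_trans r2).
rewrite -mulrA ler_peMr ?(ltW r20)//.
have -> : (1 + 6 * u) * (1 - u) ^+ 2 = 1 + u * ((1 - 2 * u) * (4 - 3 * u)) by lra.
by rewrite lerDl mulr_ge0// mulr_ge0//; lra.
Qed.

End OneVariable.

(** * Self-concordant functions along lines *)

Section Lines.
Context {R : realType} {E : lmodType R}.
Implicit Types (z h w m : E) (t s k : R).

(** Self-concordance with constant k on D, read along lines only: f1, f2 and f3 stand for the
   first three directional derivatives as functions of the base point and the direction in V,
   with no joint differentiability. The last field is the trace of the blow-up at the boundary:
   a segment along which f stays bounded ends inside D. *)
Record sc_function k (D V : set E) (f : E -> R) (f1 f2 f3 : E -> E -> R) : Prop := ScFunction {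
  sc_const_ge0 : 0 <= k;
  sc_scale : forall t h, V h -> V (t *: h);
  sc_add : forall h h', V h -> V h' -> V (h + h');
  sc_convex : forall z h t, D z -> D (z + h) -> 0 <= t <= 1 -> D (z + t *: h);
  sc_open : forall z h, D z -> V h ->
    exists2 e : R, 0 < e & forall t, `|t| < e -> D (z + t *: h);
  sc_deriv1 : forall z h, D z -> V h -> is_derive (0 : R) 1 (fun s : R => f (z + s *: h)) (f1 z h);
  sc_deriv2 : forall z h, D z -> V h -> is_derive (0 : R) 1 (fun s : R => f1 (z + s *: h) h) (f2 z h);
  sc_deriv3 : forall z h, D z -> V h -> is_derive (0 : R) 1 (fun s : R => f2 (z + s *: h) h) (f3 z h);
  sc_pos : forall z h, D z -> V h -> h != 0 -> 0 < f2 z h;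
  sc_cubic : forall z h, D z -> V h -> `|f3 z h| <= 2 * k * Num.sqrt (f2 z h) ^+ 3;
  sc_barrier : forall z h, D z -> V h -> (forall t, 0 <= t < 1 -> D (z + t *: h)) ->
    (exists M, forall t, 0 <= t < 1 -> f (z + t *: h) <= M) -> D (z + h) }.

Lemma is_derive_unique (g : R -> R) t (a b : R) :
  is_derive t 1 g a -> is_derive t 1 g b -> a = b.
Proof. by move=> [_ <-] [_ <-]. Qed.

Section Theory.
Context (k : R) (D V : set E) (f : E -> R) (f1 f2 f3 : E -> E -> R).
Hypothesis F : sc_function k D V f f1 f2 f3.

Let at_line (g : E -> R) z h t l :
  is_derive (0 : R) 1 (fun s : R => g ((z + t *: h) + s *: h)) l ->
  is_derive t 1 (fun s : R => g (z + s *: h)) l.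
Proof.
rewrite -(subrr t) => /is_derive_translate.
set G := (X in is_derive _ _ X _); suff -> : G = fun s => g (z + s *: h) by [].
by apply/funext => s; rewrite /G -addrA -scalerDl addrCA subrr addr0.
Qed.

Let scaled (g : E -> R) z h t l :
  is_derive (0 : R) 1 (fun s : R => g (z + s *: h)) l ->
  is_derive (0 : R) 1 (fun s : R => g (z + s *: (t *: h))) (t * l).
Proof.
move=> dg; have := @is_derive_dilate R (fun s => g (z + s *: h)) 0 t l.
rewrite mul0r => /(_ dg); set G := (X in is_derive _ _ X _); suff -> : G = fun s => g (z + s *: (t *: h)) by [].
by apply/funext => s; rewrite /G scalerA.
Qed.

Lemma sc_f1Z z h t : D z -> V h -> f1 z (t *: h) = t * f1 z h.
Proof.
move=> Dz Vh; apply: is_derive_unique (sc_deriv1 F Dz (sc_scale F t Vh)) _.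
exact: scaled (sc_deriv1 F Dz Vh).
Qed.

Lemma sc_f2Z z h t : D z -> V h -> f2 z (t *: h) = t ^+ 2 * f2 z h.
Proof.
move=> Dz Vh; have Vth := sc_scale F t Vh.
apply: is_derive_unique (sc_deriv2 F Dz Vth) _.
have [e e0 De] := sc_open F Dz Vth.
apply: (@near_eq_is_derive _ _ _ (fun s : R => t * f1 (z + s *: (t *: h)) h)).
  exists e => //= s; rewrite /ball /= sub0r normrN => /De Ds.
  by rewrite sc_f1Z.
have := is_deriveZ t (scaled (g := f1 ^~ h) t (sc_deriv2 F Dz Vh)).
by move=> /is_derive_eq; apply; rewrite /GRing.scale /=; lra.
Qed.

Lemma sc_f2_ge0 z h : D z -> V h -> 0 <= f2 z h.
Proof.
move=> Dz Vh; have [->|h0] := eqVneq h 0; last exact/ltW/(sc_pos F).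
by rewrite -(scale0r h) sc_f2Z// expr0n mul0r.
Qed.

(** The one-variable bounds applied to t -> f (z + t h). *)
Lemma sc_taylor z h : D z -> D (z + h) -> V h ->
  f z + f1 z h + f2 z h / 2 - k * Num.sqrt (f2 z h) ^+ 3 / 3 <= f (z + h) /\
  (k * Num.sqrt (f2 z h) <= 2^-1 ->
   f (z + h) <= f z + f1 z h + f2 z h / 2 + k * Num.sqrt (f2 z h) ^+ 3).
Proof.
move=> Dz Dzh Vh; have [h0|h0] := eqVneq h 0.
  have f10 : f1 z h = 0 by rewrite h0 -(scale0r h) sc_f1Z// mul0r.
  have f20 : f2 z h = 0 by rewrite h0 -(scale0r h) sc_f2Z// expr0n mul0r.
  rewrite f10 f20 sqrtr0 expr0n h0 !addr0 /=; split; lra.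
have Dt t : 0 <= t <= 1 -> D (z + t *: h) by exact: (sc_convex F).
have := @taylor_self_concordant R (fun s => f (z + s *: h)) (fun s => f1 (z + s *: h) h)
  (fun s => f2 (z + s *: h) h) (fun s => f3 (z + s *: h) h) k (sc_const_ge0 F) _ _ _ _ _.
rewrite /= scale0r addr0 scale1r (sqr_sqrtr (sc_f2_ge0 Dz Vh)); apply=> t /Dt D1.
- exact: (at_line (sc_deriv1 F D1 Vh)).
- exact: (at_line (g := f1 ^~ h) (sc_deriv2 F D1 Vh)).
- exact: (at_line (g := f2 ^~ h) (sc_deriv3 F D1 Vh)).
- exact: (sc_pos F).
- exact: (sc_cubic F).
Qed.

(** The Dikin ellipsoid stays in the domain: along the segment the function is bounded by its
   Taylor polynomial, whereas it would blow up at an exit point. *)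
Lemma sc_dikin z h : D z -> V h -> k * Num.sqrt (f2 z h) <= 2^-1 -> D (z + h).
Proof.
move=> Dz Vh kr.
pose S := [set t : R | 0 <= t <= 1 /\ D (z + t *: h)].
have S0 : S 0 by rewrite /S /= lexx ler01 scale0r addr0.
have Sub : has_sup S by split; [exists 0|exists 1 => t [/andP[]]].
pose s := sup S.
have s0 : 0 <= s by apply: ub_le_sup => //; exact: Sub.2.
have s1 : s <= 1 by apply: ge_sup => [|t [/andP[]//]]; exact: Sub.1.
have Dlt t : 0 <= t < s -> D (z + t *: h).
  move=> /andP[t0 ts].
  have [u [/andP[u0 u1] Du] tu] := sup_gt Sub.1 ts.
  have ugt0 : 0 < u by exact: le_lt_trans tu.
  have := sc_convex F (t := t / u) Dz Du.
  rewrite scalerA mulfVK ?lt0r_neq0//; apply.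
  by rewrite divr_ge0//= ler_pdivrMr// mul1r ltW.
have Ds : D (z + s *: h).
  have lin t : 0 <= t < 1 -> D (z + t *: (s *: h)).
    move=> /andP[t0 t1]; rewrite scalerA.
    have [->|sn0] := eqVneq s 0; first by rewrite mulr0 scale0r addr0.
    by apply: Dlt; rewrite mulr_ge0//= gtr_pMl// lt0r sn0.
  apply: (sc_barrier F Dz (sc_scale F s Vh) lin).
  exists (f z + `|f1 z h| + f2 z h / 2 + k * Num.sqrt (f2 z h) ^+ 3) => t t01.
  have ts0 : 0 <= t * s by case/andP: t01 => t0 _; rewrite mulr_ge0.
  have ts1 : t * s <= 1 by case/andP: t01 => t0 t1; rewrite mulr_ile1// ltW.
  rewrite scalerA; have := lin t t01; rewrite scalerA => Dts.
  have [_] := sc_taylor Dz Dts (sc_scale F _ Vh).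
  rewrite sc_f1Z// sc_f2Z// sqrtrM ?sqr_ge0// sqrtr_sqr ger0_norm//.
  set r := Num.sqrt _; set c := t * s in ts0 ts1 *.
  have r0 : 0 <= r by exact: sqrtr_ge0.
  have k0 := sc_const_ge0 F.
  have cr : c * r <= r by rewrite ler_piMl.
  have kcr : k * (c * r) <= k * r by rewrite ler_wpM2l.
  move=> /(_ (le_trans kcr kr)) /le_trans; apply.
  have f20 := sc_f2_ge0 Dz Vh.
  have c2 : c ^+ 2 <= 1 by rewrite expr_le1.
  have A1 : c ^+ 2 * f2 z h <= f2 z h by rewrite ler_piMl.
  have A2 : k * (c * r) ^+ 3 <= k * r ^+ 3.
    apply: ler_wpM2l => //; apply: lerXn2r => //; rewrite nnegrE//; exact: mulr_ge0.
  have A3 : c * f1 z h <= `|f1 z h|.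
    by rewrite (le_trans (ler_norm _))// normrM (ger0_norm ts0) ler_piMl ?normr_ge0.
  lra.
have [s1'|] := ltP s 1; last by move=> s1'; rewrite -(scale1r h) (_ : 1 = s) //; apply/le_anti/andP.
have [e e0 De] := sc_open F Ds Vh.
pose d := Num.min (e / 2) (1 - s).
have d0 : 0 < d by rewrite lt_min divr_gt0//= subr_gt0.
have : S (s + d).
  split.
    by rewrite addr_ge0 ?(ltW d0)//= -lerBrDl ge_min lexx orbT.
  rewrite scalerDl addrA; apply: De; rewrite gtr0_norm//.
  by rewrite (le_lt_trans (_ : d <= e / 2)) ?ge_min ?lexx// gtr_pMr// invf_lt1// ltr1n.
move=> /(ub_le_sup Sub.2); rewrite -/s gerDl => /(lt_le_trans d0).
by rewrite ltxx.
Qed.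

End Theory.
End Lines.

(** * The parallelogram law for the second derivative *)

Section Hessian.
Context {R : realType} {E : lmodType R}.
Implicit Types (z h m w q : E) (s t : R).
Context (D V : set E) (f : E -> R) (f1 f2 f3 : E -> E -> R).
Hypothesis F : sc_function 1 D V f f1 f2 f3.
Hypothesis plane_continuity : forall z h m, D z -> V h -> V m ->
  forall e : R, 0 < e -> exists2 d : R, 0 < d & forall s t, `|s| <= d -> `|t| <= d ->
    D (z + s *: h + t *: m) /\ `|f (z + s *: h + t *: m) - f z| <= e.

Let VN h : V h -> V (- h).
Proof. by move=> Vh; rewrite -scaleN1r; exact: (sc_scale F _ Vh). Qed.

Let sqrt_f2Z w q t : D w -> V q -> 0 <= t ->
  Num.sqrt (f2 w (t *: q)) = t * Num.sqrt (f2 w q).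
Proof.
by move=> Dw Vq t0; rewrite (sc_f2Z F)// sqrtrM ?sqr_ge0// sqrtr_sqr ger0_norm.
Qed.

(** In the symmetric second difference the first-order terms cancel, so it determines the
   second derivative up to third order. *)
Let second_difference w q : D w -> V q -> D (w + q) -> D (w - q) ->
  Num.sqrt (f2 w q) <= 2^-1 ->
  `|f (w + q) + f (w - q) - 2 * f w - f2 w q| <= 2 * Num.sqrt (f2 w q) ^+ 3.
Proof.
move=> Dw Vq D1 D2 r2; have Vnq := VN Vq.
have [l1 u1] := sc_taylor F Dw D1 Vq; have [l2 u2] := sc_taylor F Dw D2 Vnq.
have e2 : f2 w (- q) = f2 w q by rewrite -scaleN1r (sc_f2Z F)// sqrrN expr1n mul1r.
have e1 : f1 w (- q) = - f1 w q by rewrite -scaleN1r (sc_f1Z F)// mulN1r.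
rewrite e1 e2 !mul1r in l1 u1 l2 u2.
have := u1 r2; have := u2 r2; have : 0 <= Num.sqrt (f2 w q) ^+ 3 by rewrite exprn_ge0 ?sqrtr_ge0.
by rewrite ler_norml => *; apply/andP; split; lra.
Qed.

(** Rescale a direction of the plane to local length 1: if the rescaled step were shorter than
   d, f would grow along it by at least 1/6 in one of the two senses, whereas f varies too
   little near z. *)
Let local_bound z h m : D z -> V h -> V m ->
  exists2 d : R, 0 < d <= 1 & forall s t a b, `|s| <= d -> `|t| <= d -> `|a| <= 1 -> `|b| <= 1 ->
    let w := z + s *: h + t *: m in let q := a *: h + b *: m in
    [/\ D w, forall u, `|u| <= d -> D (w + u *: q) & Num.sqrt (f2 w q) <= d^-1].
Proof.
move=> Dz Vh Vm.
(* Twice 1/16 is less than 1/2 - 1/3, the growth that Taylor's formula gives at local length 1.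
   *)
have e16 : 0 < 16^-1 :> R by rewrite invr_gt0.
have [d0 d00 near_z] := plane_continuity Dz Vh Vm e16.
pose d := Num.min (d0 / 2) 1.
have d0P : 0 < d by rewrite lt_min divr_gt0/=.
have dd0 : 2 * d <= d0.
  by have : d <= d0 / 2; [rewrite ge_min lexx|rewrite ler_pdivlMr// mulrC].
exists d; first by rewrite d0P ge_min lexx orbT.
move=> s t a b sd td a1 b1 w q.
have box u : `|u| <= d -> D (w + u *: q) /\ `|f (w + u *: q) - f z| <= 16^-1.
  move=> ud; have -> : w + u *: q = z + (s + u * a) *: h + (t + u * b) *: m.
    by rewrite /w /q scalerDr !scalerA !scalerDl addrACA -!addrA; congr (_ + (_ + _)); rewrite addrCA.
  have ua x : `|x| <= 1 -> `|u * x| <= d.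
    by move=> x1; rewrite normrM (le_trans _ ud)// ler_piMr.
  apply: near_z; apply: (le_trans (ler_normD _ _)).
    by have := ua a a1; lra.
  by have := ua b b1; lra.
have [Dw fw] : D w /\ `|f w - f z| <= 16^-1.
  by have := box 0; rewrite normr0 scale0r addr0; apply; exact: ltW.
have Vq : V q by apply: (sc_add F); exact: (sc_scale F).
split=> [//|u /box[]//|].
rewrite leNgt; apply/negP; set r := Num.sqrt _ => dr.
have r0 : 0 < r by rewrite (lt_trans _ dr)// invr_gt0.
have rd : `|r^-1| <= d.
  by rewrite gtr0_norm ?invr_gt0// -[d]invrK lef_pV2 ?posrE ?invr_gt0// ltW.
have [Dp fp] := box _ rd; have := box (- r^-1); rewrite normrN => /(_ rd)[Dm fm].
have sr : Num.sqrt (f2 w (r^-1 *: q)) = 1.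
  by rewrite sqrt_f2Z ?invr_ge0 ?(ltW r0)// mulVf ?lt0r_neq0.
have f2e : f2 w (r^-1 *: q) = 1 by rewrite -[LHS]sqr_sqrtr ?sr ?expr1n ?(sc_f2_ge0 F)//; exact: (sc_scale F _ Vq).
have Vr := sc_scale F r^-1 Vq.
have [lp _] := sc_taylor F Dw Dp Vr.
have Dm' : D (w + (- (r^-1 *: q))) by rewrite -scaleNr.
have [lm _] := sc_taylor F Dw Dm' (VN Vr).
have e2 : f2 w (- (r^-1 *: q)) = 1 by rewrite -scaleN1r (sc_f2Z F)// f2e sqrrN expr1n mul1r.
have e1 : f1 w (- (r^-1 *: q)) = - f1 w (r^-1 *: q) by rewrite -scaleN1r (sc_f1Z F)// mulN1r.
rewrite e1 e2 f2e sqrtr1 expr1n in lp lm.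
by rewrite scaleNr in fm; move: fp fm fw; rewrite !ler_norml => /andP[? ?] /andP[? ?] /andP[? ?]; lra.
Qed.

(** A limit of second differences whose error is uniform near z, each of them continuous in z.
   *)
Let f2_continuous z h m : D z -> V h -> V m -> forall e : R, 0 < e ->
  exists2 d : R, 0 < d & forall s, `|s| <= d -> `|f2 (z + s *: h) m - f2 z m| <= e.
Proof.
move=> Dz Vh Vm e e0.
have [d /andP[d0 d1] bd] := local_bound Dz Vh Vm.
pose L := d^-1; have L0 : 0 < L by rewrite invr_gt0.
have L1 : 1 <= L by rewrite invf_ge1.
have L30 : 0 < L ^+ 3 by rewrite exprn_gt0.
pose t := Num.min (d / 2) (e / (8 * L ^+ 3)).
have t0 : 0 < t by rewrite lt_min !divr_gt0 ?mulr_gt0.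
have tL : t * L <= 2^-1.
  have : t <= d / 2 by rewrite ge_min lexx.
  have dL : d * L = 1 by rewrite divff// lt0r_neq0.
  by move=> td2; have := ler_wpM2r (ltW L0) td2; lra.
have te : 8 * t * L ^+ 3 <= e.
  have : t <= e / (8 * L ^+ 3) by rewrite ge_min lexx orbT.
  by rewrite ler_pdivlMr ?mulr_gt0//; lra.
have td : `|t| <= d.
  have : t <= d / 2 by rewrite ge_min lexx.
  by rewrite gtr0_norm//; lra.
have sd s w : `|s| <= d -> w = z + s *: h ->
    `|f (w + t *: m) + f (w - t *: m) - 2 * f w - t ^+ 2 * f2 w m| <= 2 * (t * L) ^+ 3.
  move=> s1 wE.
  have := bd s 0 0 1 s1; rewrite normr0 normr1 ltW// => /(_ isT ler01 (lexx _)).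
  rewrite /= !scale0r scale1r add0r addr0 -wE => -[Dw Du r1].
  have Dm : D (w - t *: m) by rewrite -scaleNr; apply: Du; rewrite normrN.
  have r2 : Num.sqrt (f2 w (t *: m)) <= t * L by rewrite sqrt_f2Z ?(ltW t0)// ler_pM2l.
  have Vtm := sc_scale F t Vm.
  have := second_difference Dw Vtm (Du _ td) Dm (le_trans r2 tL).
  rewrite (sc_f2Z F)// => /le_trans; apply.
  rewrite -(sc_f2Z F)// ler_pM2l//; apply: lerXn2r => //; rewrite nnegrE ?sqrtr_ge0//.
  by rewrite mulr_ge0// ltW.
pose e' := e * t ^+ 2 / 8.
have t20 : 0 < t ^+ 2 by rewrite exprn_gt0.
have e'0 : 0 < e' by rewrite divr_gt0 ?mulr_gt0.
have [Dp Dm] : D (z + t *: m) /\ D (z - t *: m).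
  have := bd 0 0 0 1; rewrite normr0 normr1 ltW// => /(_ isT isT ler01 (lexx _)).
  rewrite /= !scale0r scale1r add0r !addr0 => -[_ Du _]; split; first exact: Du.
  by rewrite -scaleNr; apply: Du; rewrite normrN.
have [c0 c00 H0] := plane_continuity Dz Vh Vm e'0.
have [cp cp0 Hp] := plane_continuity Dp Vh Vm e'0.
have [cm cm0 Hm] := plane_continuity Dm Vh Vm e'0.
exists (Num.min (Num.min d c0) (Num.min cp cm)); first by rewrite !lt_min d0 c00 cp0.
move=> s; rewrite !le_min => /andP[/andP[sd1 sc0] /andP[scp scm]].
have := sd _ _ sd1 erefl; have := sd 0 z; rewrite normr0 scale0r addr0 (ltW d0) => /(_ isT erefl).
have n0 x : 0 < x -> `|0 : R| <= x by rewrite normr0 => /ltW.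
have := (H0 s 0 sc0 (n0 _ c00)).2; have := (Hp s 0 scp (n0 _ cp0)).2.
have := (Hm s 0 scm (n0 _ cm0)).2; rewrite /= !scale0r !addr0 (addrAC z (- _)) (addrAC z (t *: m)).
rewrite /e' !ler_norml => /andP[? ?] /andP[? ?] /andP[? ?] /andP[? ?] /andP[? ?].
have tL3 : 4 * (t * L) ^+ 3 <= e * t ^+ 2 / 2.
  have : t ^+ 2 * (8 * t * L ^+ 3) <= t ^+ 2 * e by rewrite ler_pM2l.
  by rewrite exprMn; lra.
have -> : (- e <= f2 (z + s *: h) m - f2 z m <= e) =
   (t ^+ 2 * - e <= t ^+ 2 * (f2 (z + s *: h) m - f2 z m) <= t ^+ 2 * e).
  by rewrite !ler_pM2l.
by apply/andP; split; lra.
Qed.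

(** Compare f at the corners of a small parallelogram spanned by h and m: second differences
   along its two diagonals and along its sides use the same values of f. This replaces joint
   differentiability. *)
Lemma sc_parallelogram z h m : D z -> V h -> V m ->
  f2 z (h + m) + f2 z (h - m) = 2 * f2 z h + 2 * f2 z m.
Proof.
move=> Dz Vh Vm; apply/eqP; rewrite -subr_eq0 -normr_le0 leNgt; apply/negP.
set X := _ - _ => X0.
pose e := `|X| / 4; have e0 : 0 < e by rewrite divr_gt0.
have [d /andP[d0 d1] bd] := local_bound Dz Vh Vm.
have [c c0 fc] := f2_continuous Dz Vh Vm e0.
pose L := d^-1; have L0 : 0 < L by rewrite invr_gt0.
have L30 : 0 < L ^+ 3 by rewrite exprn_gt0.
pose t := Num.min (Num.min (d / 2) c) (e / (12 * L ^+ 3)).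
have t0 : 0 < t by rewrite !lt_min c0 !divr_gt0 ?mulr_gt0.
have tL : t * L <= 2^-1.
  have : t <= d / 2 by rewrite !ge_min lexx.
  have dL : d * L = 1 by rewrite divff// lt0r_neq0.
  by move=> td2; have := ler_wpM2r (ltW L0) td2; lra.
have te : 12 * t * L ^+ 3 <= e.
  have : t <= e / (12 * L ^+ 3) by rewrite !ge_min lexx !orbT.
  by rewrite ler_pdivlMr ?mulr_gt0//; lra.
have td : `|t| <= d.
  have : t <= d / 2 by rewrite !ge_min lexx.
  by rewrite gtr0_norm//; lra.
have tc : `|t| <= c by rewrite gtr0_norm// !ge_min lexx orbT.
have sd s a b w q : `|s| <= d -> `|a| <= 1 -> `|b| <= 1 ->
    w = z + s *: h -> q = a *: h + b *: m ->
    `|f (w + t *: q) + f (w - t *: q) - 2 * f w - t ^+ 2 * f2 w q| <= 2 * (t * L) ^+ 3.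
  move=> s1 a1 b1 wE qE.
  have := bd s 0 a b s1; rewrite normr0 ltW// => /(_ isT a1 b1).
  rewrite /= !scale0r addr0 -wE -qE => -[Dw Du r1].
  have Vq : V q by rewrite qE; apply: (sc_add F); exact: (sc_scale F).
  have Dm : D (w - t *: q) by rewrite -scaleNr; apply: Du; rewrite normrN.
  have r2 : Num.sqrt (f2 w (t *: q)) <= t * L by rewrite sqrt_f2Z ?(ltW t0)// ler_pM2l.
  have Vtq := sc_scale F t Vq.
  have := second_difference Dw Vtq (Du _ td) Dm (le_trans r2 tL).
  rewrite (sc_f2Z F)// => /le_trans; apply.
  rewrite -(sc_f2Z F)// ler_pM2l//; apply: lerXn2r => //; rewrite nnegrE ?sqrtr_ge0//.
  by rewrite mulr_ge0// ltW.
have n0 : `|0 : R| <= 1 by rewrite normr0.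
have n1 : `|1 : R| <= 1 by rewrite normr1.
have nN1 : `|- 1 : R| <= 1 by rewrite normrN1.
have nd : `|0 : R| <= d by rewrite normr0 ltW.
have ntd : `|- t| <= d by rewrite normrN.
have := sd 0 1 1 _ _ nd n1 n1 erefl erefl; have := sd 0 1 (-1) _ _ nd n1 nN1 erefl erefl.
have := sd 0 1 0 _ _ nd n1 n0 erefl erefl; have := sd t 0 1 _ _ td n0 n1 erefl erefl.
have := sd (- t) 0 1 _ _ ntd n0 n1 erefl erefl.
rewrite /= !scale0r !scale1r !addr0 !add0r scaleN1r.
have := fc t tc; have := fc (- t); rewrite normrN => /(_ tc).
rewrite !scaleNr.
have -> : z + t *: (h + m) = z + t *: h + t *: m by rewrite scalerDr addrA.
have -> : z - t *: (h + m) = z - t *: h - t *: m by rewrite scalerDr opprD addrA.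
have -> : z + t *: (h - m) = z + t *: h - t *: m by rewrite scalerBr addrA.
have -> : z - t *: (h - m) = z - t *: h + t *: m by rewrite scalerBr opprB addrA addrAC.
rewrite !ler_norml => /andP[a1 a2] /andP[b1 b2] /andP[? ?] /andP[? ?] /andP[? ?] /andP[? ?] /andP[? ?].
have t20 : 0 < t ^+ 2 by rewrite exprn_gt0.
have tL3 : 12 * (t * L) ^+ 3 <= e * t ^+ 2.
  have : t ^+ 2 * (12 * t * L ^+ 3) <= t ^+ 2 * e by rewrite ler_pM2l.
  by rewrite exprMn; lra.
have Xe : `|t ^+ 2 * X| <= t ^+ 2 * (3 * e).
  have m1 y : y <= e -> t ^+ 2 * y <= t ^+ 2 * e by rewrite ler_pM2l.
  have m2 y : - e <= y -> t ^+ 2 * - e <= t ^+ 2 * y by rewrite ler_pM2l.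
  have := m1 _ a2; have := m2 _ a1; have := m1 _ b2; have := m2 _ b1.
  by rewrite /X ler_norml => *; apply/andP; split; lra.
move: Xe; rewrite normrM (gtr0_norm t20) ler_pM2l// /e => *; lra.
Qed.

End Hessian.

(** * From the parallelogram law to a symmetric matrix *)

Section JordanVonNeumann.
Context {R : realType}.

(** Subtracting the integer part of t shows that e is bounded everywhere, and a bounded
   additive function vanishes because e (n t) = n e t. *)
Lemma additive_bounded_eq0 (e : R -> R) (M : R) : {morph e : s t / s + t} ->
  e 1 = 0 -> (forall t, 0 <= t <= 1 -> `|e t| <= M) -> forall t, e t = 0.
Proof.
move=> eD e1 eM.
have e0 : e 0 = 0 by have := eD 0 0; rewrite addr0; lra.
have eN t : e (- t) = - e t by have := eD t (- t); rewrite subrr e0; lra.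
have en (n : nat) t : e (t *+ n) = e t *+ n.
  by elim: n => [|n ih]; rewrite ?mulr0n// !mulrS eD ih.
have ez (z : int) : e z%:~R = 0.
  case: z => n; first by rewrite -pmulrn en e1 mul0rn.
  by rewrite NegzE mulrNz eN -pmulrn en e1 mul0rn oppr0.
have eB t : `|e t| <= M.
  have -> : e t = e (t - (Num.floor t)%:~R) by rewrite eD eN ez oppr0 addr0.
  apply: eM; rewrite subr_ge0 floor_le_tmp/= lerBlDl.
  by have := lt_succ_floor t; rewrite intrD addrC => /ltW.
move=> t; apply/eqP; rewrite -normr_le0 leNgt; apply/negP => et.
have M0 : 0 <= M by rewrite (le_trans _ (eB 0)).
have := eB (t *+ (Num.truncn (M / `|e t|)).+1).
rewrite en normrMn -mulr_natr mulrC -ler_pdivlMr// leNgt.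
by rewrite truncnS_gt.
Qed.

Context (N : nat) (Q : 'rV[R]_N -> R).
Hypothesis Q0 : forall x, 0 <= Q x.
Hypothesis QZ : forall t x, Q (t *: x) = t ^+ 2 * Q x.
Hypothesis Qpar : forall x y, Q (x + y) + Q (x - y) = 2 * Q x + 2 * Q y.

Let b x y := (Q (x + y) - Q (x - y)) / 4.

Let QN x : Q (- x) = Q x.
Proof. by rewrite -scaleN1r QZ sqrrN expr1n mul1r. Qed.

Let bC x y : b x y = b y x.
Proof. by rewrite /b (addrC y x) -(QN (y - x)) opprB. Qed.

Let bxx x : b x x = Q x.
Proof. 
rewrite /b subrr -(scale0r 0) QZ expr0n /= mul0r subr0.
by rewrite -mulr2n -scaler_nat QZ; lra.
Qed.

Let b_half x x' y : b (x + x') y + b (x - x') y = 2 * b x y.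
Proof.
have h1 := Qpar (x + y) x'; have h2 := Qpar (x - y) x'.
rewrite /b (addrAC x x' y) (addrAC x (- x') y) (addrAC x x' (- y)) (addrAC x (- x') (- y)).
lra.
Qed.

Let bDl x x' y : b (x + x') y = b x y + b x' y.
Proof.
have b0 : b 0 y = 0 by rewrite /b add0r sub0r QN subrr mul0r.
have b2 z : b (z + z) y = 2 * b z y by have := b_half z z y; rewrite subrr b0 addr0.
pose u := 2^-1 *: (x + x'); pose v := 2^-1 *: (x - x').
have half (z : 'rV[R]_N) : (2^-1 : R) *: (z + z) = z.
  by rewrite scalerDr -scalerDl (_ : 2^-1 + 2^-1 = 1) ?scale1r//; lra.
have uu : u + u = x + x' by rewrite /u -scalerDr half.
have uv : u + v = x by rewrite /u /v -scalerDr addrACA subrr addr0 half.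
have umv : u - v = x' by rewrite /u /v -scalerBr opprB (addrC x x') -addrA subrKC half.
by rewrite -uu b2 -(b_half u v y) uv umv.
Qed.

Let bZl t x y : b (t *: x) y = t * b x y.
Proof.
pose e s := b (s *: x) y - s * b x y.
suff : e t = 0 by rewrite /e => /eqP; rewrite subr_eq0 => /eqP.
apply: (@additive_bounded_eq0 e (Q x + Q y + `|b x y|)).
- by move=> r s; rewrite /e scalerDl bDl; lra.
- by rewrite /e scale1r mul1r subrr.
move=> s /andP[s0 s1]; rewrite /e (le_trans (ler_normB _ _))// lerD//; last first.
  by rewrite normrM ger0_norm// ler_piMl.
have h := Qpar (s *: x) y; rewrite QZ in h.
have s2 : s ^+ 2 * Q x <= Q x by rewrite ler_piMl// expr_le1.
have := Q0 (s *: x + y); have := Q0 (s *: x - y); have := Q0 x; have := Q0 y.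
by rewrite /b ler_norml => *; apply/andP; split; lra.
Qed.

Let b_suml (I : Type) (r : seq I) (F : I -> 'rV[R]_N) y :
  b (\sum_(i <- r) F i) y = \sum_(i <- r) b (F i) y.
Proof.
elim: r => [|i r ih]; last by rewrite !big_cons bDl ih.
by rewrite !big_nil /b add0r sub0r QN subrr mul0r.
Qed.

(** Jordan and von Neumann: the polar form b is additive in each argument by the parallelogram
   law. Homogeneity over the reals follows because t -> b (t x) y - t b x y is additive and, by
   nonnegativity of Q, bounded on [0, 1]. *)
Lemma parallelogram_quad : exists2 S : 'M[R]_N, S^T = S & forall x, Q x = quad S x.
Proof.
exists (\matrix_(i, j) b (delta_mx 0 i) (delta_mx 0 j)).
  by apply/matrixP => i j; rewrite !mxE bC.
have bs x y : b x y = \sum_i x 0 i * b (delta_mx 0 i) y.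
  by rewrite [in LHS](row_sum_delta x) b_suml; apply: eq_bigr => i _; rewrite bZl.
move=> x; rewrite quadE bil_sum -bxx bs; apply: eq_bigr => i _.
rewrite bC bs mulr_sumr.
by apply: eq_bigr => j _; rewrite bC !mxE; lra.
Qed.

End JordanVonNeumann.

(** * Relatively open convex sets *)

Section RelativelyOpen.
Context {R : realType} (N : nat) (D : set 'rV[R]_N).

Lemma direction_diff z z' : D z -> D z' -> z - z' \in direction D.
Proof.
move=> Dz Dz'; suff : [set` direction D] (z - z') by [].
rewrite vspanP; exists [:: z - z'] => [x|]; last by rewrite span_seq1 memv_line.
by rewrite inE => /eqP ->; exists z, z'.
Qed.

Lemma affine_hull_step x p q (c : R) : affine_hull D x -> D p -> D q ->
  affine_hull D (x + c *: (p - q)).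
Proof.
move=> [n [y [a [Dy a1 ->]]]] Dp Dq.
exists n.+2.
exists (fun i : 'I_n.+2 => match unlift ord0 i with None => p
   | Some j => match unlift ord0 j with None => q | Some k => y k end end).
exists (fun i : 'I_n.+2 => match unlift ord0 i with None => c
   | Some j => match unlift ord0 j with None => - c | Some k => a k end end).
split.
- by move=> i; case: unliftP => [j _|_//]; case: unliftP.
- rewrite !big_ord_recl unlift_none liftK unlift_none.
  under eq_bigr do rewrite !liftK.
  by rewrite a1; lra.
- rewrite !big_ord_recl unlift_none liftK unlift_none.
  under [in RHS]eq_bigr do rewrite !liftK.
  by rewrite addrC scalerBr scaleNr -addrA.
Qed.

Lemma affine_hull_direction x h : affine_hull D x -> h \in direction D -> affine_hull D (x + h).
Proof.
move=> Dx hV; have : [set` direction D] h by [].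
rewrite vspanP => -[s sD hs]; rewrite (@coord_span _ _ _ (in_tuple s) h hs).
have tD (i : 'I_(size s)) : exists p q, [/\ D p, D q & s`_i = p - q].
  by have [|p [q [Dp Dq e]]] := sD s`_i; [rewrite mem_nth|exists p, q].
elim/big_rec : _ x Dx => [x Dx|i y _ ih x Dx]; first by rewrite addr0.
have [p [q [Dp Dq e]]] := tD i.
rewrite (_ : x + (_ + y) = x + coord (in_tuple s) i h *: s`_i + y) ?addrA//.
by apply: ih; rewrite e; exact: affine_hull_step.
Qed.

Lemma affine_hull_sub z : D z -> affine_hull D z.
Proof.
move=> Dz; exists 1%N, (fun=> z), (fun=> 1); split => //; first by rewrite big_ord1.
by rewrite big_ord1 scale1r.
Qed.

(** Moving along the direction space stays in the affine hull, so the ambient open set is the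
   only constraint. *)
Lemma relatively_open_ball z : relatively_open D -> D z ->
  exists2 e : R, 0 < e & forall h, h \in direction D -> `|h| < e -> D (z + h).
Proof.
move=> [U oU DE] Dz; have Uz : U z by move: (Dz); rewrite DE => -[].
have /nbhs_normP[e /= e0 eU] : nbhs z U by exact: open_nbhs_nbhs.
exists e => // h hV he; rewrite DE; split.
  by apply: affine_hull_direction => //; exact: affine_hull_sub.
by apply: eU; rewrite /ball_ /= opprD addrA subrr sub0r normrN.
Qed.

Lemma convex_set_segment z h (t : R) : convex_set D -> D z -> D (z + h) -> 0 <= t <= 1 ->
  D (z + t *: h).
Proof.
move=> cD Dz Dzh /andP[t0 t1].
have : D (t *: (z + h) + (1 - t) *: z).
  have := cD (z + h) z (Itv01 t0 t1); rewrite !inE => H; exact: H.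
by rewrite scalerDr addrAC -scalerDl subrKC scale1r.
Qed.

Lemma convex_function_segment (f : 'rV[R]_N -> R) z h (t : R) :
  convex_function (E := 'rV[R]_N) D f -> D z -> D (z + h) -> 0 <= t <= 1 ->
  f (z + t *: h) <= (1 - t) * f z + t * f (z + h).
Proof.
move=> cf Dz Dzh /andP[t0 t1].
have : f (t *: (z + h) + (1 - t) *: z) <= t * f (z + h) + (1 - t) * f z.
  have := cf (Itv01 t0 t1) (z + h) z; rewrite !inE => H; exact: H.
rewrite [leRHS]addrC [X in f X](_ : _ = z + t *: h)//.
by rewrite scalerDr addrAC -scalerDl subrKC scale1r.
Qed.

Lemma coord_le_norm (x : 'rV[R]_N) j : `|x 0 j| <= `|x|.
Proof.
rewrite [leRHS]mx_normrE.
exact: (le_bigmax _ (fun ij : 'I_1 * 'I_N => `|x ij.1 ij.2|) (0, j)).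
Qed.

Section ConvexContinuity.
Context (f : 'rV[R]_N -> R).
Hypothesis cf : convex_function (E := 'rV[R]_N) D f.
Hypothesis cD : convex_set D.
Hypothesis oD : relatively_open D.

Let bounded_direction z p : D z -> p \in direction D ->
  exists d M : R, 0 < d /\ forall c, `|c| <= d -> D (z + c *: p) /\ f (z + c *: p) <= M.
Proof.
move=> Dz pV; have [e e0 De] := relatively_open_ball oD Dz.
pose d := e / 2 / (1 + `|p|).
have p0 : 0 < 1 + `|p| by rewrite ltr_pwDl.
have d0 : 0 < d by rewrite !divr_gt0.
have Dc c : `|c| <= d -> D (z + c *: p).
  move=> cd; apply: De; first exact: memvZ.
  rewrite normrZ (le_lt_trans (_ : _ <= d * (1 + `|p|)))//.
    by rewrite ler_pM// lerDr.
  by rewrite mulfVK ?lt0r_neq0// gtr_pMr// invf_lt1// ltr1n.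
exists d, (`|f z| + `|f (z + d *: p)| + `|f (z - d *: p)|); split=> // c cd; split; first exact: Dc.
have Dd : D (z + d *: p) by apply: Dc; rewrite gtr0_norm.
have DNd : D (z - d *: p) by rewrite -scaleNr; apply: Dc; rewrite normrN gtr0_norm.
have t01 : 0 <= `|c| / d <= 1 by rewrite divr_ge0 ?(ltW d0)//= ler_pdivrMr// mul1r.
have dd : d^-1 * d = 1 by rewrite mulVf// lt0r_neq0.
have step y : D (z + y) -> f (z + (`|c| / d) *: y) <= `|f z| + `|f (z + y)|.
  move=> Dy; apply: le_trans (convex_function_segment cf Dz Dy t01) _.
  case/andP: t01 => t0 t1; apply: lerD.
    rewrite (le_trans (ler_norm _))// normrM ler_piMl// ger0_norm ?subr_ge0//.
    by rewrite gerBl.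
  by rewrite (le_trans (ler_norm _))// normrM ler_piMl// ger0_norm.
have [c0|c0] := leP 0 c.
  have := step _ Dd; rewrite scalerA -mulrA dd mulr1 ger0_norm// => /le_trans; apply.
  by rewrite lerDl.
have := step _ DNd; rewrite scalerN scalerA -mulrA dd mulr1 ltr0_norm// scaleNr opprK.
by move=> /le_trans; apply; rewrite addrAC lerDl.
Qed.

(** By convexity, a bound along each of finitely many directions gives a bound on the cube they
   span. *)
Let bounded_span z (I : Type) (r : seq I) (p : I -> 'rV[R]_N) : D z ->
  (forall i, p i \in direction D) ->
  exists d M : R, 0 < d /\ forall c : I -> R, (forall i, `|c i| <= d) ->
    D (z + \sum_(i <- r) c i *: p i) /\ f (z + \sum_(i <- r) c i *: p i) <= M.
Proof.
move=> Dz pV; elim: r => [|i r [d [M [d0 ih]]]].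
  by exists 1, (f z); split=> // c _; rewrite big_nil addr0.
have [d' [M' [d'0 hi]]] := bounded_direction Dz (pV i).
exists (Num.min d d' / 2), (2^-1 * M' + 2^-1 * M).
split=> [|c cd]; first by rewrite divr_gt0// lt_min d0.
have c2 x : `|c x| <= Num.min d d' / 2 -> `|2 * c x| <= d /\ `|2 * c x| <= d'.
  by rewrite ler_pdivlMr// mulrC normrM (ger0_norm (ler0n _ 2)) le_min => /andP[].
have [D1 f1] := hi _ (c2 _ (cd i)).2.
have [D2 f2] := ih (fun x => 2 * c x) (fun x => (c2 _ (cd x)).1).
rewrite big_cons; set S := \sum_(_ <- _) _ in D2 f2; set S' := \sum_(_ <- _) _.
have SE : S = 2 *: S'.
  by rewrite /S /S' scaler_sumr; apply: eq_bigr => j _; rewrite scalerA.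
pose a := z + (2 * c i) *: p i; pose h := (z + S) - a.
have ah : a + h = z + S by rewrite /h addrC subrK.
have h01 : 0 <= (2^-1 : R) <= 1 by rewrite invr_ge0 ler0n /= invf_le1// ler1n.
have mid : z + (c i *: p i + S') = a + 2^-1 *: h.
  have hE : h = 2 *: (S' - c i *: p i).
    by rewrite /h /a SE opprD addrACA subrr add0r scalerBr scalerA.
  rewrite hE scalerA mulVf// scale1r /a mulr_natl mulr2n scalerDl.
  by rewrite -!addrA; congr (_ + (_ + _)); rewrite addrC subrK.
rewrite mid; split; first by apply: convex_set_segment => //; rewrite ah.
have := convex_function_segment cf D1 (_ : D (a + h)) h01; rewrite ah => /(_ D2) /le_trans; apply.
by rewrite lerD//; lra.
Qed.

(** A convex function that is bounded above near a point is continuous there; the rows of the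
   projection onto the direction space provide finitely many directions to bound it on. *)
Lemma convex_continuous z (e : R) : D z -> 0 < e ->
  exists2 d : R, 0 < d & forall h, h \in direction D -> `|h| <= d ->
    D (z + h) /\ `|f (z + h) - f z| <= e.
Proof.
move=> Dz e0.
have [Pi [_ iPi PiV _]] := orthogonal_projection (direction D).
have pV i : row i Pi \in direction D by apply/PiV; rewrite -row_mul iPi.
have [d [M [d0 hd]]] := bounded_span (index_enum 'I_N) Dz pV.
have near h : h \in direction D -> `|h| <= d -> D (z + h) /\ f (z + h) <= M.
  move=> /PiV hV hd'; have := hd (fun i => h 0 i).
  rewrite -mulmx_sum_row hV; apply => i; exact: le_trans (coord_le_norm h i) _.
have Mz : f z <= M by have := near 0 (mem0v _); rewrite normr0 addr0; case=> //; exact: ltW.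
pose s := Num.min 1 (e / (M - f z + 1)).
have m0 : 0 < M - f z + 1 by rewrite ltr_wpDl// subr_ge0.
have s0 : 0 < s by rewrite lt_min ltr01 divr_gt0.
have s1 : s <= 1 by rewrite ge_min lexx.
have se : s * (M - f z) <= e.
  have : s <= e / (M - f z + 1) by rewrite ge_min lexx orbT.
  by rewrite ler_pdivlMr//; lra.
exists (d * s); first by rewrite mulr_gt0.
move=> h hV hds.
pose h' := s^-1 *: h.
have h'V : h' \in direction D by exact: memvZ.
have h'd : `|h'| <= d.
  by rewrite normrZ gtr0_norm ?invr_gt0// mulrC ler_pdivrMr.
have hE : h = s *: h' by rewrite scalerA divff ?scale1r// lt0r_neq0.
have [D1 f1] := near h' h'V h'd.
have [D2 f2] : D (z - h') /\ f (z - h') <= M.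
  by apply: near; rewrite ?normrN// memvN.
have s01 : 0 <= s <= 1 by rewrite ltW.
have Dh : D (z + h) by rewrite hE; exact: convex_set_segment.
split=> //.
have u1 := convex_function_segment cf Dz D1 s01; rewrite -hE in u1.
pose t := s / (1 + s).
have s1p : 0 < 1 + s by rewrite addr_gt0.
have t01 : 0 <= t <= 1.
  by rewrite divr_ge0 ?(ltW s0) ?(ltW s1p)//= ler_pdivrMr// mul1r lerDr.
have ts : t * (1 + s) = s by rewrite mulfVK// lt0r_neq0.
have back : z + h + (- h - h') = z - h' by rewrite addrA addrK.
have u2 := convex_function_segment cf Dh (_ : D (z + h + (- h - h'))) t01.
rewrite back in u2; have {}u2 := u2 D2.
have zE : z + h + t *: (- h - h') = z.
  rewrite hE -opprD scalerN -addrA.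
  rewrite (_ : s *: h' + h' = (1 + s) *: h'); last by rewrite scalerDl scale1r addrC.
  by rewrite (scalerA t) ts subrr addr0.
rewrite zE in u2.
have u3 : (1 + s) * f z <= f (z + h) + s * f (z - h').
  have := ler_wpM2l (ltW s1p) u2.
  have -> : (1 + s) * ((1 - t) * f (z + h) + t * f (z - h'))
     = (1 + s - t * (1 + s)) * f (z + h) + t * (1 + s) * f (z - h') by lra.
  by rewrite ts addrK mul1r.
have u4 : s * f (z + h') <= s * M by rewrite ler_pM2l.
have u5 : s * f (z - h') <= s * M by rewrite ler_pM2l.
by rewrite ler_norml; apply/andP; split; lra.
Qed.

End ConvexContinuity.
End RelativelyOpen.

(** * Directional calculus of a barrier *)

Section BarrierCalculus.
Context {R : realType} (N : nat).
Implicit Types (z h : 'rV[R]_N).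

Lemma derive1_translate (f : R -> R) (a : R) :
  derive1 (fun u => f (u + a)) = (fun u => derive1 f (u + a)).
Proof.
apply/funext => u; rewrite /derive1.
suff -> : (fun h : R => h^-1 *: (f (h + u + a) - f (u + a)))
  = (fun h : R => h^-1 *: (f (h + (u + a)) - f (u + a))) by [].
by apply/funext => t; rewrite addrA.
Qed.

Lemma Dk_line k (Psi : 'rV[R]_N -> R) z h (s : R) :
  Dk k Psi (z + s *: h) h = derive1n k (along Psi z h) s.
Proof.
rewrite /Dk; have -> : along Psi (z + s *: h) h = (fun u => along Psi z h (u + s)).
  by apply/funext => u; rewrite /along -addrA -scalerDl (addrC s).
suff -> : derive1n k (fun u => along Psi z h (u + s)) = (fun u => derive1n k (along Psi z h) (u + s)).
  by rewrite add0r.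
by elim: k => [//|k ih]; rewrite !derive1nS ih derive1_translate.
Qed.

Context (D : set 'rV[R]_N) (B : 'rV[R]_N -> R) (vartheta : R).
Hypothesis cD : convex_set D.
Hypothesis oD : relatively_open D.
Hypothesis scB : self_concordant_barrier vartheta D B.

Lemma barrier_derive k z h : (k < 3)%N -> D z -> h \in direction D ->
  is_derive (0 : R) 1 (fun s : R => Dk k B (z + s *: h) h) (Dk k.+1 B z h).
Proof.
move=> k3 Dz hV; have [_ C3 _ _] := scB.
have [|dk _] := C3 z h 0 Dz hV; first by rewrite scale0r addr0.
have -> : (fun s : R => Dk k B (z + s *: h) h) = derive1n k (along B z h).
  by apply/funext => s; rewrite Dk_line.
apply: DeriveDef; first exact: dk.
by rewrite /Dk derive1nS derive1E.
Qed.

Lemma Dk0 z h : Dk 0 B z h = B z.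
Proof. by rewrite /Dk /along /= scale0r addr0. Qed.

Lemma barrier_derive1 z h : D z -> h \in direction D ->
  is_derive (0 : R) 1 (fun s : R => B (z + s *: h)) (Dk 1 B z h).
Proof.
move=> Dz hV; have := @barrier_derive 0 z h isT Dz hV.
by under eq_fun do rewrite Dk0.
Qed.

Lemma Dk1Z z h (t : R) : D z -> h \in direction D -> Dk 1 B z (t *: h) = t * Dk 1 B z h.
Proof.
move=> Dz hV; have thV : t *: h \in direction D by exact: memvZ.
apply: is_derive_unique (barrier_derive1 Dz thV) _.
have := @is_derive_dilate R (fun s => B (z + s *: h)) 0 t (Dk 1 B z h).
rewrite mul0r => /(_ (barrier_derive1 Dz hV)).
set G := (X in is_derive _ _ X _); suff -> : G = fun s => B (z + s *: (t *: h)) by [].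
by apply/funext => s; rewrite /G scalerA.
Qed.

Lemma barrier_gradient z h : D z -> h \in direction D -> D (z + h) ->
  Dk 1 B z h <= B (z + h) - B z.
Proof.
move=> Dz hV Dzh; have [cB _ _ _] := scB.
apply: (derive_le_slope (barrier_derive1 Dz hV) (@ltr01 R)) => s /andP[s0 s1].
have s01 : 0 <= s <= 1 by rewrite !ltW.
have := convex_function_segment cB Dz Dzh s01.
by rewrite add0r scale0r addr0; lra.
Qed.

Lemma line_open z h : D z -> h \in direction D ->
  exists2 e : R, 0 < e & forall t, `|t| < e -> D (z + t *: h).
Proof.
move=> Dz hV; have [e e0 De] := relatively_open_ball oD Dz.
have h0 : 0 < 1 + `|h| by rewrite ltr_pwDl.
exists (e / (1 + `|h|)); first by rewrite divr_gt0.
move=> t; rewrite ltr_pdivlMr// => te; apply: De; first exact: memvZ.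
by rewrite normrZ (le_lt_trans _ te)// ler_wpM2l// lerDr.
Qed.

(** Convexity makes the first derivative along a line nondecreasing. *)
Lemma Dk2_ge0 z h : D z -> h \in direction D -> 0 <= Dk 2 B z h.
Proof.
move=> Dz hV; have [e e0 De] := line_open Dz hV.
rewrite -oppr_le0.
have dN : is_derive (0 : R) 1 (fun s : R => - Dk 1 B (z + s *: h) h) (- Dk 2 B z h).
  exact: (is_deriveN (@barrier_derive 1 z h isT Dz hV)).
apply: (derive_le_slope dN e0) => s /andP[s0 se].
rewrite mul0r add0r scale0r addr0 /= subr_le0 lerN2.
have Ds : D (z + s *: h) by apply: De; rewrite gtr0_norm.
have shV : s *: h \in direction D by exact: memvZ.
have g1 := barrier_gradient Dz shV Ds.
have back : z + s *: h + (- s) *: h = z by rewrite scaleNr addrK.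
have NshV : (- s) *: h \in direction D by exact: memvZ.
have g2 := barrier_gradient Ds NshV (_ : D (_ + _)).
rewrite back in g2; have {}g2 := g2 Dz.
rewrite !Dk1Z// in g1 g2.
by rewrite -(ler_pM2l s0); lra.
Qed.

Lemma barrier_cubic z h : D z -> h \in direction D ->
  `|Dk 3 B z h| <= 2 * Num.sqrt (Dk 2 B z h) ^+ 3.
Proof. by move=> Dz hV; have [_ _ _ /(_ z h Dz hV)[]] := scB. Qed.

(** At a limit point outside D the barrier is infinite, so a segment along which the barrier
   stays bounded ends inside D. *)
Lemma barrier_radial z h : D z -> h \in direction D ->
  (forall t : R, 0 <= t < 1 -> D (z + t *: h)) ->
  (exists M, forall t : R, 0 <= t < 1 -> B (z + t *: h) <= M) -> D (z + h).
Proof.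
move=> Dz hV Dt [M BM]; apply: contrapT => nD; have [_ _ blow _] := scB.
have near (e : R) : 0 < e -> exists2 t : R, 0 <= t < 1 & `|z + h - (z + t *: h)| < e.
  move=> e0; have h0 : 0 < 1 + `|h| by rewrite ltr_pwDl.
  pose t := 1 - Num.min 1 (e / 2 / (1 + `|h|)).
  have m0 : 0 < Num.min 1 (e / 2 / (1 + `|h|)) by rewrite lt_min ltr01 !divr_gt0.
  exists t; first by rewrite /t subr_ge0 ge_min lexx /= gtrBl.
  have -> : z + h - (z + t *: h) = Num.min 1 (e / 2 / (1 + `|h|)) *: h.
    by rewrite opprD addrACA subrr add0r /t scalerBl scale1r opprB addrC subrK.
  rewrite normrZ gtr0_norm// (le_lt_trans (_ : _ <= e / 2 / (1 + `|h|) * (1 + `|h|)))//.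
    by rewrite ler_pM ?(ltW m0)// ?lerDr// ge_min lexx orbT.
  by rewrite mulfVK ?lt0r_neq0// gtr_pMr// invf_lt1// ltr1n.
have cl : (closure D `\` D) (z + h).
  split=> // U /nbhs_normP[e /= e0 eU]; have [t t01 te] := near e e0.
  by exists (z + t *: h); split; [exact: Dt|exact: eU].
have /cvgryPgt/(_ M) ev := blow _ cl.
have /nbhs_normP[e /= e0 eB] : nbhs (z + h) (fun x => D x -> M < B x) := ev.
have [t t01 te] := near e e0.
have := eB (z + t *: h) te (Dt _ t01).
by rewrite ltNge BM.
Qed.

End BarrierCalculus.

(** * Quadratic plus barrier *)

Section QuadraticPlusBarrier.
Context {R : realType} (N : nat) (D : set 'rV[R]_N) (B : 'rV[R]_N -> R) (vartheta : R).
Hypothesis cD : convex_set D.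
Hypothesis oD : relatively_open D.
Hypothesis scB : self_concordant_barrier vartheta D B.

Lemma is_derive_quadratic (a b c : R) : is_derive (0 : R) 1 (fun s : R => a + s * b + s ^+ 2 / 2 * c) b.
Proof.
have D1 := is_derive_cst a (0 : R) (1 : R).
have D2 := is_deriveZ b (is_derive_id (0 : R) (1 : R)).
have D3 := is_deriveZ (c / 2) (is_deriveM (is_derive_id (0 : R) (1 : R)) (is_derive_id (0 : R) (1 : R))).
have -> : (fun s : R => a + s * b + s ^+ 2 / 2 * c) = cst a + b \*: id + (c / 2) \*: (id * id).
  apply/funext => s /=; rewrite /GRing.scale /=.
  rewrite -[RHS]/(a + b * s + c / 2 * (s * s)); lra.
have := is_deriveD (is_deriveD D1 D2) D3.
by move=> /is_derive_eq; apply; rewrite /GRing.scale /=; lra.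
Qed.

(** The quadratic q increases the second derivative and leaves the third one unchanged, while
   multiplying a barrier by gamma multiplies its constant by gamma^(-1/2). The map pr embeds
   the barrier into a space with further variables, here the intercept b. *)
Lemma sc_quadratic_barrier (E : lmodType R) (pr : {linear E -> 'rV[R]_N}) (gamma : R)
    (q : E -> R) (q1 : E -> E -> R) (q2 : E -> R) :
  0 < gamma ->
  (forall z h (s : R), q (z + s *: h) = q z + s * q1 z h + s ^+ 2 / 2 * q2 h) ->
  (forall z h (s : R), q1 (z + s *: h) h = q1 z h + s * q2 h) ->
  (forall z, 0 <= q z) -> (forall h, 0 <= q2 h) -> (forall h, h != 0 -> 0 < q2 h) ->
  sc_function (Num.sqrt gamma)^-1 [set z | D (pr z)] [set h | pr h \in direction D]
    (fun z => q z + gamma * B (pr z))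
    (fun z h => q1 z h + gamma * Dk 1 B (pr z) (pr h))
    (fun z h => q2 h + gamma * Dk 2 B (pr z) (pr h))
    (fun z h => gamma * Dk 3 B (pr z) (pr h)).
Proof.
move=> g0 qE q1E q_ge0 q2_ge0 q2_gt0.
have g0' := ltW g0.
split.
- by rewrite invr_ge0 sqrtr_ge0.
- by move=> t h /= hV; rewrite linearZ memvZ.
- by move=> h h' /= hV h'V; rewrite linearD memvD.
- move=> z h t /= Dz Dzh t01; rewrite linearD linearZ /=.
  by apply: (convex_set_segment cD Dz _ t01); rewrite -linearD.
- move=> z h /= Dz hV; have [e e0 De] := line_open oD Dz hV.
  by exists e => // t te; rewrite linearD linearZ /=; exact: De.
- move=> z h /= Dz hV.
  under eq_fun do rewrite qE linearD linearZ /=.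
  exact: (is_deriveD (is_derive_quadratic (q z) (q1 z h) (q2 h))
    (is_deriveZ gamma (barrier_derive1 scB Dz hV))).
- move=> z h /= Dz hV.
  under eq_fun do rewrite q1E linearD linearZ /=.
  have dq : is_derive (0 : R) 1 (fun s : R => q1 z h + s * q2 h) (q2 h).
    have := is_derive_quadratic (q1 z h) (q2 h) 0.
    by under eq_fun do rewrite mulr0 addr0.
  exact: (is_deriveD dq (is_deriveZ gamma (barrier_derive scB (k := 1) isT Dz hV))).
- move=> z h /= Dz hV.
  under eq_fun do rewrite linearD linearZ /=.
  have := is_deriveD (is_derive_cst (q2 h) (0 : R) (1 : R)) (is_deriveZ gamma (barrier_derive scB (k := 2) isT Dz hV)).
  by rewrite add0r.
- move=> z h /= Dz hV h0; rewrite ltr_pwDl ?q2_gt0//.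
  by rewrite mulr_ge0// (Dk2_ge0 oD scB).
- move=> z h /= Dz hV; rewrite normrM (ger0_norm g0').
  have D20 := Dk2_ge0 oD scB Dz hV.
  apply: (le_trans (ler_wpM2l g0' (barrier_cubic scB Dz hV))).
  have sg : 0 < Num.sqrt gamma by rewrite sqrtr_gt0.
  have -> : gamma * (2 * Num.sqrt (Dk 2 B (pr z) (pr h)) ^+ 3)
    = 2 * (Num.sqrt gamma)^-1 * Num.sqrt (gamma * Dk 2 B (pr z) (pr h)) ^+ 3.
    rewrite sqrtrM// exprMn; set r := Num.sqrt (Dk _ _ _ _).
    have gE : gamma = Num.sqrt gamma ^+ 2 by rewrite sqr_sqrtr.
    have si : (Num.sqrt gamma)^-1 * Num.sqrt gamma = 1 by rewrite mulVf// lt0r_neq0.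
    rewrite {1}gE; set s := Num.sqrt gamma in si *.
    have -> : 2 * s^-1 * (s ^+ 3 * r ^+ 3) = (s^-1 * s) * (2 * s ^+ 2 * r ^+ 3) by lra.
    by rewrite si; lra.
  rewrite ler_wpM2l ?mulr_ge0 ?invr_ge0 ?sqrtr_ge0//.
  by rewrite lerXn2r ?nnegrE ?sqrtr_ge0// ler_wsqrtr// lerDr.
- move=> z h /= Dz hV Dt [M fM]; rewrite linearD.
  apply: (barrier_radial scB Dz hV) => [t t01|].
    by have := Dt t t01; rewrite linearD linearZ.
  exists (gamma^-1 * M) => t t01; rewrite ler_pdivlMl//.
  have := fM t t01; rewrite linearD linearZ /=; apply: le_trans.
  by rewrite lerDr.
Qed.

Lemma dot_line (z h : 'rV[R]_N) (s : R) :
  dot (z + s *: h) (z + s *: h) / 2 = dot z z / 2 + s * dot z h + s ^+ 2 / 2 * dot h h.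
Proof. by rewrite dotDl !dotDr !(dotZl, dotZr) (dotC h z); lra. Qed.

(** The second derivative is given line by line; it is a quadratic form in the direction
   because it satisfies the parallelogram law. Half of |z|^2 is added to B to make f2 positive
   definite, and subtracted at the end. *)
Lemma barrier_hessian z : D z ->
  exists2 S : 'M[R]_N, S^T = S & forall h, h \in direction D -> Dk 2 B z h = quad S h.
Proof.
move=> Dz.
have [cB _ _ _] := scB.
have dpos (h : 'rV[R]_N) : h != 0 -> 0 < dot h h.
  by move=> h0; rewrite lt0r dotxx_eq0 h0 dotxx_ge0.
have q1E (x h : 'rV[R]_N) (s : R) : dot (x + s *: h) h = dot x h + s * dot h h.
  by rewrite dotDl dotZl.
have q0 (x : 'rV[R]_N) : 0 <= dot x x / 2 by rewrite divr_ge0 ?dotxx_ge0.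
have F := @sc_quadratic_barrier _ (@idfun 'rV[R]_N) 1 (fun z => dot z z / 2) (@dot R N)
  (fun h => dot h h) ltr01 dot_line q1E q0 (@dotxx_ge0 R N) dpos.
rewrite sqrtr1 invr1 /= in F.
pose f z := dot z z / 2 + 1 * B z.
have cf : convex_function (E := 'rV[R]_N) D f.
  have key (a b : 'rV[R]_N) (c : R) : 0 <= c <= 1 ->
      dot (c *: a + (1 - c) *: b) (c *: a + (1 - c) *: b) <= c * dot a a + (1 - c) * dot b b.
    move=> /andP[c0 c1]; have := dotxx_ge0 (a - b).
    rewrite dotBr ![dot (a - b) _]dotC !dotBr !dotDl !dotDr !(dotZl, dotZr) (dotC b a) => ab.
    have : 0 <= c * (1 - c) * (dot a a - dot a b - (dot a b - dot b b)).
      by rewrite mulr_ge0// mulr_ge0// subr_ge0.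
    by lra.
  have H (u v : 'rV[R]_N) (c : R) : 0 <= c <= 1 -> D u -> D v ->
      f (c *: u + (1 - c) *: v) <= c * f u + (1 - c) * f v.
    move=> c01 Du Dv; have k1 := key u v c c01; case/andP: c01 => c0 c1.
    have k2 : B (c *: u + (1 - c) *: v) <= c * B u + (1 - c) * B v.
      by have := cB (Itv01 c0 c1) u v; rewrite !inE => h; exact: h.
    by rewrite /f; lra.
  move=> t x y; rewrite !inE => xD yD.
  by apply: (H x y t%:num) => //; rewrite ge0 le1.
have plane (x h m : 'rV[R]_N) : D x -> h \in direction D -> m \in direction D ->
  forall e : R, 0 < e -> exists2 d : R, 0 < d & forall s t : R, `|s| <= d -> `|t| <= d ->
    D (x + s *: h + t *: m) /\ `|f (x + s *: h + t *: m) - f x| <= e.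
  move=> Dx hV mV e e0.
  have [d d0 fd] := convex_continuous cf cD oD Dx e0.
  have hm0 : 0 < 1 + `|h| + `|m| by rewrite !ltr_pwDl.
  exists (d / (1 + `|h| + `|m|)); first by rewrite divr_gt0.
  move=> s t sd td; rewrite -addrA; apply: fd.
    by rewrite memvD// memvZ.
  rewrite (le_trans (ler_normD _ _))// !normrZ.
  pose c := d / (1 + `|h| + `|m|).
  have cE : c * (1 + `|h| + `|m|) = d by rewrite mulfVK// lt0r_neq0.
  have c0 : 0 < c by rewrite divr_gt0.
  have := ler_wpM2r (normr_ge0 h) (sd : `|s| <= c).
  by have := ler_wpM2r (normr_ge0 m) (td : `|t| <= c); lra.
pose Pi_ex := orthogonal_projection (direction D).
have [Pi [_ iPi PiV _]] := Pi_ex.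
have PV h : h *m Pi \in direction D by apply/PiV; rewrite -mulmxA iPi.
pose Q h := dot (h *m Pi) (h *m Pi) + 1 * Dk 2 B z (h *m Pi).
have [S sS QS] : exists2 S : 'M[R]_N, S^T = S & forall x, Q x = quad S x.
  apply: parallelogram_quad.
  - by move=> x; rewrite addr_ge0 ?dotxx_ge0// mul1r (Dk2_ge0 oD scB).
  - move=> t x; rewrite /Q -scalemxAl; exact: (sc_f2Z F t Dz (PV x)).
  - move=> x y; rewrite /Q mulmxDl mulmxBl; exact: (sc_parallelogram F plane Dz (PV x) (PV y)).
exists (S - 1%:M); first by rewrite linearB /= sS trmx1.
move=> h hV; have := QS h; rewrite /Q; have /PiV -> := hV.
have -> : quad (S - 1%:M) h = quad S h - dot h h.
  by rewrite dotE /quad /bil mulmxBr mulmxBl !mxE.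
by move=> <-; lra.
Qed.

End QuadraticPlusBarrier.

(** * Perturbing a minimum by one squared linear form *)

Section RankOnePerturbation.
Context {R : realType} {E : lmodType R}.
Context (k : R) (D V : set E) (f : E -> R) (f1 f2 f3 : E -> E -> R).
Hypothesis F : sc_function k D V f f1 f2 f3.
Hypothesis f_convex : forall z h (t : R), D z -> D (z + h) -> 0 <= t <= 1 ->
  f (z + t *: h) <= (1 - t) * f z + t * f (z + h).
Context (v : E).
Hypothesis Dv : D v.
Hypothesis vmin : forall w, D w -> f v <= f w.
Hypothesis DV : forall w, D w -> V (w - v).

Let f1_eq0 h : V h -> f1 v h = 0.
Proof.
have half m : V m -> 0 <= f1 v m.
  move=> Vm; have [e e0 De] := sc_open F Dv Vm; rewrite -oppr_le0.
  have dN : is_derive (0 : R) 1 (fun s : R => - f (v + s *: m)) (- f1 v m).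
    exact: (is_deriveN (sc_deriv1 F Dv Vm)).
  apply: (derive_le_slope dN e0) => s /andP[s0 se].
  rewrite mul0r add0r scale0r addr0 subr_le0 lerN2; apply: vmin; apply: De.
  by rewrite gtr0_norm.
move=> Vh; have := half _ Vh; have := half _ (sc_scale F (-1) Vh).
by rewrite (sc_f1Z F)// => *; lra.
Qed.

(* Here l is the linear form (theta, b) -> b - <z, theta> of a sample, and g its squared dual
   norm for the Hessian at the minimiser v. *)
Context (l : E -> R) (n g : R).
Hypothesis l_add : forall u h, l (u + h) = l u + l h.
Hypothesis l_scale : forall t h, l (t *: h) = t * l h.
Hypothesis n_gt0 : 0 < n.
Hypothesis g_attained : exists y, [/\ V y, l y = g & f2 v y = g].
Hypothesis g_bound : forall h, V h -> l h ^+ 2 <= g * f2 v h.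

Let x : R := l v.
Let G w : R := f w + (2 * n)^-1 * l w ^+ 2.
Let X : R := `|x| / Num.sqrt n.

Let g_ge0 : 0 <= g.
Proof. by have [y [Vy _ <-]] := g_attained; exact: (sc_f2_ge0 F). Qed.

Let X_ge0 : 0 <= X. Proof. by rewrite divr_ge0 ?sqrtr_ge0. Qed.

Let X_sqr : X ^+ 2 = x ^+ 2 / n.
Proof. by rewrite /X expr_div_n real_normK ?num_real// sqr_sqrtr// ltW. Qed.

Let m : R := x ^+ 2 / (2 * (n + g)).

Let ng_gt0 : 0 < n + g. Proof. by rewrite ltr_pwDl. Qed.

Let m_le : m <= X ^+ 2 / 2.
Proof.
rewrite X_sqr /m -mulrA ler_wpM2l ?sqr_ge0// -invfM.
by rewrite lef_pV2 ?posrE ?mulr_gt0//; have := g_ge0; lra.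
Qed.

Let m_ge0 : 0 <= m.
Proof. by rewrite divr_ge0 ?sqr_ge0// mulr_ge0// ltW. Qed.

(** Completing the square: the quadratic model is minimised at the value m. *)
Let model_ge h : V h -> m <= f2 v h / 2 + (2 * n)^-1 * (x + l h) ^+ 2.
Proof.
move=> Vh; have := g_bound Vh; have := sc_f2_ge0 F Dv Vh.
move: (f2 v h) (l h : R) => q s q0 sq; rewrite /m ler_pdivrMr ?mulr_gt0//.
pose i := (2 * n)^-1; rewrite -/i.
have ni : 2 * n * i = 1 by rewrite divff// mulf_neq0// lt0r_neq0.
have i0 : 0 < i by rewrite invr_gt0 mulr_gt0.
suff : 2 * n * x ^+ 2 <= 2 * n * ((q / 2 + i * (x + s) ^+ 2) * (2 * (n + g))).
  by rewrite ler_pM2l ?mulr_gt0.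
have -> : 2 * n * ((q / 2 + i * (x + s) ^+ 2) * (2 * (n + g)))
   = 2 * n * q * (n + g) + (2 * n * i) * (x + s) ^+ 2 * (2 * (n + g)) by lra.
rewrite ni.
have : 0 <= g * (x + s) ^+ 2 + 2 * n * ((x + s) * s) + n ^+ 2 * q.
  have [q00|qn0] := eqVneq q 0.
    have s0 : s = 0 by apply/eqP; rewrite -sqrf_eq0 eq_le sqr_ge0 andbT; rewrite q00 mulr0 in sq.
    by rewrite s0 q00 !mulr0 !addr0 mulr_ge0// sqr_ge0.
  have qgt0 : 0 < q by rewrite lt0r qn0.
  have : 0 <= (s * (x + s) + n * q) ^+ 2 by exact: sqr_ge0.
  have : s ^+ 2 * (x + s) ^+ 2 <= g * q * (x + s) ^+ 2 by rewrite ler_wpM2r ?sqr_ge0.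
  by move=> *; rewrite -(pmulr_rge0 _ qgt0); lra.
have : 0 <= n * (g * q - s ^+ 2) by rewrite mulr_ge0 ?subr_ge0// ltW.
by lra.
Qed.

Let X3 : R := k * X ^+ 3.

Let X3_ge0 : 0 <= X3.
Proof. by rewrite mulr_ge0 ?exprn_ge0 ?(sc_const_ge0 F). Qed.

(** Lower bound. If the step h is short for the local norm, Taylor's formula reduces to the
   model, whose minimum is m. If it is long, convexity carries the growth of f at local
   distance 2 X to every larger distance. When k X is at least 1/2 the error term alone exceeds
   m. *)
Lemma perturbed_ge w : D w -> f v + m - 3 * X3 <= G w.
Proof.
move=> Dw; set h := w - v; have wE : w = v + h by rewrite addrC subrK.
have Dvh : D (v + h) by rewrite -wE.
have Vh : V h := DV Dw; have k0 := sc_const_ge0 F.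
have Gf : f w <= G w by rewrite lerDl mulr_ge0 ?sqr_ge0 ?invr_ge0 ?mulr_ge0 ?ltW.
have [kX|kX] := leP (2^-1) (k * X).
  apply: le_trans Gf; apply: le_trans (vmin Dw).
  have : X ^+ 2 / 2 <= X3.
    have -> : X3 = (k * X) * X ^+ 2 by rewrite /X3; lra.
    by rewrite mulrC ler_wpM2r ?sqr_ge0.
  by have := m_le; have := X3_ge0; lra.
set r := Num.sqrt (f2 v h); have r0 : 0 <= r by exact: sqrtr_ge0.
have r2 : r ^+ 2 = f2 v h by rewrite sqr_sqrtr// (sc_f2_ge0 F).
have [r2X|r2X] := leP r (2 * X).
  have [+ _] := sc_taylor F Dv Dvh Vh.
  rewrite -wE f1_eq0// -/r => lo.
  have := model_ge Vh.
  have -> : x + l h = l w by rewrite [in RHS]wE l_add.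
  have : k * r ^+ 3 <= k * (2 * X) ^+ 3.
    by apply: ler_wpM2l => //; apply: lerXn2r => //; rewrite nnegrE// mulr_ge0.
  by rewrite /G; have := X3_ge0; rewrite /X3 => *; lra.
have rgt0 : 0 < r by apply: le_lt_trans r2X; rewrite mulr_ge0.
pose t := 2 * X / r.
have tr : t * r = 2 * X by rewrite mulfVK// lt0r_neq0.
have t0 : 0 <= t by rewrite divr_ge0 ?mulr_ge0.
have t1 : t <= 1 by rewrite ler_pdivrMr// mul1r ltW.
have t01 : 0 <= t <= 1 by rewrite t0.
have Dt : D (v + t *: h) by exact: (sc_convex F).
have [lo _] := sc_taylor F Dv Dt (sc_scale F t Vh).
rewrite f1_eq0 ?(sc_f2Z F)// in lo; last exact: (sc_scale F).
rewrite sqrtrM ?sqr_ge0// sqrtr_sqr ger0_norm// -/r tr -r2 in lo.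
have e1 : t ^+ 2 * r ^+ 2 = 4 * X ^+ 2 by rewrite -exprMn tr exprMn; lra.
have e2 : k * (2 * X) ^+ 3 <= 4 * X ^+ 2.
  have -> : k * (2 * X) ^+ 3 = (k * X) * (8 * X ^+ 2) by lra.
  have := ler_wpM2r (_ : 0 <= 8 * X ^+ 2) (ltW kX).
  by rewrite mulr_ge0 ?sqr_ge0// => /(_ isT); lra.
have up := f_convex Dv Dvh t01; rewrite -wE in up.
have : f (v + t *: h) <= f w.
  apply: (le_trans up); have := ler_wpM2l (_ : 0 <= 1 - t) (vmin Dw).
  by rewrite subr_ge0 t1 => /(_ isT); lra.
move: lo; rewrite e1 => *.
by have := m_le; have := X3_ge0; have := sqr_ge0 X; lra.
Qed.

(** Upper bound. The Newton step of the quadratic model is a competitor as long as it lies in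
   the Dikin ellipsoid; otherwise the point v is good enough. *)
Lemma perturbed_le : exists2 w, D w & G w <= f v + m + X3.
Proof.
have k0 := sc_const_ge0 F.
have [kX|kX] := leP (k * X) 1; last first.
  exists v => //; rewrite /G -/x.
  have -> : (2 * n)^-1 * x ^+ 2 = X ^+ 2 / 2 by rewrite X_sqr invfM; lra.
  have : X ^+ 2 <= X3.
    have -> : X3 = (k * X) * X ^+ 2 by rewrite /X3; lra.
    by rewrite ler_peMl ?sqr_ge0// ltW.
  by have := m_ge0; have := sqr_ge0 X; lra.
have [y [Vy ly f2y]] := g_attained.
pose a := - x / (n + g); have ang : a * (n + g) = - x by rewrite mulfVK// lt0r_neq0.
have Vh := sc_scale F a Vy.
have qE : f2 v (a *: y) = a ^+ 2 * g by rewrite (sc_f2Z F)// f2y.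
have q_le : a ^+ 2 * g <= X ^+ 2 / 4.
  rewrite X_sqr -mulrA -invfM ler_pdivlMr ?mulr_gt0//.
  have -> : x ^+ 2 = a ^+ 2 * (n + g) ^+ 2 by rewrite -exprMn ang sqrrN.
  rewrite -mulrA ler_wpM2l ?sqr_ge0//.
  by have := sqr_ge0 (n - g); lra.
set r := Num.sqrt (f2 v (a *: y)).
have rX : r <= X / 2.
  have -> : X / 2 = Num.sqrt ((X / 2) ^+ 2) by rewrite sqrtr_sqr ger0_norm// divr_ge0.
  by rewrite /r qE ler_wsqrtr// (le_trans q_le)//; lra.
have kr : k * r <= 2^-1.
  by have := ler_wpM2l k0 rX; lra.
have Dw := sc_dikin F Dv Vh kr.
have [_ /(_ kr)] := sc_taylor F Dv Dw Vh.
rewrite f1_eq0// -/r qE => up.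
have r0 : 0 <= r by exact: sqrtr_ge0.
have r3 : k * r ^+ 3 <= k * (X / 2) ^+ 3.
  by apply: ler_wpM2l => //; apply: lerXn2r => //; rewrite nnegrE// divr_ge0.
exists (v + a *: y) => //; rewrite /G l_add l_scale ly -/x.
have -> : x + a * g = - a * n by have := ang; lra.
have -> : (2 * n)^-1 * (- a * n) ^+ 2 = a ^+ 2 * n / 2.
  have -> : (2 * n)^-1 * (- a * n) ^+ 2 = (n^-1 * n) * a ^+ 2 * n / 2 by rewrite invfM; lra.
  by rewrite mulVf ?lt0r_neq0// mul1r.
have -> : m = a ^+ 2 * (n + g) / 2.
  rewrite /m (_ : x ^+ 2 = a ^+ 2 * (n + g) * (n + g)); last first.
    by have : x ^+ 2 = (a * (n + g)) ^+ 2 by [rewrite ang sqrrN|]; lra.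
  rewrite invfM.
  have -> : a ^+ 2 * (n + g) * (n + g) * (2^-1 / (n + g)) = (n + g) / (n + g) * (a ^+ 2 * (n + g) / 2) by lra.
  by rewrite divff ?mul1r// lt0r_neq0.
have := X3_ge0; rewrite /X3 in r3 *.
by lra.
Qed.

End RankOnePerturbation.

(** * Existence of a minimiser *)

Section Minimiser.
Context {R : realType} (N : nat) (D : set 'rV[R]_N) (B : 'rV[R]_N -> R) (vartheta : R).
Hypothesis D0 : D !=set0.
Hypothesis bD : bounded_set D.
Hypothesis cD : convex_set D.
Hypothesis oD : relatively_open D.
Hypothesis scB : self_concordant_barrier vartheta D B.

(** A minimising sequence stays in a compact set, and its cluster points avoid the relative
   boundary because the barrier is infinite there. *)
Lemma barrier_minimiser (gamma : R) (g : 'rV[R]_N -> R) : 0 < gamma ->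
  convex_function (E := 'rV[R]_N) D g ->
  (forall x, D x -> gamma * B x <= g x) -> (forall x, D x -> 0 <= g x) ->
  exists2 p, D p & forall x, D x -> g p <= g x.
Proof.
move=> g0 cg gB g_ge0.
have [M [Mreal DM]] := bD.
have hinf : has_inf (g @` D).
  by case: D0 => x Dx; split; [exists (g x), x|exists 0 => _ [y Dy <-]; exact: g_ge0].
pose I := inf (g @` D).
have seq_ex (k : nat) : exists x, D x /\ g x < I + k.+1%:R^-1.
  have [_ [x Dx <-] xk] : exists2 y, (g @` D) y & y < I + k.+1%:R^-1.
    by apply: inf_lt; [exact: hinf.1|rewrite ltrDl invr_gt0].
  by exists x.
have [s sP] := choice seq_ex.
have Kc : compact [set x : 'rV[R]_N | `|x| <= `|M| + 1].
  apply: bounded_closed_compact.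
    by exists (`|M| + 1); split => // y My x /= xM; exact: le_trans xM (ltW My).
  apply: (@closed_comp _ _ (fun x : 'rV[R]_N => `|x|) [set y | y <= `|M| + 1]).
    by move=> x _; exact: norm_continuous.
  exact: closed_le.
have [p [_ pcl]] : [set x : 'rV[R]_N | `|x| <= `|M| + 1] `&` cluster (s @ \oo) !=set0.
  apply: Kc; exists 0%N => // k _ /=.
  by apply: DM (sP k).1; rewrite (le_lt_trans (ler_norm M))// ltrDl.
have ev (e : R) : 0 < e -> (s @ \oo) [set x | D x /\ g x <= I + e].
  move=> e0; rewrite /= -[_ _]/(\forall k \near \oo, [set x | D x /\ g x <= I + e] (s k)).
  near=> k; have [Dk gk] := sP k; split=> //.
  rewrite (le_trans (ltW gk))// lerD2l ltW//.
  by near: k; exact: near_infty_natSinv_lt (PosNum e0).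
have Dp : D p.
  apply: contrapT => nDp; have [_ _ blow _] := scB.
  have cl : (closure D `\` D) p.
    split=> // U pU; have [x [[Dx _] Ux]] := pcl _ _ (ev 1 ltr01) pU.
    by exists x.
  have /cvgryPgt/(_ (gamma^-1 * (I + 1))) evB := blow _ cl.
  have [x [[Dx gx] /= /(_ Dx)]] := pcl _ _ (ev 1 ltr01) evB.
  rewrite ltr_pdivrMl// => /(le_lt_trans gx).
  by rewrite ltNge gB.
exists p => // x Dx; apply: (@le_trans _ _ I); last first.
  by apply: inf_lbound; [exact: hinf.2|exists x].
apply/ler_addgt0Pr => e e0; have e2 : 0 < e / 2 by rewrite divr_gt0.
have [d d0 gd] := convex_continuous cg cD oD Dp e2.
have nb : \forall y \near p, `|p - y| < d by apply/nbhs_normP; exists d.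
have [y [[Dy gy] /= yd]] := pcl _ _ (ev _ e2) nb.
have ypd : `|y - p| <= d by rewrite distrC ltW.
have [_] := gd (y - p) (direction_diff Dy Dp) ypd.
have -> : p + (y - p) = y by rewrite addrC subrK.
rewrite ler_norml => /andP[? ?].
by lra.
Unshelve. all: by end_near. Qed.

End Minimiser.

(** * Leave-one-out expansion of the regularized value *)

Section RegularisedLeastSquares.
Context {R : realType} (N n : nat) (D : set 'rV[R]_N) (B : 'rV[R]_N -> R) (vartheta : R).
Hypothesis D0 : D !=set0.
Hypothesis bD : bounded_set D.
Hypothesis cD : convex_set D.
Hypothesis oD : relatively_open D.
Hypothesis B_ge0 : forall x, D x -> 0 <= B x.
Hypothesis scB : self_concordant_barrier vartheta D B.
Context (lambda beta gamma : R).
Hypothesis lambda_gt0 : 0 < lambda.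
Hypothesis beta_gt0 : 0 < beta.
Hypothesis gamma_gt0 : 0 < gamma.
Hypothesis n_gt0 : (0 < n)%N.

(** The problem with the samples outside P left out keeps the normalisation 1 / (2 n), so that
   putting a sample back is exactly adding its squared residual. *)
Definition partial_objective (P : pred 'I_n) (Z : 'I_n -> 'rV[R]_N) (th : 'rV[R]_N) (b : R) : R :=
  (2 * n%:R)^-1 * \sum_(j | P j) (b - dot (Z j) th) ^+ 2
  + beta * (lambda * norm2 th ^+ 2 + b ^+ 2).

Definition partial_Phi (P : pred 'I_n) (Z : 'I_n -> 'rV[R]_N) : R :=
  inf [set partial_objective P Z th b + gamma * B th | th in D & b in [set: R]].

Section FixedSample.
Context (P : pred 'I_n) (Z : 'I_n -> 'rV[R]_N).
Local Notation E := ('rV[R]_N * R)%type.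
Implicit Types (v w h : E).

Let res v j : R := v.2 - dot (Z j) v.1.

Let q v : R := (2 * n%:R)^-1 * \sum_(j | P j) res v j ^+ 2
  + beta * (lambda * dot v.1 v.1 + v.2 ^+ 2).

Let q1 v h : R := 2 * ((2 * n%:R)^-1 * \sum_(j | P j) (res v j * res h j)
  + beta * (lambda * dot v.1 h.1 + v.2 * h.2)).

Let q2 h : R := 2 * q h.

Let n0 : 0 < (2 * n%:R)^-1 :> R.
Proof. by rewrite invr_gt0 mulr_gt0// ltr0n. Qed.

Let res_line v h (s : R) j : res (v + s *: h) j = res v j + s * res h j.
Proof.
rewrite /res -[(v + s *: h).2]/(v.2 + s * h.2) -[(v + s *: h).1]/(v.1 + s *: h.1).
by rewrite dotDr dotZr; lra.
Qed.

Let sum_sqr_line (u w : 'I_n -> R) (s : R) : \sum_(j | P j) (u j + s * w j) ^+ 2 =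
  \sum_(j | P j) u j ^+ 2 + 2 * s * (\sum_(j | P j) u j * w j) + s ^+ 2 * \sum_(j | P j) w j ^+ 2.
Proof.
rewrite !mulr_sumr -!big_split /=; apply: eq_bigr => j _; lra.
Qed.

Let qE v h (s : R) : q (v + s *: h) = q v + s * q1 v h + s ^+ 2 / 2 * q2 h.
Proof.
rewrite /q2 /q1 /q; under eq_bigr do rewrite res_line.
rewrite sum_sqr_line -[(v + s *: h).2]/(v.2 + s * h.2) -[(v + s *: h).1]/(v.1 + s *: h.1).
by rewrite dotDl !dotDr !(dotZl, dotZr) (dotC h.1 v.1); lra.
Qed.

Let q1E v h (s : R) : q1 (v + s *: h) h = q1 v h + s * q2 h.
Proof.
rewrite /q2 /q1 /q -[(v + s *: h).2]/(v.2 + s * h.2) -[(v + s *: h).1]/(v.1 + s *: h.1).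
have -> : \sum_(j | P j) res (v + s *: h) j * res h j
    = \sum_(j | P j) res v j * res h j + s * \sum_(j | P j) res h j ^+ 2.
  by rewrite mulr_sumr -big_split /=; apply: eq_bigr => j _; rewrite res_line; lra.
by rewrite dotDl dotZl; lra.
Qed.

Let q_lower v : beta * (lambda * dot v.1 v.1 + v.2 ^+ 2) <= q v.
Proof.
by rewrite lerDr mulr_ge0 ?(ltW n0)//; apply: sumr_ge0 => j _; exact: sqr_ge0.
Qed.

Let ridge_ge0 v : 0 <= beta * (lambda * dot v.1 v.1 + v.2 ^+ 2).
Proof.
apply: mulr_ge0; first exact: ltW.
by apply: addr_ge0; [apply: mulr_ge0; [exact: ltW|exact: dotxx_ge0]|exact: sqr_ge0].
Qed.

Let q_ge0 v : 0 <= q v. Proof. exact: le_trans (ridge_ge0 v) (q_lower v). Qed.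

Let q2_ge0 h : 0 <= q2 h. Proof. by rewrite mulr_ge0. Qed.

Let q2_gt0 h : h != 0 -> 0 < q2 h.
Proof.
move=> h0; rewrite mulr_gt0//; apply: lt_le_trans (q_lower h); rewrite mulr_gt0//.
have [h10|h10] := eqVneq h.1 0.
  have h20 : h.2 != 0.
    by apply: contraNneq h0 => h20; case: h h10 h20 => a b /= -> ->.
  by rewrite h10 dot0r mulr0 add0r lt0r sqr_ge0 sqrf_eq0 h20.
by rewrite ltr_pwDl ?sqr_ge0// mulr_gt0// lt0r dotxx_eq0 h10 dotxx_ge0.
Qed.

Let f v : R := q v + gamma * B v.1.

Let f_sc := @sc_quadratic_barrier R N D B vartheta cD oD scB E fst gamma q q1 q2 gamma_gt0 qE q1E q_ge0 q2_ge0 q2_gt0.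

Let f_convex v h (t : R) : D v.1 -> D (v + h).1 -> 0 <= t <= 1 ->
  f (v + t *: h) <= (1 - t) * f v + t * f (v + h).
Proof.
move=> Dv Dvh t01; have [cB _ _ _] := scB.
have := convex_function_segment cB Dv Dvh t01.
have qh := qE v h 1; rewrite scale1r in qh; rewrite /f qE qh.
have := q2_ge0 h; case/andP: t01 => t0 t1 ? ?.
have : 0 <= (t - t ^+ 2) * q2 h.
  by rewrite mulr_ge0// subr_ge0 expr2 ler_piMl.
have : gamma * B (v.1 + t *: h.1) <= gamma * ((1 - t) * B v.1 + t * B (v.1 + h.1)).
  by rewrite ler_pM2l.
rewrite -[(v + t *: h).1]/(v.1 + t *: h.1) -[(v + h).1]/(v.1 + h.1).
by move=> *; lra.
Qed.

Let e2 : E := (0, 1).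

Let e2_gt0 : 0 < q2 e2.
Proof.
apply: q2_gt0; apply/eqP => /(congr1 snd) /= /eqP; by rewrite oner_eq0.
Qed.

(** The best intercept for a given theta: eliminating b leaves a problem on the bounded set D.
   *)
Let best th : R := - q1 (th, 0) e2 / q2 e2.

Let pair_e2 th (b : R) : (th, b) = (th, 0) + b *: e2 :> E.
Proof.
rewrite /e2; congr pair; first by rewrite /= scaler0 addr0.
by rewrite add0r -[RHS]/(b * 1) mulr1.
Qed.

Let best_le th (b : R) : q (th, best th) <= q (th, b).
Proof.
have -> : (th, b) = (th, best th) + (b - best th) *: e2 :> E.
  by rewrite [in RHS]pair_e2 -addrA -scalerDl subrKC -pair_e2.
rewrite qE [X in _ <= _ + _ * X + _](_ : _ = 0).
  by rewrite mulr0 addr0 lerDl mulr_ge0 ?divr_ge0 ?sqr_ge0.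
by rewrite pair_e2 q1E /best mulfVK ?lt0r_neq0// subrr.
Qed.

Lemma partial_minimiser : exists th b, D th /\
  forall th' b', D th' -> f (th, b) <= f (th', b').
Proof.
pose g th : R := f (th, best th).
have g_le th b : g th <= f (th, b) by rewrite /g /f lerD2r best_le.
have cg : convex_function (E := 'rV[R]_N) D g.
  have H (x y : 'rV[R]_N) (c : R) : 0 <= c <= 1 -> D x -> D y ->
      g (c *: x + (1 - c) *: y) <= c * g x + (1 - c) * g y.
    move=> c01 Dx Dy.
    pose v : E := (y, best y); pose h : E := (x, best x) - v.
    have vh : v + h = (x, best x) by rewrite addrC subrK.
    have vhD : D (v + h).1 by rewrite vh.
    have := f_convex (v := v) Dy vhD c01; rewrite vh [leRHS]addrC; apply: le_trans.
    have -> : v + c *: h = (c *: x + (1 - c) *: y, (v + c *: h).2).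
      congr pair; rewrite -[LHS]/(y + c *: (x - y)).
      by rewrite scalerBr scalerBl scale1r addrCA.
    exact: g_le.
  move=> t x y; rewrite !inE => xD yD.
  by apply: (H x y t%:num) => //; rewrite ge0 le1.
have [x Dx|x Dx|th Dth thmin] := barrier_minimiser D0 bD cD oD scB gamma_gt0 cg.
- by rewrite /g /f lerDr.
- by rewrite addr_ge0// mulr_ge0 ?B_ge0// ltW.
exists th, (best th); split=> // th' b' Dth'.
exact: le_trans (thmin _ Dth') (g_le _ _).
Qed.

Let hessian_matrix (S : 'M[R]_N) : 'M[R]_(N + 1) :=
  n%:R^-1 *: (\sum_(j | P j) (augment (- Z j) 1)^T *m augment (- Z j) 1)
  + block_mx ((2 * beta * lambda) *: 1%:M + gamma *: S) 0 0 (2 * beta)%:M.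

Let hessian_matrix_sym S : S^T = S -> (hessian_matrix S)^T = hessian_matrix S.
Proof.
move=> sS; rewrite /hessian_matrix linearD linearZ /= linear_sum /=.
rewrite tr_block_mx !trmx0 linearD linearZ /= linearZ /= sS trmx1 tr_scalar_mx.
by congr (_ *: _ + _); apply: eq_bigr => j _; rewrite trmx_mul trmxK.
Qed.

Let bil_addm m p (A A' : 'M[R]_(m, p)) x y : bil (A + A') x y = bil A x y + bil A' x y.
Proof. by rewrite /bil mulmxDr mulmxDl mxE. Qed.

Let bil_scalem m p (A : 'M[R]_(m, p)) c x y : bil (c *: A) x y = c * bil A x y.
Proof. by rewrite /bil -scalemxAr -scalemxAl mxE. Qed.

Let hessian_matrixE S v : quad (hessian_matrix S) (augment v.1 v.2)
  = q2 v + gamma * quad S v.1.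
Proof.
have sumE (r : seq 'I_n) x y : bil (\sum_(j <- r | P j) (augment (- Z j) 1)^T *m augment (- Z j) 1) x y
    = \sum_(j <- r | P j) dot (augment (- Z j) 1) x * dot (augment (- Z j) 1) y.
  elim/big_rec2 : _ => [|j s A _ <-]; first by rewrite /bil mulmx0 mul0mx mxE.
  rewrite bil_addm; congr (_ + _).
  by rewrite (dotC _ x) !dotE /bil !mulmx1 mulmxA -mulmxA mxE big_ord1.
rewrite quadE /hessian_matrix bil_addm bil_scalem sumE.
have resE j : dot (augment (- Z j) 1) (augment v.1 v.2) = res v j.
  by rewrite dot_augment mul1r dotC dotNr dotC addrC.
under eq_bigr do rewrite !resE -expr2.
have -> : bil (block_mx ((2 * beta * lambda) *: 1%:M + gamma *: S) 0 0 (2 * beta)%:M)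
    (augment v.1 v.2) (augment v.1 v.2)
    = 2 * beta * lambda * dot v.1 v.1 + gamma * quad S v.1 + 2 * beta * v.2 ^+ 2.
  rewrite bil_dot /augment mul_row_block !mulmx0 addr0 add0r -scalar_mxM -/(augment _ _).
  rewrite dot_augment -bil_dot bil_addm !bil_scalem -dotE quadE; lra.
rewrite /q2 /q invfM; lra.
Qed.

Let phi0 th b : partial_objective P Z th b + gamma * B th = f (th, b).
Proof. by rewrite /partial_objective norm2_sqr. Qed.

Let inf_min (S : set R) m : S m -> (forall y, S y -> m <= y) -> inf S = m.
Proof.
move=> Sm mS; apply/le_anti/andP; split.
  by apply: inf_lbound => //; exists m.
by apply: lb_le_inf => //; exists m.
Qed.

(** The deterministic core. With v = (th, b) the minimiser of the partial problem and x the
   residual of an added sample z at v, the value increases by x^2 / (2 (n + g)) up to a cubic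
   error, where g is the quadratic polynomial in z given by the inverse Hessian at v. The first
   clause bounds v by the value, and the crude bounds on Psi hold for all samples. *)
Lemma partial_expansion : exists th b (T : 'M[R]_N) (u : 'rV[R]_N) (e : R),
  [/\ beta * (lambda * dot th th + b ^+ 2) <= partial_Phi P Z,
    T^T = T,
    normF T ^+ 2 <= (\dim (direction D))%:R / (2 * beta * lambda) ^+ 2,
    dot u u <= (\dim (direction D))%:R / (4 * beta ^+ 2 * lambda) &
    forall z, let x := b - dot z th in let g := quad T z - 2 * dot u z + e in
      let Psi := inf [set partial_objective P Z t c + gamma * B t + (2 * n%:R)^-1 * (c - dot z t) ^+ 2
          | t in D & c in [set: R]] in
      [/\ 0 <= g, partial_Phi P Z <= Psi, Psi <= partial_Phi P Z + (2 * n%:R)^-1 * x ^+ 2 &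
        `|Psi - partial_Phi P Z - x ^+ 2 / (2 * (n%:R + g))|
          <= 3 * ((Num.sqrt gamma)^-1 * (`|x| / Num.sqrt n%:R) ^+ 3)]].
Proof.
have [th [b [Dth vmin]]] := partial_minimiser.
pose v : E := (th, b).
have PhiE : partial_Phi P Z = f v.
  apply: inf_min; first by exists th => //; exists b => //; rewrite phi0.
  by move=> _ [t Dt [c _ <-]]; rewrite phi0; exact: vmin.
have [S sS SE] := barrier_hessian cD oD scB Dth.
have Hge (h : 'rV[R]_N) (c : R) : h \in direction D ->
    2 * beta * (lambda * dot h h + c ^+ 2) <= quad (hessian_matrix S) (augment h c).
  move=> hV; rewrite (hessian_matrixE S (h, c)) /= -SE//.
  have := Dk2_ge0 oD scB Dth hV; have := q_lower (h, c); rewrite /q2 /= => ? D20.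
  have : 0 <= gamma * Dk 2 B th h by rewrite mulr_ge0// ltW.
  by lra.
have [T [u [e [sT Tb ub model]]]] :=
  quadratic_model lambda_gt0 beta_gt0 (hessian_matrix_sym sS) Hge.
exists th, b, T, u, e; split=> //.
  by rewrite PhiE (le_trans (q_lower v))// lerDl mulr_ge0 ?B_ge0// ltW.
move=> z x g Psi; have [[h [c [hV lg Qg]]] gb] := model z.
have N0 : 0 < n%:R :> R by rewrite ltr0n.
pose l (w : E) : R := w.2 - dot z w.1.
have ladd (w w' : E) : l (w + w') = l w + l w'.
  rewrite /l -[(w + w').2]/(w.2 + w'.2) -[(w + w').1]/(w.1 + w'.1) dotDr; lra.
have lscale (t : R) (w : E) : l (t *: w) = t * l w.
  rewrite /l -[(t *: w).2]/(t * w.2) -[(t *: w).1]/(t *: w.1) dotZr; lra.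
have f2E (w : E) : w.1 \in direction D ->
    q2 w + gamma * Dk 2 B v.1 w.1 = quad (hessian_matrix S) (augment w.1 w.2).
  by move=> wV; rewrite hessian_matrixE SE.
have att : exists y : E, [/\ y.1 \in direction D, l y = g & q2 y + gamma * Dk 2 B v.1 y.1 = g].
  by exists (h, c); split => //; rewrite f2E.
have bound (w : E) : w.1 \in direction D -> l w ^+ 2 <= g * (q2 w + gamma * Dk 2 B v.1 w.1).
  by move=> wV; rewrite f2E//; exact: gb.
have DV (w : E) : D w.1 -> (w - v).1 \in direction D by move=> Dw; exact: direction_diff.
have vmin' (w : E) : D w.1 -> f v <= f w by case: w => t c' /= Dt; exact: vmin.
have lower := @perturbed_ge _ _ _ _ _ _ _ _ _ f_sc f_convex v Dth vmin' DV l n%:R g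
  ladd N0 att bound.
have [w Dw upper] := @perturbed_le _ _ _ _ _ _ _ _ _ f_sc v Dth vmin' l n%:R g
  ladd lscale N0 att.
have lvE : l v = x by [].
rewrite lvE in lower upper.
have g_ge0 : 0 <= g.
  have := Hge _ c hV; rewrite Qg; apply: le_trans.
  by have := ridge_ge0 (h, c); rewrite /=; lra.
have Psi_set y : [set partial_objective P Z t c + gamma * B t + (2 * n%:R)^-1 * (c - dot z t) ^+ 2
          | t in D & c in [set: R]] y <-> exists2 w : E, D w.1 & y = f w + (2 * n%:R)^-1 * l w ^+ 2.
  split=> [[t Dt [c' _ <-]]|[[t c'] Dt ->]].
    by exists (t, c') => //; rewrite phi0.
  by exists t => //; exists c' => //; rewrite phi0.
have Psi_lb m : (forall w : E, D w.1 -> m <= f w + (2 * n%:R)^-1 * l w ^+ 2) -> m <= Psi.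
  move=> mle; apply: lb_le_inf.
    by exists (f v + (2 * n%:R)^-1 * l v ^+ 2); apply/Psi_set; exists v.
  by move=> y /Psi_set[w' Dw' ->]; exact: mle.
have Psi_ub (w' : E) : D w'.1 -> Psi <= f w' + (2 * n%:R)^-1 * l w' ^+ 2.
  move=> Dw'; apply: inf_lbound; last by apply/Psi_set; exists w'.
  exists (f v) => y /Psi_set[w1 Dw1 ->]; apply: (le_trans (vmin' _ Dw1)).
  by rewrite lerDl mulr_ge0 ?sqr_ge0// ltW.
split=> //.
- rewrite PhiE; apply: Psi_lb => w' Dw'; apply: (le_trans (vmin' _ Dw')).
  by rewrite lerDl mulr_ge0 ?sqr_ge0// ltW.
- by rewrite PhiE -lvE; exact: Psi_ub.
have X3 : 0 <= (Num.sqrt gamma)^-1 * (`|x| / Num.sqrt n%:R) ^+ 3.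
  by rewrite mulr_ge0 ?invr_ge0 ?sqrtr_ge0// exprn_ge0// divr_ge0 ?sqrtr_ge0.
set X := (Num.sqrt gamma)^-1 * _ in X3 *; set m := x ^+ 2 / _.
have up : Psi <= f v + m + X := le_trans (Psi_ub _ Dw) upper.
have lo : f v + m - 3 * X <= Psi := Psi_lb _ lower.
rewrite PhiE ler_norml; apply/andP; split; last by lra.
by rewrite !lerBrDl; apply: le_trans lo; lra.
Qed.

End FixedSample.
End RegularisedLeastSquares.

(** * Product laws on finite arrays *)

Section Arrays.
Context {d} {X : measurableType d} {I : finType}.

Definition boxes : set (set (I -> X)) :=
  [set E | exists2 A : I -> set X, (forall i, measurable (A i)) & E = [set z | forall i, A i (z i)]].

(** The product sigma-algebra on a finite family; boxes form a pi-system, so laws on arr are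
   determined on them. *)
Definition arr : Type := g_sigma_algebraType boxes.

HB.instance Definition _ := Measurable.copy arr (g_sigma_algebraType boxes).

Lemma measurable_box (A : I -> set X) : (forall i, measurable (A i)) ->
  measurable ([set z | forall i, A i (z i)] : set arr).
Proof. by move=> mA; apply: sub_sigma_algebra; exists A. Qed.

Lemma measurable_to_arr d' (T : measurableType d') (f : T -> arr) :
  (forall i, measurable_fun setT (fun t => f t i)) -> measurable_fun setT f.
Proof.
move=> mf; apply: (@measurability _ _ T arr setT f boxes) => // _ [_ [A mA ->] <-].
rewrite setTI.
have -> : f @^-1` [set z | forall i, A i (z i)] = \bigcap_(i in [set: I]) ((fun t => f t i) @^-1` A i).
  by apply/seteqP; split => t /= h i => [_|]; exact: h.
apply: fin_bigcap_measurable => // i _; rewrite -[X in measurable X]setTI; exact: mf.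
Qed.

Lemma measurable_coord i : measurable_fun setT (fun z : arr => z i).
Proof.
move=> _ A mA; rewrite setTI.
have -> : (fun z : arr => z i) @^-1` A = [set z | forall j, (if j == i then A else setT) (z j)].
  apply/seteqP; split => [z /= Az j|z /= /(_ i)]; last by rewrite eqxx.
  by case: eqP => [->|].
have mif j : measurable (if j == i then A else setT) by case: ifP.
exact: (measurable_box mif).
Qed.

Definition upd (z : I -> X) i (x : X) : I -> X := fun j => if j == i then x else z j.

Lemma upd_same z i x y : upd (upd z i x) i y = upd z i y.
Proof. by apply/funext => j; rewrite /upd; case: eqP. Qed.

Lemma upd_comm z i j x y : i != j -> upd (upd z i x) j y = upd (upd z j y) i x.
Proof.
move=> ij; apply/funext => k; rewrite /upd; case: (eqVneq k j) => // ->.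
by rewrite eq_sym (negbTE ij).
Qed.

Lemma measurable_upd i : measurable_fun setT (fun p : X * arr => upd p.2 i p.1 : arr).
Proof.
apply: measurable_to_arr => j; rewrite /upd; case: eqP => _.
  exact: measurable_fst.
exact: measurableT_comp (measurable_coord j) measurable_snd.
Qed.

End Arrays.
Arguments arr {d} X I.

Section Resampling.
Context {d} {X : measurableType d} {I : finType} {R : realType}.
Context (mu : I -> probability X R) (nu : probability (arr X I) R).
Hypothesis nu_box : forall A : I -> set X, (forall i, measurable (A i)) ->
  nu [set z | forall i, A i (z i)] = (\prod_i mu i (A i))%E.

(** Both sides are integrals for measures that agree on boxes: replacing a coordinate by an
   independent copy does not change a product law. *)
Lemma resampling (i : I) (F : arr X I -> \bar R) : measurable_fun [set: arr X I] F -> (forall z, 0 <= F z)%E ->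
  (\int[nu]_z F z = \int[nu]_z \int[mu i]_x F (upd z i x))%E.
Proof.
move=> mF F0.
pose phi := fun p : X * arr X I => upd p.2 i p.1 : arr X I.
have mphi : measurable_fun setT phi := measurable_upd i.
have phi_mfun : phi \in mfun by rewrite inE.
pose nu' := pushforward (mu i \x nu)%E (mfun_Sub phi_mfun).
transitivity (\int[nu']_z F z)%E.
  apply: eq_measure_integral => A mA _.
  apply: (@g_sigma_algebra_measure_unique _ R (arr X I) (@boxes d X I) _ (fun=> setT)) => //.
  - by move=> B [A' mA' ->]; exact: measurable_box.
  - move=> _; exists (fun=> setT) => //; by apply/seteqP; split.
  - by rewrite bigcup_const.
  - move=> _ _ [A1 mA1 ->] [A2 mA2 ->]; exists (fun j => A1 j `&` A2 j).
      by move=> j; exact: measurableI.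
    by apply/seteqP; split=> z /= => [[h1 h2] j|h]; split => // j; case: (h j).
  - move=> _ [A' mA' ->].
    transitivity (\prod_j mu j (A' j))%E; first exact: nu_box.
    rewrite /= /pushforward /=.
    have -> : phi @^-1` [set z | forall j, A' j (z j)]
        = A' i `*` [set z | forall j, (if j == i then setT else A' j) (z j)].
      apply/seteqP; split => [[x z] /= h|[x z] /= [Ax h] j].
        split; first by have := h i; rewrite /phi /upd eqxx.
        by move=> j; have := h j; rewrite /phi /upd /=; case: eqP.
      by have := h j; rewrite /phi /upd /=; case: eqP => [->|].
    have mif j : measurable (if j == i then setT else A' j) by case: ifP.
    rewrite product_measure1E//; last exact: (measurable_box mif).
    rewrite (bigD1 i)//=; congr (_ * _)%E; apply/esym/(etrans (nu_box mif)).
    rewrite (bigD1 i)//= eqxx probability_setT mul1e.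
    by apply: eq_bigr => j /negbTE ->.
  - by move=> k; rewrite (le_lt_trans (probability_le1 _ _)) ?ltry.
rewrite ge0_integral_pushforward//=.
rewrite fubini_tonelli2//.
exact: measurableT_comp.
Qed.

End Resampling.

(** * Averages over one coordinate and the Efron-Stein inequality *)

Section Tame.
Context {d} {X : measurableType d} {I : finType} {R : realType}.
Context (mu : I -> probability X R) (nu : probability (arr X I) R).
Hypothesis nu_box : forall A : I -> set X, (forall i, measurable (A i)) ->
  nu [set z | forall i, A i (z i)] = (\prod_i mu i (A i))%E.
Context (h : X -> R).
Hypothesis mh : measurable_fun setT h.
Hypothesis h_ge0 : forall x, 0 <= h x.
Hypothesis h_int : forall i, (mu i).-integrable setT (EFin \o h).
Implicit Types (F G : arr X I -> R) (z : arr X I) (i j : I).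

Definition envelope (z : arr X I) : R := 1 + \sum_j h (z j).

(** A class of integrable functions that is stable under averaging over a coordinate: growth at
   most linear in the values of h at the coordinates. *)
Definition tame (F : arr X I -> R) : Prop := measurable_fun [set: arr X I] F /\
  exists c : R, forall z, `|F z| <= c * envelope z.

Let env_ge1 z : 1 <= envelope z.
Proof. by rewrite lerDl sumr_ge0. Qed.

Let env_ge0 z : 0 <= envelope z. Proof. exact: le_trans ler01 (env_ge1 z). Qed.

Let menv : measurable_fun [set: arr X I] envelope.
Proof.
apply: measurable_funD => //; apply: measurable_sum => j.
exact: measurableT_comp mh (measurable_coord j).
Qed.

Lemma tame_envelope : tame envelope.
Proof. by split=> //; exists 1 => z; rewrite mul1r ger0_norm. Qed.

Lemma tame_bound F : tame F -> exists2 c : R, 0 <= c & forall z, `|F z| <= c * envelope z.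
Proof.
move=> [_ [c Fc]]; exists `|c| => // z; rewrite (le_trans (Fc z))//.
by rewrite ler_wpM2r// ler_norm.
Qed.

Lemma tame_le F G : measurable_fun [set: arr X I] F -> tame G ->
  (forall z, `|F z| <= `|G z|) -> tame F.
Proof. by move=> mF [_ [c Gc]] FG; split=> //; exists c => z; exact: le_trans (FG z) (Gc z). Qed.

Lemma tame_cst (a : R) : tame (fun=> a).
Proof.
split; first exact: measurable_cst.
by exists `|a| => z; rewrite ler_peMr.
Qed.

Lemma tameD F G : tame F -> tame G -> tame (fun z => F z + G z).
Proof.
move=> tF tG; split; first by apply: measurable_funD; [exact: tF.1|exact: tG.1].
have [a a0 Fa] := tame_bound tF; have [b b0 Gb] := tame_bound tG.
exists (a + b) => z; rewrite (le_trans (ler_normD _ _))// mulrDl lerD//.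
Qed.

Lemma tameZ (a : R) F : tame F -> tame (fun z => a * F z).
Proof.
move=> tF; split; first by apply: measurable_funM => //; exact: tF.1.
have [b b0 Fb] := tame_bound tF.
by exists (`|a| * b) => z; rewrite normrM -mulrA ler_wpM2l.
Qed.

Lemma tameB F G : tame F -> tame G -> tame (fun z => F z - G z).
Proof.
move=> tF tG; have := tameD tF (tameZ (-1) tG).
by under eq_fun do rewrite mulN1r.
Qed.

Let envelope_coord_integrable j : nu.-integrable setT (EFin \o (fun z : arr X I => h (z j))).
Proof.
have mhj : measurable_fun [set: arr X I] (fun z => h (z j)).
  exact: measurableT_comp mh (measurable_coord j).
apply/integrableP; split; first exact/measurable_EFinP.
under eq_integral => z _ do rewrite /= ger0_norm//.
rewrite (resampling nu_box j)//; [|exact/measurable_EFinP|by move=> z; rewrite lee_fin].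
under eq_integral => z _ do under eq_integral => x _ do rewrite /upd eqxx.
set c := (\int[mu j]_x _)%E.
rewrite integral_cst// [X in (_ * X)%E](_ : _ = 1%E) ?mule1; last exact: probability_setT.
rewrite /c.
have /integrableP[_] := h_int j.
by under eq_integral => z _ do rewrite /= ger0_norm//.
Qed.

Lemma envelope_integrable : nu.-integrable setT (EFin \o envelope).
Proof.
rewrite (_ : EFin \o envelope = (cst 1%E \+ (fun z : arr X I => \sum_j (h (z j))%:E))%E); last first.
  by apply/funext => z /=; rewrite sumEFin.
apply: integrableD => //; first exact: finite_measure_integrable_cst.
by apply: integrable_sum => // j _; exact: envelope_coord_integrable.
Qed.

Lemma tame_integrable F : tame F -> nu.-integrable setT (EFin \o F).
Proof.
move=> tF; have [c c0 Fc] := tame_bound tF.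
apply: (@le_integrable _ _ _ _ _ measurableT _ (fun z => c%:E * (envelope z)%:E)%E).
- by apply/measurable_EFinP; exact: tF.1.
- by move=> z _; rewrite -EFinM /= lee_fin (le_trans (Fc z))// ler_norm.
- by apply: integrableZl => //; exact: envelope_integrable.
Qed.

Let rest i z : R := 1 + \sum_(j | j != i) h (z j).

Let env_upd i z x : envelope (upd z i x) = rest i z + h x.
Proof.
rewrite /envelope /rest (bigD1 i)//= /upd eqxx addrCA addrC; congr (_ + _ + _).
by apply: eq_bigr => j /negbTE ->.
Qed.

Lemma measurable_section i z : measurable_fun [set: X] (fun x => upd z i x : arr X I).
Proof.
apply: measurable_to_arr => j; rewrite /upd; case: eqP => _ //.
Qed.

Lemma tame_section i z F : tame F -> (mu i).-integrable setT (EFin \o (fun x => F (upd z i x))).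
Proof.
move=> tF; have [c c0 Fc] := tame_bound tF.
apply: (@le_integrable _ _ _ _ _ measurableT _ (fun x => c%:E * ((rest i z)%:E + (h x)%:E))%E).
- apply/measurable_EFinP; exact: measurableT_comp tF.1 (measurable_section i z).
- move=> x _; rewrite -EFinD -EFinM /= lee_fin (le_trans (Fc _))// env_upd.
  exact: ler_norm.
- apply: integrableZl => //; apply: integrableD => //; last exact: h_int.
  exact: finite_measure_integrable_cst.
Qed.

(** Conditional expectation given all coordinates but i. *)
Definition avg i F z : R := \int[mu i]_x F (upd z i x).

Lemma avgD i F G z : tame F -> tame G -> avg i (fun z => F z + G z) z = avg i F z + avg i G z.
Proof. by move=> tF tG; rewrite /avg RintegralD//; exact: tame_section. Qed.

Lemma avgB i F G z : tame F -> tame G -> avg i (fun z => F z - G z) z = avg i F z - avg i G z.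
Proof. by move=> tF tG; rewrite /avg RintegralB//; exact: tame_section. Qed.

Lemma avgZ i (a : R) F z : tame F -> avg i (fun z => a * F z) z = a * avg i F z.
Proof. by move=> tF; rewrite /avg RintegralZl//; exact: tame_section. Qed.

Lemma avg_le i F G z : tame F -> tame G -> (forall x, F (upd z i x) <= G (upd z i x)) ->
  avg i F z <= avg i G z.
Proof. by move=> tF tG FG; apply: le_Rintegral => //; exact: tame_section. Qed.

Let mu_setT i : fine (mu i [set: X]) = 1.
Proof. by transitivity (fine (1%E : \bar R)) => //; congr fine; exact: probability_setT. Qed.

Lemma avg_invariant i F z : (forall x, F (upd z i x) = F z) -> avg i F z = F z.
Proof.
move=> Fi; rewrite /avg (_ : (fun x => F (upd z i x)) = cst (F z)); last exact/funext.
by rewrite Rintegral_cst// -[RHS]mulr1 mu_setT.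
Qed.

Lemma avg_upd i F z y : avg i F (upd z i y) = avg i F z.
Proof. by apply: eq_Rintegral => x _; rewrite upd_same. Qed.

Lemma avg_norm_le i F z : tame F -> `|avg i F z| <= avg i (fun z => `|F z|) z.
Proof. by move=> tF; apply: le_normr_Rintegral => //; exact: tame_section. Qed.

Let avgE i F z : tame F -> (avg i F z)%:E = (\int[mu i]_x (F (upd z i x))%:E)%E.
Proof.
by move=> tF; rewrite /avg /Rintegral fineK// integrable_fin_num//; exact: tame_section.
Qed.

Let nonneg_avg i F : tame F -> (forall z, 0 <= F z) ->
  measurable_fun [set: arr X I] (avg i F) /\ \int[nu]_z F z = \int[nu]_z avg i F z.
Proof.
move=> tF F0; split.
  apply/measurable_EFinP.
  have -> : EFin \o avg i F = fubini_G (mu i) (fun p : X * arr X I => (F (upd p.2 i p.1))%:E).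
    by apply/funext => z /=; rewrite avgE.
  apply: measurable_fun_fubini_tonelli_G => //=.
    by apply/measurable_EFinP; exact: measurableT_comp tF.1 (measurable_upd i).
  by move=> p; rewrite lee_fin.
have mF : measurable_fun [set: arr X I] (EFin \o F) by apply/measurable_EFinP; exact: tF.1.
have F0' z : (0 <= (EFin \o F) z)%E by rewrite lee_fin.
rewrite /Rintegral (resampling nu_box i mF F0').
by congr fine; apply: eq_integral => z _; rewrite -avgE.
Qed.

(** Adding a multiple of the envelope reduces statements on tame functions to nonnegative ones.
   *)
Let shift_nonneg F : tame F -> exists2 c : R, 0 <= c & forall z, 0 <= F z + c * envelope z.
Proof.
move=> tF; have [c c0 Fc] := tame_bound tF; exists c => // z.
by have := Fc z; rewrite ler_norml => /andP[+ _]; rewrite -subr_ge0 opprK.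
Qed.

Let avg_measurable i F : tame F -> measurable_fun [set: arr X I] (avg i F).
Proof.
move=> tF; have [c c0 Fc] := shift_nonneg tF.
have tE := tameZ c tame_envelope; have tFE := tameD tF tE.
have -> : avg i F = (fun z => avg i (fun z => F z + c * envelope z) z - avg i (fun z => c * envelope z) z).
  by apply/funext => z; rewrite avgD// addrK.
apply: measurable_funB; apply: (nonneg_avg _ _ _).1 => // z.
by rewrite mulr_ge0.
Qed.

Lemma tame_avg i F : tame F -> tame (avg i F).
Proof.
move=> tF; split; first exact: avg_measurable.
have [c c0 Fc] := tame_bound tF.
have m0 : 0 <= \int[mu i]_x h x by apply: Rintegral_ge0.
exists (c * (1 + \int[mu i]_x h x)) => z.
have tE := tameZ c tame_envelope.
rewrite (le_trans (avg_norm_le i z tF))//.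
have tN : tame (fun z => `|F z|).
  split; first by apply: measurableT_comp tF.1; exact: normr_measurable.
  by exists c => y; rewrite normr_id.
rewrite (le_trans (avg_le tN tE (fun x => Fc _)))// avgZ; last exact: tame_envelope.
rewrite -mulrA ler_wpM2l//.
have -> : avg i envelope z = rest i z + \int[mu i]_x h x.
  rewrite /avg (_ : (fun x => envelope (upd z i x)) = (fun x => rest i z + h x)); last first.
    by apply/funext => x; rewrite env_upd.
  have ic := finite_measure_integrable_cst (mu i) (rest i z) measurableT.
  rewrite (RintegralD measurableT ic (h_int i)).
  rewrite Rintegral_cst//; congr (_ + _); by rewrite mu_setT mulr1.
have r1 : rest i z <= envelope z.
  by rewrite /rest /envelope lerD2l [leRHS](bigD1 i)//= lerDr.
have := env_ge1 z; set m := Rintegral _ _ _ in m0 *.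
by have := ler_wpM2l m0 (env_ge1 z); lra.
Qed.

Lemma integral_avg i F : tame F -> \int[nu]_z F z = \int[nu]_z avg i F z.
Proof.
move=> tF; have [c c0 Fc] := shift_nonneg tF.
have tE := tameZ c tame_envelope; have tFE := tameD tF tE.
have [_ e1] := nonneg_avg i tFE Fc.
have [_ e2] := nonneg_avg i tE (fun z => mulr_ge0 c0 (env_ge0 z)).
have iF := tame_integrable tF; have iE := tame_integrable tE.
have iaF := tame_integrable (tame_avg i tF); have iaE := tame_integrable (tame_avg i tE).
have e3 : \int[nu]_z avg i (fun z => F z + c * envelope z) z
    = \int[nu]_z (avg i F z + avg i (fun z => c * envelope z) z).
  by apply: eq_Rintegral => z _; rewrite avgD.
rewrite e3 !RintegralD// e2 in e1.
exact: addIr e1.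
Qed.

Definition sq_tame F : Prop := measurable_fun [set: arr X I] F /\ tame (fun z => F z ^+ 2).

Lemma sq_tameM F G : sq_tame F -> sq_tame G -> tame (fun z => F z * G z).
Proof.
move=> [mF F2] [mG G2]; apply: (tame_le _ (tameD F2 G2)).
  exact: measurable_funM.
move=> z; rewrite [leRHS]ger0_norm ?addr_ge0 ?sqr_ge0// ler_norml.
by have := sqr_ge0 (F z + G z); have := sqr_ge0 (F z - G z); have := sqr_ge0 (F z);
  have := sqr_ge0 (G z) => *; apply/andP; split; lra.
Qed.

Lemma sq_tame_cst (a : R) : sq_tame (fun=> a).
Proof. by split; [exact: measurable_cst|exact: tame_cst]. Qed.

Lemma sq_tame_tame F : sq_tame F -> tame F.
Proof. by move=> sF; have := sq_tameM sF (sq_tame_cst 1); under eq_fun do rewrite mulr1. Qed.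

Lemma sq_tameB F G : sq_tame F -> sq_tame G -> sq_tame (fun z => F z - G z).
Proof.
move=> sF sG; have [mF F2] := sF; have [mG G2] := sG.
have mB : measurable_fun [set: arr X I] (fun z => F z - G z) by exact: measurable_funB.
split=> //; have T := tameD (tameD F2 G2) (tameZ (-2) (sq_tameM sF sG)).
apply: (tame_le _ T) => [|z]; first exact: measurable_funX.
by rewrite le_eqVlt; apply/orP; left; apply/eqP; congr (`|_|); lra.
Qed.

(** Jensen, from the nonnegativity of the variance. *)
Lemma avg_sqr_le i F z : sq_tame F -> avg i F z ^+ 2 <= avg i (fun z => F z ^+ 2) z.
Proof.
move=> sF; have tF := sq_tame_tame sF; set m := avg i F z.
have t1 : tame (fun z => (2 * m) * F z) by exact: tameZ.
have t2 : tame (fun=> m ^+ 2) by exact: tame_cst.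
have H : avg i (fun z => 2 * m * F z - m ^+ 2) z <= avg i (fun z => F z ^+ 2) z.
  apply: (avg_le (tameB t1 t2) sF.2) => x.
  by have := sqr_ge0 (F (upd z i x) - m); lra.
rewrite (avgB i z t1 t2) (avgZ i _ z tF) (avg_invariant (F := fun=> m ^+ 2))// -/m in H.
lra.
Qed.

Lemma sq_tame_avg i F : sq_tame F -> sq_tame (avg i F).
Proof.
move=> sF; have tA := tame_avg i (sq_tame_tame sF); split; first exact: tA.1.
apply: (tame_le _ (tame_avg i sF.2)); first by apply: measurable_funX; exact: tA.1.
move=> z; rewrite ger0_norm ?sqr_ge0//.
by rewrite (le_trans (avg_sqr_le i z sF))// ler_norm.
Qed.

Lemma integral_tame_le F G : tame F -> tame G -> (forall z, F z <= G z) ->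
  \int[nu]_z F z <= \int[nu]_z G z.
Proof. by move=> tF tG FG; apply: le_Rintegral => //; exact: tame_integrable. Qed.

Lemma integral_tameD F G : tame F -> tame G ->
  \int[nu]_z (F z + G z) = \int[nu]_z F z + \int[nu]_z G z.
Proof. by move=> tF tG; rewrite RintegralD//; exact: tame_integrable. Qed.

Lemma integral_tameB F G : tame F -> tame G ->
  \int[nu]_z (F z - G z) = \int[nu]_z F z - \int[nu]_z G z.
Proof. by move=> tF tG; rewrite RintegralB//; exact: tame_integrable. Qed.

Lemma integral_tameZ (a : R) F : tame F -> \int[nu]_z (a * F z) = a * \int[nu]_z F z.
Proof. by move=> tF; rewrite RintegralZl//; exact: tame_integrable. Qed.

Lemma integral_constant (a : R) : \int[nu]_z a = a.
Proof.
rewrite Rintegral_cst//; transitivity (a * fine (1%E : \bar R)); last by rewrite mulr1.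
by congr (_ * fine _); exact: probability_setT.
Qed.

(** Change the coordinates of z one after the other into the base point. *)
Lemma invariant_constant F z : (forall i z x, F (upd z i x) = F z) -> F z = F (fun=> point).
Proof.
move=> Finv.
pose w (s : seq I) : arr X I := foldr (fun i acc => upd acc i (z i)) (fun=> point) s.
have wE s j : j \in s -> w s j = z j.
  elim: s => [//|i s ih]; rewrite inE /w /= /upd; case: eqP => [->//|_ /=]; exact: ih.
have -> : z = w (enum I) by apply/funext => j; rewrite wE ?mem_enum.
by elim: (enum I) => [//|i s ih] /=; rewrite Finv ih.
Qed.

(** Replacing F by its average over one coordinate loses, of the second moment, at most the
   squared distance from F to any function that ignores this coordinate, and averaging is a
   contraction for the distances attached to the other coordinates. *)
Lemma efron_stein (s : seq I) F (c : I -> arr X I -> R) :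
  sq_tame F -> (forall i, sq_tame (c i)) ->
  (forall i z x, c i (upd z i x) = c i z) ->
  (forall i z x, i \notin s -> F (upd z i x) = F z) ->
  \int[nu]_z F z ^+ 2 - (\int[nu]_z F z) ^+ 2 <= \sum_(i <- s) \int[nu]_z (F z - c i z) ^+ 2.
Proof.
elim: s F c => [|i s ih] F c sF sc cinv Finv.
  rewrite big_nil; have Fc z : F z = F (fun=> point).
    by apply: invariant_constant => j w x; exact: Finv.
  have -> : (fun z => F z ^+ 2) = (fun=> F (fun=> point) ^+ 2) by apply/funext => z; rewrite Fc.
  have -> : F = (fun=> F (fun=> point)) by apply/funext => z; exact: Fc.
  by rewrite !integral_constant subrr.
pose c' j := avg i (c j).
have sF' := sq_tame_avg i sF.
have sc' j : sq_tame (c' j) by exact: sq_tame_avg.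
have comm (G : arr X I -> R) j : (forall z x, G (upd z j x) = G z) ->
    forall z x, avg i G (upd z j x) = avg i G z.
  move=> Ginv z x; have [->|ij] := eqVneq j i; first exact: avg_upd.
  by apply: eq_Rintegral => y _; rewrite upd_comm// Ginv.
have F'inv j z x : j \notin s -> avg i F (upd z j x) = avg i F z.
  have [->|ij] := eqVneq j i; first by move=> _; exact: avg_upd.
  by move=> js; apply: comm => w y; apply: Finv; rewrite inE negb_or ij.
have := ih (avg i F) c' sF' sc' (fun j => comm _ _ (cinv j)) F'inv.
rewrite big_cons -(integral_avg i (sq_tame_tame sF)) => IH.
have tF := sq_tame_tame sF; have tc := sq_tame_tame (sc i).
have sub : \sum_(j <- s) \int[nu]_z (avg i F z - c' j z) ^+ 2
    <= \sum_(j <- s) \int[nu]_z (F z - c j z) ^+ 2.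
  apply: ler_sum => j _; have sB := sq_tameB sF (sc j).
  rewrite [leRHS](integral_avg i sB.2); apply: integral_tame_le.
  - exact: (sq_tameB sF' (sc' j)).2.
  - exact: (tame_avg i sB.2).
  - by move=> z; rewrite -avgB ?avg_sqr_le//; exact: sq_tame_tame.
have step : \int[nu]_z F z ^+ 2 - \int[nu]_z avg i F z ^+ 2 <= \int[nu]_z (F z - c i z) ^+ 2.
  have sB := sq_tameB sF (sc i).
  rewrite (integral_avg i sF.2) (integral_avg i sB.2) -integral_tameB//; last 2 first.
  - exact: (tame_avg i sF.2).
  - exact: sF'.2.
  apply: integral_tame_le.
  - by apply: tameB; [exact: (tame_avg i sF.2)|exact: sF'.2].
  - exact: (tame_avg i sB.2).
  move=> z.
  have t1 : tame (fun w => 2 * c i z * F w) by exact: tameZ.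
  have t2 : tame (fun=> c i z ^+ 2) by exact: tame_cst.
  have -> : avg i (fun w => (F w - c i w) ^+ 2) z = avg i (fun w => F w ^+ 2 - (2 * c i z * F w - c i z ^+ 2)) z.
    by apply: eq_Rintegral => x _; rewrite cinv; lra.
  rewrite (avgB i z sF.2 (tameB t1 t2)) (avgB i z t1 t2) (avgZ i _ z tF).
  rewrite (avg_invariant (F := fun=> c i z ^+ 2))//.
  by have := sqr_ge0 (avg i F z - c i z); lra.
lra.
Qed.

End Tame.

(** * Measurability on vectors and on arrays of vectors *)

Section BorelVectors.
Context {R : realType} {N : nat}.
Local Notation vec := (borel_rV R N).

Lemma measurable_rV_coord (j : 'I_N) : measurable_fun [set: vec] (fun x : vec => (x : 'rV[R]_N) 0 j).
Proof.
apply: (measurability _ (RGenOpens.measurableE R)).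
move=> _ [_ [a [b ->] <-]]; rewrite setTI; apply: sub_sigma_algebra.
by apply: open_comp => [x _|]; [exact: coord_continuous|exact: interval_open].
Qed.

Lemma measurable_dot (th : 'rV[R]_N) : measurable_fun [set: vec] (fun x : vec => dot x th).
Proof.
apply: measurable_sum => j; apply: measurable_funM => //; exact: measurable_rV_coord.
Qed.

(** The sets where F is below a level are open, hence countable unions of rational boxes; the
   sigma-algebra generated by boxes contains them. *)
Lemma measurable_open_sublevel (I : finType) (F : arr vec I -> R) :
  (forall c z, F z < c -> exists2 e : R, 0 < e &
     forall z' : arr vec I, (forall i j, `|(z' i : 'rV[R]_N) 0 j - (z i : 'rV[R]_N) 0 j| < e) -> F z' < c) ->
  measurable_fun [set: arr vec I] F.
Proof.
move=> oF; apply: (measurability _ (RGenInftyO.measurableE R)).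
move=> _ [_ [c ->] <-]; rewrite setTI.
pose U := F @^-1` `]-oo, c[.
pose box (a : {ffun I * 'I_N -> rat} * nat) : set (arr vec I) :=
  \bigcap_(p in [set: I * 'I_N]) [set z | `|(z p.1 : 'rV[R]_N) 0 p.2 - ratr (a.1 p)| < a.2.+1%:R^-1].
have mbox a : measurable (box a).
  apply: fin_bigcap_measurable => // p _.
  have mg : measurable_fun [set: arr vec I] (fun z => `|(z p.1 : 'rV[R]_N) 0 p.2 - ratr (a.1 p)|).
    apply: measurableT_comp => //; apply: measurable_funB => //.
    exact: measurableT_comp (measurable_rV_coord p.2) (measurable_coord p.1).
  have := mg measurableT `]-oo, a.2.+1%:R^-1[%classic (measurable_itv _).
  by rewrite setTI; congr measurable; apply/seteqP; split => z /=; rewrite in_itv.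
rewrite -/U.
have -> : U = \bigcup_(n in [set: nat]) (if unpickle n is Some a then
    (if `[< box a `<=` U >] then box a else set0) else set0).
  apply/seteqP; split => [z Uz|z [n _]]; last first.
    by case: unpickle => // a; case: asboolP => // sub; exact: sub.
  have Fzc : F z < c by move: Uz; rewrite /U /= in_itv.
  have [e e0 eF] := oF c z Fzc.
  pose k := Num.truncn (2 / e); pose r : R := k.+1%:R^-1.
  have r0 : 0 < r by rewrite invr_gt0.
  have re : 2 * r < e.
    by rewrite ltr_pdivrMr// mulrC -ltr_pdivrMr// truncnS_gt.
  have qex (p : I * 'I_N) : exists q : rat, `|(z p.1 : 'rV[R]_N) 0 p.2 - ratr q| < r.
    have xr : (z p.1 : 'rV[R]_N) 0 p.2 - r < (z p.1 : 'rV[R]_N) 0 p.2 + r by lra.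
    have [q] := rat_in_itvoo xr; rewrite inE => /andP[]; rewrite !bnd_simp => ? ?.
    by exists q; rewrite ltr_norml; apply/andP; split; lra.
  have [q qP] := choice qex.
  pose a : {ffun I * 'I_N -> rat} * nat := ([ffun p => q p], k).
  have az : box a z by move=> p _ /=; rewrite ffunE; exact: qP.
  exists (pickle a) => //; rewrite pickleK; case: asboolP => // -[].
  move=> z' az'; rewrite /U /= in_itv /=; apply: eF => i j.
  have h1 := az (i, j) Logic.I; have h2 := az' (i, j) Logic.I; rewrite /= ffunE in h1 h2.
  apply: le_lt_trans re.
  rewrite (_ : _ - _ = ((z' i : 'rV[R]_N) 0 j - ratr (q (i, j))) - ((z i : 'rV[R]_N) 0 j - ratr (q (i, j)))); last by lra.
  by rewrite (le_trans (ler_normB _ _))// mulr_natl mulr2n lerD// ltW.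
apply: bigcup_measurable => n _; case: unpickle => [a|]; last exact: measurable0.
by case: ifP.
Qed.

End BorelVectors.

(** * Moments of normal laws *)

Section NormalMoments.
Context {R : realType}.
Local Notation leb := (@lebesgue_measure R).

(** The density is the Radon-Nikodym derivative up to a null set. *)
Lemma integral_normal_prob (m s : R) (f : R -> \bar R) : (forall x, 0 <= f x)%E ->
  measurable_fun setT f ->
  (\int[normal_prob m s]_x f x = \int[leb]_x (f x * (normal_pdf m s x)%:E))%E.
Proof.
move=> f0 mf; have dom := normal_prob_dominates m s.
rewrite -(Radon_Nikodym_SigmaFinite.change_of_variables dom)//.
have mp : measurable_fun [set: R] (fun x => (normal_pdf m s x)%:E).
  by apply/measurable_EFinP; exact: measurable_normal_pdf.
have ri := Radon_Nikodym_SigmaFinite.f_integrable dom.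
apply: ae_eq_integral => //.
- by apply: emeasurable_funM => //; exact: measurable_int ri.
- exact: emeasurable_funM.
- apply: ae_eqe_mul2l; apply: integral_ae_eq => // E _ mE.
  by rewrite -Radon_Nikodym_SigmaFinite.f_integral.
Qed.

(** Integrate over [-k, k] by the fundamental theorem of calculus and pass to the limit by
   dominated convergence. *)
Lemma integral_derivative0 (F f : R -> R) : continuous f ->
  (forall x : R, is_derive x 1 F (f x)) -> leb.-integrable setT (EFin \o f) ->
  F k.+1%:R @[k --> \oo] --> 0 -> F (- k.+1%:R) @[k --> \oo] --> 0 ->
  (\int[leb]_x (f x)%:E = 0)%E.
Proof.
move=> cf dF fint F0 F0'.
have mf : measurable_fun [set: R] (EFin \o f) by apply/measurable_EFinP; exact: continuous_measurable_fun.
pose f_ (k : nat) := (EFin \o f) \_ `[- k.+1%:R, k.+1%:R]%classic.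
have intf k : (\int[leb]_x f_ k x = (F k.+1%:R - F (- k.+1%:R))%:E)%E.
  rewrite -integral_mkcond EFinB -(@continuous_FTC2 _ f F)//.
  - by rewrite ltrNl (lt_trans _ (ltr0Sn _ _))// oppr_lt0.
  - exact: continuous_subspaceT.
  - have cF x : {for x, continuous F}.
      by apply: differentiable_continuous; apply/derivable1_diffP; have [] := dF x.
    split; first by move=> x _; have [] := dF x.
      by apply: cvg_at_right_filter; exact: cF.
    by apply: cvg_at_left_filter; exact: cF.
  - by move=> x _; rewrite derive1E; have [_ ->] := dF x.
have mf_ k : measurable_fun setT (f_ k).
  by apply/(measurable_restrictT _ _).1 => //; exact: measurable_funTS.
have f_f : {ae leb, forall x, setT x -> f_ ^~ x @ \oo --> (EFin \o f) x}.
  apply/aeW => x _; apply: cvg_near_cst.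
  exists (Num.truncn `|x|) => // k /= xk; rewrite /f_ patchE mem_set//= in_itv/= -ler_norml.
  by rewrite (le_trans (ltW (truncnS_gt _)))// ler_nat.
have f_le : {ae leb, forall x k, setT x -> (`|f_ k x| <= `|(EFin \o f) x|)%E}.
  by apply/aeW => x k _; rewrite /f_ patchE; case: ifP => // _; rewrite abse0.
have [_ _] := @dominated_convergence _ _ _ leb setT measurableT f_ (EFin \o f) (abse \o (EFin \o f)) mf_ mf f_f (integrable_abse fint) f_le.
rewrite (_ : (fun _ => _) = EFin \o (fun k => F k.+1%:R - F (- k.+1%:R))); last first.
  by apply/funext => k /=; rewrite intf.
move=> H; apply: (cvg_unique _ H) => //.
have lim0 : (F k.+1%:R - F (- k.+1%:R)) @[k --> \oo] --> (0 : R).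
  by rewrite -[X in _ --> X](subr0 (0 : R)); exact: cvgB.
by apply: cvg_EFin; [exact: nearW|exact: lim0].
Qed.

Section Moments.
Variable (s : R).
Hypothesis s0 : s != 0.
Let e := normal_fun 0 s.
Let s2 : 0 < s ^+ 2. Proof. by rewrite exprn_even_gt0. Qed.

Let wide := Num.sqrt 2 * s.

(** Polynomials of degree four times the Gaussian are dominated by a wider Gaussian, because
   exp y >= y^2 / 4 for y >= 0. *)
Let growth (x : R) : (1 + x ^+ 4) * e x <= (1 + 64 * s ^+ 4) * normal_fun 0 wide x.
Proof.
pose y := x ^+ 2 / (s ^+ 2 *+ 4).
have y0 : 0 <= y by rewrite divr_ge0 ?sqr_ge0// mulrn_wge0// ltW.
have ee : e x = expR (- y) * expR (- y).
  rewrite -expRD /e /normal_fun subr0; congr expR; rewrite /y.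
  rewrite (_ : s ^+ 2 *+ 4 = (s ^+ 2 *+ 2) * 2); last by lra.
  by rewrite invfM mulNr; lra.
have -> : normal_fun 0 wide x = expR (- y).
  rewrite /normal_fun subr0 /wide exprMn sqr_sqrtr// mulNr /y; congr expR.
  by congr (- (_ / _)); lra.
rewrite ee mulrA ler_wpM2r ?expR_ge0//.
rewrite expRN ler_pdivrMr ?expR_gt0//.
have x4 : x ^+ 4 = 16 * s ^+ 4 * y ^+ 2.
  rewrite /y expr_div_n (_ : (s ^+ 2 *+ 4) ^+ 2 = 16 * s ^+ 4); last by lra.
  rewrite mulrC divfK; first by lra.
  by rewrite mulf_neq0 ?pnatr_eq0// expf_neq0.
have ey : 1 <= expR y by rewrite -expR0 ler_expR.
have ey2 : y ^+ 2 <= 4 * expR y.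
  have h := expR_ge1Dx (y / 2).
  have -> : expR y = expR (y / 2) ^+ 2 by rewrite expr2 -expRD; congr expR; lra.
  by nra.
have s4 : 0 <= s ^+ 4 by rewrite exprn_even_ge0.
by rewrite x4; nra.
Qed.

Let monomial_le k (x : R) : (k <= 4)%N -> `|x ^+ k| <= 1 + x ^+ 4.
Proof.
move=> k4; have x4 : x ^+ 4 = `|x| ^+ 4 by rewrite -normrX ger0_norm// exprn_even_ge0.
rewrite normrX x4; have [x1|x1] := leP `|x| 1.
  apply: (@le_trans _ _ 1); first exact: exprn_ile1.
  by rewrite lerDl exprn_ge0.
by rewrite (le_trans (ler_weXn2l (ltW x1) k4))// lerDr.
Qed.

Let gauss_integrable (k : nat) : (k <= 4)%N -> leb.-integrable setT (EFin \o (fun x => x ^+ k * e x)).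
Proof.
move=> k4; have w0 : wide != 0 by rewrite mulf_neq0// gt_eqF// sqrtr_gt0.
have gi : leb.-integrable setT (fun x => ((1 + 64 * s ^+ 4) / normal_peak wide)%:E * (normal_pdf 0 wide x)%:E)%E.
  by apply: integrableZl => //; exact: integrable_normal_pdf.
apply: le_integrable gi => //.
  apply/measurable_EFinP; apply: measurable_funM; first exact: (measurable_funX k (@measurable_id _ _ setT)).
  exact: measurable_normal_fun.
move=> x _; rewrite /= lee_fin normrM (ger0_norm (normal_fun_ge0 _ _ _)).
rewrite normal_pdfE//.
have -> : (1 + 64 * s ^+ 4) / normal_peak wide * (normal_peak wide * normal_fun 0 wide x) = (1 + 64 * s ^+ 4) * normal_fun 0 wide x.
  by rewrite mulrA divfK// gt_eqF// normal_peak_gt0.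
apply: le_trans (ler_norm _); apply: le_trans (growth x).
by rewrite ler_wpM2r ?normal_fun_ge0 ?monomial_le.
Qed.

Let gauss_cvg k (u : nat -> R) : (k < 4)%N -> (forall j, `|u j| = j.+1%:R) ->
  (u j ^+ k * e (u j)) @[j --> \oo] --> (0 : R).
Proof.
move=> k4 uj; pose c : R := 1 + 64 * s ^+ 4.
have h0 : (c * harmonic j) @[j --> \oo] --> (0 : R).
  by rewrite -[X in _ --> X](mulr0 c); apply: cvgM; [exact: cvg_cst|exact: cvg_harmonic].
apply: norm_cvg0; apply: (@squeeze_cvgr _ _ _ _ (fun=> 0) (fun j => c * harmonic j)).
- apply: nearW => j; rewrite normr_ge0 /=.
  have j0 : 0 < `|u j| by rewrite uj.
  rewrite /harmonic -uj ler_pdivlMr// normrM (ger0_norm (normal_fun_ge0 _ _ _)) mulrAC.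
  rewrite -normrM -exprSr; apply: (@le_trans _ _ (c * normal_fun 0 wide (u j))).
    apply: le_trans (growth _); rewrite ler_wpM2r ?normal_fun_ge0 //; exact: monomial_le.
  rewrite ler_piMr//; first by rewrite addr_ge0// mulr_ge0// exprn_even_ge0.
  rewrite -expR0 ler_expR mulNr oppr_le0 divr_ge0 ?sqr_ge0// mulrn_wge0// sqr_ge0 //.
- exact: cvg_cst.
- exact: h0.
Qed.

Let moment k := \int[leb]_x (x ^+ k * e x).

(** Integration by parts: x^(k+1) e(x) has derivative ((k+1) x^k - x^(k+2) / s^2) e(x). *)
Let moment_rec k : (k <= 2)%N -> moment k.+2 = s ^+ 2 * k.+1%:R * moment k.
Proof.
move=> k2; pose F (x : R) := x ^+ k.+1 * e x.
pose f (x : R) := k.+1%:R * (x ^+ k * e x) - s ^- 2 * (x ^+ k.+2 * e x).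
have de (x : R) : is_derive x 1 e (- (x / s ^+ 2) * e x).
  rewrite /e /normal_fun.
  have dq : is_derive x 1 (fun x : R => - (x - 0) ^+ 2 / (s ^+ 2 *+ 2)) (- (x / s ^+ 2)).
    rewrite (_ : (fun x : R => _) = (fun x => (- (s ^+ 2 *+ 2)^-1) * x ^+ 2)); last first.
      by apply/funext => y; rewrite subr0 mulNr mulrC mulNr.
    have q : s ^+ 2 *+ 2 = s ^+ 2 * 2 by lra.
    apply: is_derive_eq.
    by rewrite /GRing.scale /= q invfM; lra.
  apply: is_derive_eq; rewrite /GRing.scale /=; lra.
have dF (x : R) : is_derive x 1 F (f x).
  have dX : is_derive x 1 (fun x : R => x ^+ k.+1) (k.+1%:R * x ^+ k).
    have -> : (fun x : R => x ^+ k.+1) = (id ^+ k.+1 : R -> R) by apply/funext => y; rewrite exprfctE.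
    by apply: (is_derive_eq (is_deriveX k.+1 (is_derive_id x (1 : R)))); rewrite /GRing.scale /= mulr1.
  apply: (is_derive_eq (is_deriveM dX (de x))).
  by rewrite /GRing.scale /= /f [x ^+ k.+2]exprS [x ^+ k.+1]exprS; lra.
have ik := gauss_integrable (leq_trans k2 (isT : 2 <= 4)%N).
have ik2 : leb.-integrable setT (EFin \o (fun x => x ^+ k.+2 * e x)) by exact: gauss_integrable.
have ce : continuous e.
  move=> x; apply: differentiable_continuous; apply/derivable1_diffP.
  by have [] := de x.
have cm j : continuous (fun x : R => x ^+ j * e x).
  by move=> x; apply: cvgM; [exact: exprn_continuous|exact: ce].
have cF : continuous f.
  by move=> x; apply: cvgB; (apply: cvgM; [exact: cvg_cst|exact: cm]).
have fint : leb.-integrable setT (EFin \o f).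
  have -> : EFin \o f = ((fun x => k.+1%:R%:E * (x ^+ k * e x)%:E) \- (fun x => (s ^- 2)%:E * (x ^+ k.+2 * e x)%:E))%E by [].
  by apply: integrableB => //; exact: integrableZl.
have i0 : \int[leb]_x f x = 0.
  rewrite /Rintegral (@integral_derivative0 F f cF dF fint)//; apply: gauss_cvg => // j.
    by rewrite ger0_norm.
  by rewrite normrN ger0_norm.
have : k.+1%:R * moment k - s ^- 2 * moment k.+2 = 0.
  rewrite -i0 /moment -!RintegralZl// RintegralB//.
    exact: (integrableZl _ k.+1%:R ik).
  exact: (integrableZl _ (s ^- 2) ik2).
move=> /eqP; rewrite subr_eq0 => /eqP h.
by rewrite mulrAC -mulrA [X in _ * X]mulrC h mulrA divff ?mul1r// gt_eqF.
Qed.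

Let integral_moment k : (k <= 4)%N -> (\int[leb]_x (x ^+ k * e x)%:E = (moment k)%:E)%E.
Proof.
move=> k4; rewrite /moment /Rintegral fineK//.
exact: integrable_fin_num (gauss_integrable k4).
Qed.

Let normal_integral k : (k <= 4)%N -> ~~ odd k ->
  (\int[normal_prob 0 s]_x (x ^+ k)%:E = (normal_peak s * moment k)%:E)%E.
Proof.
move=> k4 ek; rewrite integral_normal_prob; last 2 first.
- by move=> x; rewrite lee_fin exprn_even_ge0.
- by apply/measurable_EFinP; exact: (measurable_funX k (@measurable_id _ _ setT)).
rewrite EFinM -integral_moment// -integralZl//; last exact: gauss_integrable.
by apply: eq_integral => x _; rewrite normal_pdfE// -!EFinM; congr EFin; rewrite mulrCA.
Qed.

Let moment0 : normal_peak s * moment 0 = 1.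
Proof.
apply/EFin_inj; rewrite EFinM -integral_moment// -integralZl//; last exact: gauss_integrable.
rewrite -(integral_normal_pdf 0 s); apply: eq_integral => x _.
by rewrite normal_pdfE// -!EFinM; congr EFin; rewrite expr0 mul1r.
Qed.

Lemma normal_prob_moment2 : (\int[normal_prob 0 s]_x (x ^+ 2)%:E = (s ^+ 2)%:E)%E.
Proof. by rewrite normal_integral// moment_rec// mulr1 mulrCA moment0 mulr1. Qed.

Lemma normal_prob_moment4 : (\int[normal_prob 0 s]_x (x ^+ 4)%:E = (3 * s ^+ 4)%:E)%E.
Proof.
rewrite normal_integral// moment_rec// moment_rec//; congr EFin.
rewrite mulr1 -[RHS]mulr1 -[X in _ = _ * X]moment0.
by move: (moment 0) (normal_peak s) => a b; lra.
Qed.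

End Moments.
Lemma integral_normal_law (v : R) (Q : {measure set (measurableTypeR R) -> \bar R}) (f : measurableTypeR R -> \bar R) :
  (forall A, measurable A -> Q A = normal_law 0 v A) -> measurable_fun setT f ->
  (\int[Q]_x f x = if (v == 0)%R then f 0%R else \int[normal_prob 0%R (Num.sqrt v)]_x f x)%E.
Proof.
move=> QE mf; case: ifPn => [v0|vN0].
  transitivity (\int[\d_(0%R : measurableTypeR R)]_x f x)%E.
    by apply: eq_measure_integral => A mA _; rewrite QE// /normal_law v0.
  by rewrite integral_dirac// diracT mul1e.
by apply: eq_measure_integral => A mA _; rewrite QE// /normal_law (negbTE vN0).
Qed.

End NormalMoments.

Section GaussianVector.
Context {R : realType} {N : nat} (mu : probability (borel_rV R N) R) (Sigma : 'M[R]_N).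
Local Notation vec := (borel_rV R N).
Hypothesis projection_law : forall (theta : 'rV[R]_N) (A : set R), measurable A ->
  mu ((fun z : vec => dot z theta) @^-1` A) = normal_law 0 (quad Sigma theta) A.
Hypothesis psd : forall theta : 'rV[R]_N, 0 <= quad Sigma theta.

Let projection_integral theta (f : R -> \bar R) : (forall x, 0 <= f x)%E -> measurable_fun setT f ->
  (\int[mu]_z f (dot z theta) =
   if (quad Sigma theta == 0)%R then f 0%R
   else \int[normal_prob 0%R (Num.sqrt (quad Sigma theta))]_x f x)%E.
Proof.
move=> f0 mf.
have d_mfun : (fun z : vec => dot z theta) \in @mfun _ _ vec (measurableTypeR R).
  by rewrite inE; exact: measurable_dot.
pose Q := @pushforward _ _ vec (measurableTypeR R) R mu (mfun_Sub d_mfun).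
transitivity (\int[Q]_x f x)%E.
  rewrite ge0_integral_pushforward; first by rewrite preimage_setT.
  - exact: measurable_dot.
  - exact: measurableT.
  - exact: mf.
  - by move=> x _; exact: f0.
have QE A : measurable A -> Q A = normal_law 0 (quad Sigma theta) A by exact: (projection_law theta).
rewrite (integral_normal_law QE mf)//; exact: measurable_dot.
Qed.

Lemma gaussian_moment2 theta :
  (\int[mu]_z (dot z theta ^+ 2)%:E = (quad Sigma theta)%:E)%E.
Proof.
rewrite (@projection_integral theta (fun x => (x ^+ 2)%:E)); last 2 first.
- by move=> x; rewrite lee_fin exprn_even_ge0.
- by apply/measurable_EFinP; exact: (measurable_funX 2 (@measurable_id _ _ setT)).
case: ifPn => [/eqP ->|q0]; first by rewrite expr0n.
by rewrite normal_prob_moment2 ?sqr_sqrtr// sqrtr_eq0 -ltNge lt_def q0 psd.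
Qed.

Lemma gaussian_moment4 theta :
  (\int[mu]_z (dot z theta ^+ 4)%:E = (3 * quad Sigma theta ^+ 2)%:E)%E.
Proof.
rewrite (@projection_integral theta (fun x => (x ^+ 4)%:E)); last 2 first.
- by move=> x; rewrite lee_fin exprn_even_ge0.
- by apply/measurable_EFinP; exact: (measurable_funX 4 (@measurable_id _ _ setT)).
case: ifPn => [/eqP ->|q0]; first by rewrite !expr0n mulr0.
rewrite normal_prob_moment4 ?sqrtr_eq0 -?ltNge ?lt_def ?q0 ?psd//.
by rewrite (_ : Num.sqrt (quad Sigma theta) ^+ 4 = quad Sigma theta ^+ 2)// (exprM _ 2 2) sqr_sqrtr.
Qed.

(** The projections on theta and on - theta have the same law. *)
Lemma gaussian_symmetric theta (f : R -> \bar R) : (forall x, 0 <= f x)%E -> measurable_fun setT f ->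
  (\int[mu]_z f (dot z theta) = \int[mu]_z f (- dot z theta)%R)%E.
Proof.
move=> f0 mf; have e : quad Sigma (- theta) = quad Sigma theta.
  by rewrite !quadE -scaleN1r bilZl bilZr mulrA mulrNN mulr1 mul1r.
transitivity (\int[mu]_z f (dot z (- theta)))%E.
  by rewrite (@projection_integral theta f f0 mf) (@projection_integral (- theta) f f0 mf) e.
by apply: eq_integral => z _; rewrite dotNr.
Qed.

End GaussianVector.

(** * Functions of polynomial growth *)

Section Growth.
Context {R : realType} {N : nat}.
Local Notation vec := (borel_rV R N).
Implicit Types (f g : vec -> R) (theta : 'rV[R]_N).

Definition weight (z : vec) : R := (1 + norm2 z) ^+ 4.

(** Measurable functions of polynomial growth in the norm. Degrees add under multiplication,
   and degree at most four is integrable as soon as fourth moments are. *)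
Definition growth k f : Prop := measurable_fun [set: vec] f /\
  exists2 c : R, 0 <= c & forall z, `|f z| <= c * (1 + norm2 z) ^+ k.

Let base_ge1 (z : vec) : 1 <= 1 + norm2 z.
Proof. by rewrite lerDl norm2_ge0. Qed.

Lemma measurable_norm2 : measurable_fun [set: vec] (fun z : vec => norm2 z).
Proof.
have ms : measurable_fun [set: R] (@Num.sqrt R) by exact: (continuous_measurable_fun (@sqrt_continuous R)).
have md : measurable_fun [set: vec] (fun z : vec => dot z z).
  by apply: measurable_sum => j; apply: measurable_funM; exact: measurable_rV_coord.
exact: (measurableT_comp ms md).
Qed.

Lemma measurable_weight : measurable_fun [set: vec] weight.
Proof.
apply: measurable_funX; apply: measurable_funD => //; exact: measurable_norm2.
Qed.

Lemma weight_ge0 z : 0 <= weight z.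
Proof. by rewrite exprn_ge0// addr_ge0// norm2_ge0. Qed.

Lemma growth_leq j k f : (j <= k)%N -> growth j f -> growth k f.
Proof.
move=> jk [mf [c c0 fc]]; split=> //; exists c => // z.
by rewrite (le_trans (fc z))// ler_wpM2l// ler_weXn2l.
Qed.

Lemma growth_cst (a : R) : growth 0 (fun=> a).
Proof. by split; [exact: measurable_cst|exists `|a| => // z; rewrite mulr1]. Qed.

Lemma growthD k f g : growth k f -> growth k g -> growth k (fun z => f z + g z).
Proof.
move=> [mf [a a0 fa]] [mg [b b0 gb]]; split; first exact: measurable_funD.
exists (a + b) => [|z]; first exact: addr_ge0.
by rewrite (le_trans (ler_normD _ _))// mulrDl lerD.
Qed.

Lemma growthM j k f g : growth j f -> growth k g -> growth (j + k) (fun z => f z * g z).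
Proof.
move=> [mf [a a0 fa]] [mg [b b0 gb]]; split; first exact: measurable_funM.
exists (a * b) => [|z]; first exact: mulr_ge0.
by rewrite normrM exprD mulrACA ler_pM.
Qed.

Lemma growthZ k (a : R) f : growth k f -> growth k (fun z => a * f z).
Proof. exact: growthM (growth_cst a). Qed.

Lemma growthB k f g : growth k f -> growth k g -> growth k (fun z => f z - g z).
Proof.
move=> gf gg; have := growthD gf (growthZ (-1) gg).
by under eq_fun do rewrite mulN1r.
Qed.

Lemma growthX j k f : growth j f -> growth (k * j) (fun z => f z ^+ k).
Proof.
move=> gf; elim: k => [|k IH]; first exact: growth_cst.
by under eq_fun do rewrite exprS; rewrite mulSn; exact: growthM.
Qed.

Lemma growth_norm k f : growth k f -> growth k (fun z => `|f z|).
Proof.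
move=> [mf [c c0 fc]]; split; first exact: measurableT_comp.
by exists c => // z; rewrite normr_id.
Qed.

Lemma growth_sum k (I : Type) (r : seq I) (F : I -> vec -> R) :
  (forall i, growth k (F i)) -> growth k (fun z => \sum_(i <- r) F i z).
Proof.
move=> gF; elim: r => [|i r IH].
  by under eq_fun do rewrite big_nil; exact: growth_leq (growth_cst 0).
by under eq_fun do rewrite big_cons; exact: growthD.
Qed.

Lemma growth_le k f g : measurable_fun [set: vec] f -> growth k g ->
  (forall z, `|f z| <= `|g z|) -> growth k f.
Proof. by move=> mf [_ [c c0 gc]] fg; split=> //; exists c => // z; exact: le_trans (fg z) (gc z). Qed.

Lemma growth_coord j : growth 1 (fun z : vec => (z : 'rV[R]_N) 0 j).
Proof.
split; first exact: measurable_rV_coord.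
exists 1 => // z; rewrite mul1r expr1 ler_wpDl// -sqrtr_sqr ler_wsqrtr//.
by rewrite /dot (bigD1 j)//= -expr2 lerDl sumr_ge0// => i _; rewrite -expr2 sqr_ge0.
Qed.

Lemma growth_dot theta : growth 1 (fun z : vec => dot z theta).
Proof.
apply: growth_sum => j; apply: (@growthM 1 0); [exact: growth_coord|exact: growth_cst].
Qed.

Lemma growth_quad (T : 'M[R]_N) : growth 2 (fun z : vec => quad T z).
Proof.
under eq_fun do rewrite quadE bil_sum.
apply: growth_sum => i; apply: growth_sum => j; apply: (@growthM 1 1); last exact: growth_coord.
by apply: (@growthM 1 0); [exact: growth_coord|exact: growth_cst].
Qed.

Section Integration.
Context (mu : probability vec R).
Hypothesis weight_int : mu.-integrable setT (EFin \o weight).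

Lemma growth_integrable k f : (k <= 4)%N -> growth k f -> mu.-integrable setT (EFin \o f).
Proof.
move=> k4 /(growth_leq k4) [mf [c c0 fc]].
apply: (@le_integrable _ _ _ _ _ measurableT _ (fun z => c%:E * (weight z)%:E)%E).
- exact/measurable_EFinP.
- move=> z _; rewrite lee_fin; apply: le_trans (ler_norm _); exact: fc.
- exact: integrableZl.
Qed.

Lemma mean_add f g : growth 4 f -> growth 4 g ->
  \int[mu]_z (f z + g z) = \int[mu]_z f z + \int[mu]_z g z.
Proof. by move=> gf gg; rewrite RintegralD//; exact: (growth_integrable (leqnn 4)). Qed.

Lemma mean_sub f g : growth 4 f -> growth 4 g ->
  \int[mu]_z (f z - g z) = \int[mu]_z f z - \int[mu]_z g z.
Proof. by move=> gf gg; rewrite RintegralB//; exact: (growth_integrable (leqnn 4)). Qed.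

Lemma mean_scale (a : R) f : growth 4 f -> \int[mu]_z (a * f z) = a * \int[mu]_z f z.
Proof. by move=> gf; rewrite RintegralZl//; exact: (growth_integrable (leqnn 4)). Qed.

Lemma mean_cst (a : R) : \int[mu]_z a = a.
Proof.
rewrite Rintegral_cst//; transitivity (a * fine (1%E : \bar R)); last by rewrite mulr1.
by congr (_ * fine _); exact: probability_setT.
Qed.

Lemma mean_sum (I : Type) (r : seq I) (F : I -> vec -> R) : (forall i, growth 4 (F i)) ->
  \int[mu]_z (\sum_(i <- r) F i z) = \sum_(i <- r) \int[mu]_z F i z.
Proof.
move=> gF; elim: r => [|i r IH].
  by under eq_Rintegral do rewrite big_nil; rewrite big_nil mean_cst.
under eq_Rintegral do rewrite big_cons.
by rewrite big_cons mean_add ?IH//; exact: growth_sum.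
Qed.

Lemma mean_le f g : growth 4 f -> growth 4 g -> (forall z, f z <= g z) ->
  \int[mu]_z f z <= \int[mu]_z g z.
Proof. by move=> gf gg fg; apply: le_Rintegral => //; exact: (growth_integrable (leqnn 4)). Qed.

Lemma mean_ge0 f : (forall z, 0 <= f z) -> 0 <= \int[mu]_z f z.
Proof. by move=> f0; apply: Rintegral_ge0. Qed.

End Integration.

Lemma weight_le z : weight z <= 8 + 8 * N%:R * \sum_j dot z (delta_mx 0 j) ^+ 4.
Proof.
have dj j : dot z (delta_mx 0 j) = (z : 'rV[R]_N) 0 j.
  rewrite /dot (bigD1 j)//= mxE !eqxx mulr1 big1 ?addr0// => i ij.
  by rewrite mxE (negbTE ij) andbF mulr0.
under eq_bigr do rewrite dj.
have n4 : norm2 z ^+ 4 <= N%:R * \sum_j (z : 'rV[R]_N) 0 j ^+ 4.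
  rewrite (exprM _ 2 2) norm2_sqr.
  have := dot_CS (\row_j (z : 'rV[R]_N) 0 j ^+ 2) (const_mx 1).
  rewrite {1 3}/dot; under eq_bigr do rewrite !mxE mulr1 expr2.
  under [X in _ <= _ * X -> _]eq_bigr do rewrite !mxE mulr1.
  rewrite sumr_const card_ord mulrC /dot => h; apply: le_trans h _.
  by rewrite ler_wpM2l// ler_sum// => j _; rewrite !mxE -exprD.
have t0 := norm2_ge0 (z : 'rV[R]_N); rewrite /weight.
apply: (@le_trans _ _ (8 + 8 * norm2 z ^+ 4)); last by rewrite lerD2l -mulrA ler_wpM2l.
move: (norm2 _) t0 => t t0.
have := sqr_ge0 (t - 1); have := sqr_ge0 (t ^+ 2 - 1); have := sqr_ge0 (t ^+ 2 - t); nra.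
Qed.

Lemma weight_integrable (mu : probability vec R) :
  (forall theta, (\int[mu]_z (dot z theta ^+ 4)%:E < +oo)%E) ->
  mu.-integrable setT (EFin \o weight).
Proof.
move=> h4.
have i4 theta : mu.-integrable setT (fun z => (dot z theta ^+ 4)%:E).
  apply/integrableP; split.
    by apply/measurable_EFinP; apply: measurable_funX; exact: measurable_dot.
  apply: le_lt_trans (h4 theta); rewrite le_eqVlt; apply/orP; left; apply/eqP.
  by apply: eq_integral => z _; rewrite abse_EFin ger0_norm// exprn_even_ge0.
have fin : mu.-integrable setT (fun z : vec => 8%:E + (8 * N%:R)%:E * \sum_j (dot z (delta_mx 0 j) ^+ 4)%:E)%E.
  apply: integrableD => //; first exact: finite_measure_integrable_cst.
  by apply: integrableZl => //; apply: integrable_sum.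
apply: le_integrable fin => //.
  by apply/measurable_EFinP; exact: measurable_weight.
move=> z _; rewrite sumEFin -EFinM -EFinD lee_fin ger0_norm ?weight_ge0//.
by apply: le_trans (ler_norm _); exact: weight_le.
Qed.

End Growth.

(** * Moment conditions and the Gaussian vector *)

Section Moments.
Context {R : realType} {N : nat}.
Local Notation vec := (borel_rV R N).
Implicit Types (theta : 'rV[R]_N) (Sigma T : 'M[R]_N).

(** The only information about the law of a sample that the comparison uses. It holds with the
   same constants for a regular feature and for the Gaussian vector, and the first two moments
   are the same for both. *)
Record moments Sigma (lambda kappa rho2 : R) (mu : probability vec R) : Prop := Moments {
  moments_weight : mu.-integrable setT (EFin \o weight);
  moments_mean : forall theta, \int[mu]_z dot z theta = 0;
  moments_var : forall theta, \int[mu]_z (dot z theta ^+ 2) = quad Sigma theta;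
  moments_four : forall theta, \int[mu]_z (dot z theta ^+ 4) <= kappa * (lambda * dot theta theta) ^+ 2;
  moments_quad : forall T, T^T = T ->
    \int[mu]_z ((quad T z - \tr (T *m Sigma)) ^+ 2) <= rho2 * normF T ^+ 2 }.

Lemma dot_delta (x : 'rV[R]_N) j : dot x (delta_mx 0 j) = x 0 j.
Proof.
rewrite /dot (bigD1 j)//= mxE !eqxx mulr1 big1 ?addr0// => i ij.
by rewrite mxE (negbTE ij) andbF mulr0.
Qed.

Lemma bil_delta Sigma i j : bil Sigma (delta_mx 0 i) (delta_mx 0 j) = Sigma i j.
Proof. by rewrite bil_dot dot_delta -rowE mxE. Qed.

Lemma quad_coord Sigma T (x : 'rV[R]_N) : Sigma^T = Sigma ->
  quad T x - \tr (T *m Sigma) =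
  \sum_(p : 'I_N * 'I_N) T p.1 p.2 * (x 0 p.1 * x 0 p.2 - Sigma p.1 p.2).
Proof.
move=> sS; rewrite quadE bil_sum /mxtrace -sumrB.
rewrite -(pair_bigA _ (fun i j => T i j * (x 0 i * x 0 j - Sigma i j))) /=; apply: eq_bigr => i _; rewrite mxE -sumrB; apply: eq_bigr => j _.
by rewrite -[in Sigma j i]sS mxE; lra.
Qed.

(** The trace of A A is at most the squared Frobenius norm of A, and multiplying the rows of T
   by Sigma costs the operator norm. *)
Lemma tr_sqr_le Sigma T : \tr ((T *m Sigma) *m (T *m Sigma)) <= op_norm Sigma ^+ 2 * normF T ^+ 2.
Proof.
set A := T *m Sigma.
apply: (@le_trans _ _ (normF A ^+ 2)).
  have e1 : \tr (A *m A) = \sum_i \sum_j A i j * A j i by apply: eq_bigr => i _; rewrite mxE.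
  have e2 : normF A ^+ 2 = \sum_i \sum_j A i j ^+ 2.
    rewrite normF_sqr; apply: eq_bigr => i _; rewrite mxE; apply: eq_bigr => j _.
    by rewrite [A^T _ _]mxE expr2.
  have e3 : normF A ^+ 2 = \sum_i \sum_j A j i ^+ 2 by rewrite e2 exchange_big.
  have : 0 <= \sum_i \sum_j (A i j - A j i) ^+ 2.
    by apply: sumr_ge0 => i _; apply: sumr_ge0 => j _; exact: sqr_ge0.
  have -> : \sum_i \sum_j (A i j - A j i) ^+ 2 = normF A ^+ 2 + normF A ^+ 2 - 2 * \tr (A *m A).
    rewrite [in RHS]e1 {1}e2 e3 mulr_sumr -big_split -sumrB/=; apply: eq_bigr => i _.
    by rewrite mulr_sumr -big_split -sumrB/=; apply: eq_bigr => j _; lra.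
  by lra.
rewrite !normF_sqr_rows mulr_sumr; apply: ler_sum => i _.
rewrite row_mul -!norm2_sqr -exprMn ler_pXn2r ?nnegrE ?norm2_ge0//; first exact: op_norm_bound.
by rewrite (le_trans _ (op_norm_bound _ _))// norm2_ge0.
Qed.

(** The two pairings of Wick's formula that are left after centering contribute the same trace,
   by symmetry of T. *)
Lemma tr_sqr_sum Sigma T : T^T = T -> Sigma^T = Sigma ->
  \sum_(p : 'I_N * 'I_N) \sum_(q : 'I_N * 'I_N) T p.1 p.2 * T q.1 q.2 *
    (Sigma p.1 q.1 * Sigma p.2 q.2 + Sigma p.1 q.2 * Sigma p.2 q.1)
  = 2 * \tr ((T *m Sigma) *m (T *m Sigma)).
Proof.
move=> sT sS.
pose Q i k j l := T i j * T k l * Sigma i l * Sigma j k.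
have trE : \tr ((T *m Sigma) *m (T *m Sigma)) = \sum_i \sum_k \sum_j \sum_l Q i k j l.
  apply: eq_bigr => i _; rewrite mxE; apply: eq_bigr => k _; rewrite !mxE mulr_suml.
  apply: eq_bigr => j _; rewrite mulr_sumr; apply: eq_bigr => l _.
  by rewrite /Q -[in Sigma i l]sS mxE; lra.
have Tsym i j : T i j = T j i by rewrite -[in LHS]sT mxE.
have h1 : \sum_(p : 'I_N * 'I_N) \sum_(q : 'I_N * 'I_N) Q p.1 q.1 p.2 q.2 = \tr ((T *m Sigma) *m (T *m Sigma)).
  rewrite trE -(pair_bigA _ (fun i j => \sum_(q : 'I_N * 'I_N) Q i q.1 j q.2)) /=; apply: eq_bigr => i _.
  rewrite [RHS]exchange_big; apply: eq_bigr => j _.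
  by rewrite -(pair_bigA _ (fun k l => Q i k j l)).
have h2 : \sum_(p : 'I_N * 'I_N) \sum_(q : 'I_N * 'I_N) Q p.2 q.1 p.1 q.2 = \tr ((T *m Sigma) *m (T *m Sigma)).
  rewrite -h1 -(pair_bigA _ (fun i j => \sum_(q : 'I_N * 'I_N) Q j q.1 i q.2)) exchange_big /=.
  by rewrite (pair_bigA _ (fun i j => \sum_(q : 'I_N * 'I_N) Q i q.1 j q.2)).
rewrite mulr_natl mulr2n -{1}h2 -h1 -big_split /=; apply: eq_bigr => p _.
rewrite -big_split /=; apply: eq_bigr => q _; rewrite /Q.
by rewrite (Tsym p.2); lra.
Qed.

Section Gaussian.
Context (mu : probability vec R) (Sigma : 'M[R]_N).
Hypothesis projection_law : forall (theta : 'rV[R]_N) (A : set R), measurable A ->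
  mu ((fun z : vec => dot z theta) @^-1` A) = normal_law 0 (quad Sigma theta) A.
Hypothesis psd : forall theta : 'rV[R]_N, 0 <= quad Sigma theta.
Hypothesis symmetric : Sigma^T = Sigma.

Let wint : mu.-integrable setT (EFin \o weight).
Proof. by apply: weight_integrable => theta; rewrite (gaussian_moment4 projection_law)// ltry. Qed.

Let g4 theta : growth 4 (fun z : vec => dot z theta ^+ 4).
Proof. exact: (growthX 4 (growth_dot theta)). Qed.

Let prod4 (a b c d : 'rV[R]_N) : growth 4 (fun z : vec => dot z a * dot z b * dot z c * dot z d).
Proof. exact: (growthM (growthM (growthM (growth_dot a) (growth_dot b)) (growth_dot c)) (growth_dot d)). Qed.

Let prod2 (a b : 'rV[R]_N) : growth 2 (fun z : vec => dot z a * dot z b).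
Proof. exact: (growthM (growth_dot a) (growth_dot b)). Qed.

Let pair_moment a b : \int[mu]_z (dot z a * dot z b) = bil Sigma a b.
Proof.
have e theta : \int[mu]_z (dot z theta ^+ 2) = quad Sigma theta.
  by rewrite /Rintegral (gaussian_moment2 projection_law).
have g2 theta : growth 4 (fun z : vec => dot z theta ^+ 2).
  exact: growth_leq (growthX 2 (growth_dot theta)).
have : 4 * \int[mu]_z (dot z a * dot z b) = quad Sigma (a + b) - quad Sigma (a + -1 *: b).
  rewrite -!e -(mean_sub wint)// -(mean_scale wint); last exact: growth_leq (prod2 a b).
  by apply: eq_Rintegral => z _; rewrite !dotDr dotZr; lra.
by rewrite !quadE !bilDl !bilDr !bilZl !bilZr (bilC b a symmetric); lra.
Qed.

(** Wick's formula by polarisation: the fourth powers of a +- b +- c +- d, weighted by the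
   signs, add up to 192 a b c d. *)
Let wick a b c d : \int[mu]_z (dot z a * dot z b * dot z c * dot z d) =
  bil Sigma a b * bil Sigma c d + bil Sigma a c * bil Sigma b d + bil Sigma a d * bil Sigma b c.
Proof.
pose l : seq (R * 'rV[R]_N) := [:: (1, a + b + c + d); (-1, a + b + c + -1 *: d);
  (-1, a + b + -1 *: c + d); (-1, a + -1 *: b + c + d); (1, a + b + -1 *: c + -1 *: d);
  (1, a + -1 *: b + c + -1 *: d); (1, a + -1 *: b + -1 *: c + d);
  (-1, a + -1 *: b + -1 *: c + -1 *: d)].
have : 192 * \int[mu]_z (dot z a * dot z b * dot z c * dot z d)
     = \sum_(p <- l) p.1 * (3 * quad Sigma p.2 ^+ 2).
  have gl p : growth 4 (fun z : vec => (p : R * 'rV[R]_N).1 * dot z p.2 ^+ 4) by exact: growthZ.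
  rewrite -(mean_scale wint)//.
  transitivity (\int[mu]_z \sum_(p <- l) p.1 * dot z p.2 ^+ 4).
    apply: eq_Rintegral => z _; rewrite !big_cons big_nil /= !dotDr !dotZr.
    by move: (dot z a) (dot z b) (dot z c) (dot z d) => *; lra.
  rewrite (mean_sum wint)//; apply: eq_bigr => p _; rewrite (mean_scale wint)//.
  by rewrite /Rintegral (gaussian_moment4 projection_law).
rewrite !big_cons big_nil /= !quadE !bilDl !bilDr !bilZl !bilZr.
rewrite (bilC b a symmetric) (bilC c a symmetric) (bilC d a symmetric) (bilC c b symmetric) (bilC d b symmetric) (bilC d c symmetric).
move: (bil Sigma a a) (bil Sigma a b) (bil Sigma a c) (bil Sigma a d) (bil Sigma b b) (bil Sigma b c) (bil Sigma b d) (bil Sigma c c) (bil Sigma c d) (bil Sigma d d).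
by move=> *; lra.
Qed.

(** The variance of the quadratic form is 2 tr (T Sigma T Sigma) by Wick's formula, and the
   mean vanishes by symmetry. *)
Lemma gaussian_moments (kappa rho2 : R) : 3 <= kappa -> 2 * op_norm Sigma ^+ 2 <= rho2 ->
  moments Sigma (op_norm Sigma) kappa rho2 mu.
Proof.
move=> k3 r2; split=> //.
- move=> theta.
  have gp : growth 4 (fun z : vec => `|dot z theta| + dot z theta).
    by apply: (@growth_leq _ _ 1) => //; apply: growthD; [apply: growth_norm|]; exact: growth_dot.
  have gm : growth 4 (fun z : vec => `|dot z theta| - dot z theta).
    by apply: (@growth_leq _ _ 1) => //; apply: growthB; [apply: growth_norm|]; exact: growth_dot.
  have gd : growth 4 (fun z : vec => dot z theta) by apply: growth_leq (growth_dot theta).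
  have e : \int[mu]_z (`|dot z theta| + dot z theta) = \int[mu]_z (`|dot z theta| - dot z theta).
    rewrite /Rintegral (@gaussian_symmetric _ _ mu Sigma projection_law theta (fun x => (`|x| + x)%:E)); last 2 first.
    - by move=> x; rewrite lee_fin -lerBlDr sub0r -normrN ler_norm.
    - by apply/measurable_EFinP; apply: measurable_funD => //; exact: measurableT_comp.
    by congr fine; apply: eq_integral => z _; rewrite normrN.
  have : 2 * \int[mu]_z dot z theta =
     \int[mu]_z (`|dot z theta| + dot z theta) - \int[mu]_z (`|dot z theta| - dot z theta).
    rewrite -(mean_sub wint)// -(mean_scale wint)//.
    by apply: eq_Rintegral => z _; lra.
  by rewrite e; lra.
- by move=> theta; rewrite /Rintegral (gaussian_moment2 projection_law).
- move=> theta; rewrite /Rintegral (gaussian_moment4 projection_law)//=.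
  have q0 := psd theta; have q1 := quad_op_norm Sigma theta.
  apply: ler_pM => //; first by rewrite sqr_ge0.
  by rewrite ler_pXn2r// nnegrE// (le_trans q0).
- move=> T sT.
  apply: (@le_trans _ _ (2 * op_norm Sigma ^+ 2 * normF T ^+ 2)); last by rewrite ler_wpM2r// sqr_ge0.
  rewrite -mulrA; apply: (@le_trans _ _ (2 * \tr ((T *m Sigma) *m (T *m Sigma)))); last first.
    by rewrite ler_wpM2l// tr_sqr_le.
  rewrite -tr_sqr_sum// le_eqVlt; apply/orP; left; apply/eqP.
  pose y p (z : vec) := (z : 'rV[R]_N) 0 p.1 * (z : 'rV[R]_N) 0 p.2 - Sigma p.1 p.2.
  have gy p : growth 2 (y p).
    apply: growthB; first exact: (growthM (growth_coord p.1) (growth_coord p.2)).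
    exact: growth_leq (growth_cst _).
  have gyy p q : growth 4 (fun z => T p.1 p.2 * T q.1 q.2 * (y p z * y q z)).
    by apply: growthZ; exact: (growthM (gy p) (gy q)).
  transitivity (\int[mu]_z \sum_p \sum_q T p.1 p.2 * T q.1 q.2 * (y p z * y q z)).
    apply: eq_Rintegral => z _; rewrite quad_coord// expr2 mulr_suml.
    apply: eq_bigr => p _; rewrite mulr_sumr; apply: eq_bigr => q _.
    by rewrite /y; lra.
  rewrite (mean_sum wint); last by move=> p; exact: growth_sum.
  apply: eq_bigr => p _; rewrite (mean_sum wint)//; apply: eq_bigr => q _.
  rewrite (mean_scale wint); last exact: (growthM (gy p) (gy q)).
  congr (_ * _).
  case: p q => [i j] [k l] /=.
  pose e m : 'rV[R]_N := delta_mx 0 m.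
  have gij : growth 4 (fun z : vec => Sigma i j * (dot z (e k) * dot z (e l))).
    by apply: growthZ; exact: growth_leq (prod2 _ _).
  have gkl : growth 4 (fun z : vec => Sigma k l * (dot z (e i) * dot z (e j))).
    by apply: growthZ; exact: growth_leq (prod2 _ _).
  have gc : growth 4 (fun z : vec => Sigma i j * Sigma k l) by exact: growth_leq (growth_cst _).
  have p4 := prod4 (e i) (e j) (e k) (e l).
  transitivity (\int[mu]_z (dot z (e i) * dot z (e j) * dot z (e k) * dot z (e l)
     - Sigma i j * (dot z (e k) * dot z (e l)) - Sigma k l * (dot z (e i) * dot z (e j))
     + Sigma i j * Sigma k l)).
    by apply: eq_Rintegral => z _; rewrite /y /= !dot_delta; lra.
  rewrite (mean_add wint)//; last by apply: growthB => //; exact: growthB.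
  rewrite (mean_sub wint)//; last exact: growthB.
  rewrite (mean_sub wint)// mean_cst !(mean_scale wint); try by exact: growth_leq (prod2 _ _).
  rewrite wick !pair_moment !bil_delta; lra.
Qed.

End Gaussian.

End Moments.

(** * Moment conditions for a regular feature *)

Section Transfer.
Context d d' {T : measurableType d} {Y : measurableType d'} {R : realType}.
Context (P : probability T R) (X : {RV P >-> Y}).

Let integrable_pullback (f : Y -> R) : (distribution P X).-integrable setT (EFin \o f) ->
  P.-integrable setT ((EFin \o f) \o X).
Proof.
move=> /integrableP[mf fint]; apply/integrableP; split; first exact: measurableT_comp.
rewrite (ge0_integral_distribution X (f := fun y => `|(EFin \o f) y|%E)) in fint => //.
exact: measurableT_comp.
Qed.

Lemma expectation_law (f : Y -> R) : (distribution P X).-integrable setT (EFin \o f) ->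
  'E_P[fun w => f (X w)]%E = (\int[distribution P X]_y f y)%:E.
Proof.
move=> fint; have mf := measurable_int _ fint; have pint := integrable_pullback fint.
rewrite unlock /Rintegral fineK; first by rewrite integral_distribution.
exact: integrable_fin_num fint.
Qed.

Lemma variance_law (f : Y -> R) : (distribution P X).-integrable setT (EFin \o f) ->
  (distribution P X).-integrable setT (EFin \o (fun y => f y ^+ 2)) ->
  let m := \int[distribution P X]_y f y in
  'V_P[fun w => f (X w)]%E = (\int[distribution P X]_y ((f y - m) ^+ 2))%:E.
Proof.
move=> fint f2int m; rewrite /variance unlock expectation_law//= -/m.
rewrite -(expectation_law (f := fun y => (f y - m) ^+ 2)); last first.
  rewrite (_ : _ \o _ = (EFin \o (fun y => (f y ^+ 2)%R)) \- (fun y => (2 * m)%:E * (f y)%:E) \+ cst (m ^+ 2)%:E)%E; last first.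
    by apply/funext => y /=; rewrite (_ : (f y - m) ^+ 2 = f y ^+ 2 - 2 * m * f y + m ^+ 2)//; lra.
  apply: integrableD => //; last exact: finite_measure_integrable_cst.
  by apply: integrableB => //; exact: integrableZl.
by [].
Qed.

End Transfer.

Section RegularFeature.
Context d (T : measurableType d) (R : realType) (P : probability T R) (N : nat).
Local Notation vec := (borel_rV R N).
Context (W : {RV P >-> vec}) (K tau : R) (Sigma : 'M[R]_N).
Hypothesis feature : regular_feature K tau Sigma W.
Let mu : probability vec R := distribution P W.

Let four theta : (\int[mu]_z (dot z theta ^+ 4)%:E <=
  (K ^+ 4 * (op_norm Sigma * dot theta theta) ^+ 2)%:E)%E.
Proof.
have [_ _ _ /(_ theta) F1 _] := feature.
rewrite ge0_integral_distribution; last 2 first.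
- by apply/measurable_EFinP; apply: measurable_funX; exact: measurable_dot.
- by move=> y; rewrite lee_fin exprn_even_ge0.
have e0 : (0 <= \int[P]_x (dot (W x : 'rV[R]_N) theta ^+ 4)%:E)%E.
  by apply: integral_ge0 => x _; rewrite lee_fin exprn_even_ge0.
move: F1; rewrite unlock /comp => F1.
rewrite -(sqr_sqrte e0).
have s0 := sqrte_ge0 (\int[P]_x (dot (W x : 'rV[R]_N) theta ^+ 4)%:E)%E.
apply: (@le_trans _ _ ((K ^+ 2 * op_norm Sigma * norm2 theta ^+ 2)%:E ^+ 2)%E).
  by rewrite !expe2; exact: lee_pmul.
by rewrite -EFin_expe lee_fin norm2_sqr; lra.
Qed.

Let wint : mu.-integrable setT (EFin \o weight).
Proof. by apply: weight_integrable => theta; rewrite (le_lt_trans (four theta))// ltry. Qed.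

Let g (k : nat) f : (k <= 4)%N -> growth k f -> mu.-integrable setT (EFin \o f).
Proof. exact: growth_integrable. Qed.

Let coord_mean j : \int[mu]_z (z : 'rV[R]_N) 0 j = 0.
Proof.
have [+ _ _ _ _] := feature; move=> /(_ j).
rewrite (expectation_law (f := fun z : vec => (z : 'rV[R]_N) 0 j)); last exact: g (growth_coord j).
by case.
Qed.

Let coord_pair i j : \int[mu]_z ((z : 'rV[R]_N) 0 i * (z : 'rV[R]_N) 0 j) = Sigma i j.
Proof.
have [c0 + _ _ _] := feature; move=> /(_ i j); rewrite unlock !c0 /=.
rewrite (_ : (_ * _) = (fun w => (fun z : vec => (z : 'rV[R]_N) 0 i * (z : 'rV[R]_N) 0 j) (W w))); last first.
  apply/funext => w; transitivity (((W w : 'rV[R]_N) 0 i - 0) * ((W w : 'rV[R]_N) 0 j - 0)); first by [].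
  by rewrite !subr0.
rewrite (expectation_law (f := fun z : vec => (z : 'rV[R]_N) 0 i * (z : 'rV[R]_N) 0 j)); first by case.
exact: g (growthM (growth_coord i) (growth_coord j)).
Qed.

Lemma feature_symmetric : Sigma^T = Sigma.
Proof.
apply/matrixP => i j; rewrite mxE -!coord_pair; apply: eq_Rintegral => z _.
by rewrite mulrC.
Qed.

Let gp i j (a : R) : growth 2 (fun z : vec => a * ((z : 'rV[R]_N) 0 i * (z : 'rV[R]_N) 0 j)).
Proof. by apply: growthZ; exact: (growthM (growth_coord i) (growth_coord j)). Qed.

Let quad_mean S : \int[mu]_z quad S z = \tr (S *m Sigma).
Proof.
transitivity (\int[mu]_z \sum_i \sum_j S i j * ((z : 'rV[R]_N) 0 i * (z : 'rV[R]_N) 0 j)).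
  apply: eq_Rintegral => z _; rewrite quadE bil_sum; apply: eq_bigr => i _; apply: eq_bigr => j _.
  by rewrite mulrCA mulrA.
rewrite (mean_sum wint); last by move=> i; apply: growth_sum => j; exact: growth_leq (gp i j _).
apply: eq_bigr => i _; rewrite mxE (mean_sum wint); last by move=> j; exact: growth_leq (gp i j _).
apply: eq_bigr => j _; rewrite (mean_scale wint); last first.
  exact: growth_leq (growthM (growth_coord i) (growth_coord j)).
by rewrite coord_pair -[in LHS]feature_symmetric mxE.
Qed.

Let var_mean theta : \int[mu]_z (dot z theta ^+ 2) = quad Sigma theta.
Proof.
transitivity (\int[mu]_z quad (theta^T *m theta) (z : 'rV[R]_N)).
  apply: eq_Rintegral => z _.
  rewrite quadE bil_sum expr2 mulr_suml; apply: eq_bigr => i _; rewrite mulr_sumr.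
  by apply: eq_bigr => j _; rewrite mxE big_ord1 mxE; lra.
rewrite quad_mean -mulmxA mxtrace_mulC /mxtrace big_ord1 quadE /bil.
by rewrite !mxE.
Qed.

Lemma feature_psd theta : 0 <= quad Sigma theta.
Proof. by rewrite -var_mean; apply: mean_ge0 => z; exact: sqr_ge0. Qed.

(** Fourth moments are (F1) squared, and (F2) is the variance bound, the mean of the quadratic
   form being tr (S Sigma). *)
Lemma feature_moments (kappa rho2 : R) : K ^+ 4 <= kappa -> tau ^+ 2 <= rho2 ->
  moments Sigma (op_norm Sigma) kappa rho2 mu.
Proof.
move=> Kk tr; split=> //.
- move=> theta; rewrite (mean_sum wint); last first.
    by move=> j; apply: (@growth_leq _ _ (1 + 0)) => //; exact: (growthM (growth_coord j) (growth_cst _)).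
  apply: big1 => j _; under eq_Rintegral do rewrite mulrC.
  by rewrite (mean_scale wint) ?coord_mean ?mulr0//; exact: growth_leq (growth_coord j).
- move=> theta; apply: (@le_trans _ _ (K ^+ 4 * (op_norm Sigma * dot theta theta) ^+ 2)).
    rewrite -lee_fin /Rintegral fineK; first exact: four.
    exact: integrable_fin_num (g (leqnn 4) (growthX 4 (growth_dot theta))).
  by rewrite ler_wpM2r// sqr_ge0.
- move=> S sS; have [_ _ _ _ /(_ S sS)] := feature.
  have gq := growth_quad S.
  rewrite (variance_law (f := fun z : vec => quad S z)); last 2 first.
  - exact: g gq.
  - exact: (g (leqnn 4) (growthX 2 gq)).
  rewrite quad_mean lee_fin => h; apply: le_trans h _.
  by rewrite ler_wpM2r// sqr_ge0.
Qed.

End RegularFeature.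

(** * Effect of one random sample *)

Section Balance.
Context {R : realType}.

(** Optimise the weight a in an arithmetic-geometric mean inequality. Taking a = eta does it
   when eta is positive; when eta = 0, let a tend to 0. *)
Lemma balance (y p A eta q : R) : 0 <= eta -> 0 <= A -> 0 <= q -> 0 <= p ->
  (forall a, 0 < a -> y <= p * (a * A + eta ^+ 2 * q / a)) -> y <= p * (eta * (A + q)).
Proof.
move=> eta0 A0 q0 p0 h; have [e0|eN0] := eqVneq eta 0; last first.
  have e1 : 0 < eta by rewrite lt_def eN0.
  have e2 : eta ^+ 2 * q / eta = eta * q by apply: (mulIf eN0); rewrite divfK//; lra.
  by have := h _ e1; rewrite e2; lra.
rewrite e0 mul0r mulr0; apply/ler_addgt0Pr => e e_gt0; rewrite add0r.
have s0 : 0 < p * A + 1 by rewrite ltr_wpDl// mulr_ge0.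
pose a := e / (p * A + 1); have a0 : 0 < a by rewrite divr_gt0.
have ae : a * (p * A + 1) = e by rewrite divfK// gt_eqF.
by have := h a a0; rewrite e0 expr0n/= !mul0r; lra.
Qed.

Lemma inv_shift_diff (m g h : R) : 0 < m -> 0 <= g -> 0 <= h ->
  `|(2 * (m + g))^-1 - (2 * (m + h))^-1| <= `|g - h| / (2 * m ^+ 2).
Proof.
move=> m0 g0 h0; have mg : 0 < m + g by rewrite ltr_wpDr.
have mh : 0 < m + h by rewrite ltr_wpDr.
have -> : (2 * (m + g))^-1 - (2 * (m + h))^-1 = (h - g) * (2 * ((m + g) * (m + h)))^-1.
  have e : (h - g) * ((m + g)^-1 * (m + h)^-1) = (m + g)^-1 - (m + h)^-1.
    rewrite (_ : h - g = (m + h) - (m + g)); last by lra.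
    by rewrite mulrBl mulrCA divff ?gt_eqF// mulr1 mulrA divff ?gt_eqF// mul1r.
  by rewrite !invfM mulrCA e; lra.
have p0 : 0 < 2 * ((m + g) * (m + h)) by rewrite !mulr_gt0.
rewrite normrM distrC; apply: ler_wpM2l => //; rewrite gtr0_norm ?invr_gt0//.
rewrite lef_pV2 ?posrE ?mulr_gt0 ?exprn_gt0//.
by rewrite ler_pM2l//; nra.
Qed.
End Balance.

Section OneCoordinate.
Context {R : realType} (N n : nat) (D : set 'rV[R]_N) (B : 'rV[R]_N -> R) (vartheta : R).
Hypothesis D0 : D !=set0.
Hypothesis bD : bounded_set D.
Hypothesis cD : convex_set D.
Hypothesis oD : relatively_open D.
Hypothesis B_ge0 : forall x, D x -> 0 <= B x.
Hypothesis scB : self_concordant_barrier vartheta D B.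
Context (lambda beta gamma : R).
Hypothesis lambda_gt0 : 0 < lambda.
Hypothesis beta_gt0 : 0 < beta.
Hypothesis gamma_gt0 : 0 < gamma.
Hypothesis n_gt0 : (0 < n)%N.
Context (Sigma : 'M[R]_N) (kappa rho2 eta : R).
Hypothesis quad_le : forall theta : 'rV[R]_N, quad Sigma theta <= lambda * dot theta theta.
Hypothesis kappa_ge0 : 0 <= kappa.
Hypothesis rho2_ge0 : 0 <= rho2.
Hypothesis eta_ge0 : 0 <= eta.
Hypothesis eta_dim : (\dim (direction D))%:R * (rho2 / (2 * lambda ^+ 2) + 2) <= 3 * eta ^+ 2.
Local Notation vec := (borel_rV R N).
Let nR : 0 < n%:R :> R. Proof. by rewrite ltr0n. Qed.

(** Bound on the fourth moment of the residual of a new sample at the minimiser of the partial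
   problem, in terms of the value of that problem. *)
Definition fourth_bound (Phi0 : R) : R := 8 * (1 + kappa) * (Phi0 / beta) ^+ 2.

(** Cubic Taylor error, plus the error made when g is replaced by its mean. *)
Definition swap_bound (Phi0 : R) : R :=
  3 * ((Num.sqrt gamma)^-1 / Num.sqrt n%:R ^+ 3) * (1 + fourth_bound Phi0)
  + (4 * n%:R ^+ 2)^-1 * (eta * (fourth_bound Phi0 + 3 / beta ^+ 2)).

(** The mean of Psi is c0 up to an error, and c0 only involves Sigma and the other samples, so
   it is the same for every law with the given moments. Replace g by its mean: the mean of x^2
   / (2 (n + g)) becomes a function of the second moment of x. The cost is the mean of x^2 |g -
   gb| / (2 n^2), which is split by the arithmetic-geometric mean inequality between the fourth
   moment of x and the variance of g. *)
Lemma one_coordinate (P : pred 'I_n) (Z : 'I_n -> 'rV[R]_N) :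
  let Phi0 := partial_Phi D B lambda beta gamma P Z in
  let Psi := fun z : vec => inf [set partial_objective lambda beta P Z t c + gamma * B t
      + (2 * n%:R)^-1 * (c - dot z t) ^+ 2 | t in D & c in [set: R]] in
  exists c0 : R, forall mu : probability vec R, moments Sigma lambda kappa rho2 mu ->
    measurable_fun [set: vec] Psi ->
    [/\ growth 2 Psi, `|\int[mu]_z Psi z - c0| <= swap_bound Phi0
      & \int[mu]_z (Psi z - Phi0) ^+ 2 <= fourth_bound Phi0 / (4 * n%:R ^+ 2)].
Proof.
move=> Phi0 Psi.
have [th [b [T [u [e [bM sT T2 u2 HPsi]]]]]] :=
  partial_expansion D0 bD cD oD B_ge0 scB lambda_gt0 beta_gt0 gamma_gt0 n_gt0 P Z.
rewrite -/Phi0 in bM HPsi.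
have dth0 := dotxx_ge0 th.
pose x (z : vec) := b - dot z th.
pose g (z : vec) := quad T z - 2 * dot u z + e.
pose gt := \tr (T *m Sigma) + e.
(* Truncation at 0 keeps n + gb positive, and only brings gb closer to g, which is nonnegative.
   *)
pose gb := Num.max gt 0.
have gb0 : 0 <= gb by rewrite le_max lexx orbT.
pose s : R := 2 * (n%:R + gb).
have s0 : 0 < s by rewrite mulr_gt0// ltr_wpDr.
exists (Phi0 + (b ^+ 2 + quad Sigma th) / s) => mu mm mPsi.
have wint := moments_weight mm.
have gd t : growth 1 (fun z : vec => dot z t) := growth_dot t.
have gx : growth 1 x by apply: growthB => //; exact: growth_leq (growth_cst _).
have gx2 : growth 2 (fun z => x z ^+ 2) by exact: (growthX 2 gx).
have gx4 : growth 4 (fun z => x z ^+ 4) by exact: (growthX 4 gx).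
have c4 a : growth 4 (fun _ : vec => a) by exact: growth_leq (growth_cst _).
have c2 a : growth 2 (fun _ : vec => a) by exact: growth_leq (growth_cst _).
have up1 (f : vec -> R) : growth 1 f -> growth 4 f by exact: growth_leq.
have up2 (f : vec -> R) : growth 2 f -> growth 4 f by exact: growth_leq.
have x0 z : 0 <= (2 * n%:R)^-1 * x z ^+ 2 by rewrite mulr_ge0 ?sqr_ge0// invr_ge0 mulr_ge0// ltW.
have Phi00 : 0 <= Phi0.
  by apply: le_trans bM; apply: mulr_ge0; [exact: ltW|apply: addr_ge0; [by rewrite mulr_ge0// ltW|exact: sqr_ge0]].
have gPsi : growth 2 Psi.
  apply: (@growth_le _ _ _ _ (fun z => Phi0 + (2 * n%:R)^-1 * x z ^+ 2)) => //.
    by apply: growthD => //; exact: growthZ.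
  move=> z; have [_ h1 h2 _] := HPsi z; by rewrite (ger0_norm (le_trans Phi00 h1)) (ger0_norm (addr_ge0 Phi00 (x0 z))).
pose A := fourth_bound Phi0.
have A0 : 0 <= A by rewrite /A /fourth_bound; rewrite mulr_ge0 ?sqr_ge0// mulr_ge0// addr_ge0.
have Ex4 : \int[mu]_z (x z ^+ 4) <= A.
  have gd4 : growth 4 (fun z : vec => dot z th ^+ 4) := growthX 4 (gd th).
  apply: (@le_trans _ _ (\int[mu]_z (8 * b ^+ 4 + 8 * dot z th ^+ 4))).
    apply: (mean_le wint) => //; first by apply: growthD => //; exact: growthZ.
    move=> z; rewrite /x; move: (dot _ _) => y.
    have h1 : 0 <= (b + y) ^+ 4 by rewrite exprn_even_ge0.
    have := sqr_ge0 (b ^+ 2 - y ^+ 2); nra.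
  rewrite (mean_add wint)//; last exact: growthZ.
  rewrite mean_cst (mean_scale wint)//.
  have h4 := moments_four mm th.
  have bM' : lambda * dot th th + b ^+ 2 <= Phi0 / beta by rewrite ler_pdivlMr// mulrC.
  have l0 : 0 <= lambda * dot th th by rewrite mulr_ge0// ltW.
  have b0 := sqr_ge0 b.
  have sq : (lambda * dot th th + b ^+ 2) ^+ 2 <= (Phi0 / beta) ^+ 2.
    by rewrite ler_pXn2r// nnegrE ?addr_ge0// divr_ge0// ltW.
  rewrite /A /fourth_bound; apply: (@le_trans _ _ (8 * (1 + kappa) * (lambda * dot th th + b ^+ 2) ^+ 2)); last first.
    by rewrite ler_wpM2l// mulr_ge0// addr_ge0.
  have kp : 0 <= kappa * (b ^+ 4 + 2 * b ^+ 2 * (lambda * dot th th)).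
    apply: mulr_ge0 => //; apply: addr_ge0; first exact: exprn_even_ge0.
    by apply: mulr_ge0 => //; exact: mulr_ge0.
  have p2 := mulr_ge0 b0 l0; have p3 := sqr_ge0 (lambda * dot th th).
  nra.
have n2 : 0 <= (4 * n%:R ^+ 2)^-1 :> R by rewrite invr_ge0 mulr_ge0// sqr_ge0.
split=> //; last first.
  rewrite mulrC -[leRHS]/(_ * A); apply: (@le_trans _ _ (\int[mu]_z ((4 * n%:R ^+ 2)^-1 * x z ^+ 4))).
    apply: (mean_le wint).
    - by apply: (growthX 2 (growthB gPsi _)).
    - exact: growthZ.
    - move=> z; have [_ h1 h2 _] := HPsi z.
      have -> : (4 * n%:R ^+ 2)^-1 * x z ^+ 4 = ((2 * n%:R)^-1 * x z ^+ 2) ^+ 2.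
        by rewrite exprMn -exprM exprVn exprMn; congr ((_ * _)^-1 * _); lra.
      rewrite ler_pXn2r// ?nnegrE ?subr_ge0//.
      by rewrite lerBlDl.
  by rewrite (mean_scale wint)// ler_wpM2l.
pose cub := 3 * ((Num.sqrt gamma)^-1 / Num.sqrt n%:R ^+ 3).
have cub0 : 0 <= cub by rewrite mulr_ge0// mulr_ge0 ?invr_ge0 ?exprn_ge0 ?sqrtr_ge0.
suff H a : 0 < a -> `|\int[mu]_z Psi z - (Phi0 + (b ^+ 2 + quad Sigma th) / s)| - cub * (1 + A)
    <= (4 * n%:R ^+ 2)^-1 * (a * A + eta ^+ 2 * (3 / beta ^+ 2) / a).
  rewrite /swap_bound -/A -/cub -lerBlDl.
  by apply: balance H => //; rewrite divr_ge0 ?sqr_ge0.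
move=> a_gt0; rewrite lerBlDl.
pose q (z : vec) := quad T z - \tr (T *m Sigma).
have gq : growth 2 q by apply: growthB; [exact: growth_quad|].
have gq2 : growth 4 (fun z => q z ^+ 2) := growthX 2 gq.
have gu2 : growth 2 (fun z : vec => dot z u ^+ 2) := growthX 2 (gd u).
pose dev z := Psi z - (Phi0 + s^-1 * x z ^+ 2).
have gdev : growth 2 dev.
  by apply: growthB => //; apply: growthD => //; exact: growthZ.
have Ex2 : \int[mu]_z (x z ^+ 2) = b ^+ 2 + quad Sigma th.
  transitivity (\int[mu]_z (b ^+ 2 - (2 * b) * dot z th + dot z th ^+ 2)).
    by apply: eq_Rintegral => z _; rewrite /x; lra.
  have g1 : growth 4 (fun z : vec => (2 * b) * dot z th) by apply: growthZ; exact: (up1 _ (gd th)).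
  have g2 : growth 4 (fun z : vec => dot z th ^+ 2) by exact: (up2 _ (growthX 2 (gd th))).
  rewrite (mean_add wint)//; last exact: growthB.
  rewrite (mean_sub wint)// mean_cst (mean_scale wint); last exact: (up1 _ (gd th)).
  by rewrite (moments_mean mm) (moments_var mm); lra.
have -> : \int[mu]_z Psi z - (Phi0 + (b ^+ 2 + quad Sigma th) / s) = \int[mu]_z dev z.
  rewrite (mean_sub wint); [|exact: (up2 _ gPsi)|]; last by apply: growthD => //; apply: growthZ; exact: (up2 _ gx2).
  rewrite (mean_add wint)//; last by apply: growthZ; exact: (up2 _ gx2).
  by rewrite mean_cst (mean_scale wint) ?Ex2 1?mulrC//; exact: (up2 _ gx2).
pose G (z : vec) := cub * (1 + x z ^+ 4) + (4 * n%:R ^+ 2)^-1 *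
  (a * x z ^+ 4 + a^-1 * (2 * q z ^+ 2 + 8 * dot z u ^+ 2)).
have gp1 : growth 4 (fun z => 1 + x z ^+ 4) by exact: growthD.
have gp3 : growth 4 (fun z : vec => 2 * q z ^+ 2 + 8 * dot z u ^+ 2).
  by apply: growthD; [exact: growthZ|apply: growthZ; exact: (up2 _ gu2)].
have gp2 : growth 4 (fun z : vec => a * x z ^+ 4 + a^-1 * (2 * q z ^+ 2 + 8 * dot z u ^+ 2)).
  by apply: growthD; exact: growthZ.
have gG : growth 4 G by apply: growthD; exact: growthZ.
have devG z : `|dev z| <= G z.
  have [g0 _ _ h3] := HPsi z; rewrite -/(x z) -/(g z) in g0 h3.
  have ng : 0 < n%:R + g z by rewrite ltr_wpDr.
  have -> : dev z = (Psi z - Phi0 - x z ^+ 2 / (2 * (n%:R + g z)))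
      + x z ^+ 2 * ((2 * (n%:R + g z))^-1 - (2 * (n%:R + gb))^-1) by rewrite /dev /s; lra.
  apply: le_trans (ler_normD _ _) _; apply: lerD.
    apply: le_trans h3 _; rewrite expr_div_n /cub.
    have x3 : `|x z| ^+ 3 <= 1 + x z ^+ 4.
      have -> : x z ^+ 4 = `|x z| ^+ 4 by rewrite -normrX ger0_norm// exprn_even_ge0.
      have [x1|/ltW x1] := leP `|x z| 1.
        by apply: (@le_trans _ _ 1); [exact: exprn_ile1|rewrite lerDl exprn_ge0].
      by apply: le_trans (ler_weXn2l x1 (isT : 3 <= 4)%N) _; rewrite lerDr.
    apply: le_trans (ler_wpM2l cub0 x3); rewrite /cub le_eqVlt; apply/orP; left; apply/eqP; lra.
  rewrite normrM (ger0_norm (sqr_ge0 _)).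
  have d1 := inv_shift_diff nR g0 gb0.
  have d2 : `|g z - gb| ^+ 2 <= 2 * q z ^+ 2 + 8 * dot z u ^+ 2.
    apply: (@le_trans _ _ ((g z - gt) ^+ 2)).
      rewrite real_normK ?num_real// /gb; case: (leP gt 0) => gt0//; nra.
    have -> : g z - gt = q z - 2 * dot z u by rewrite /g /gt /q (dotC u); lra.
    have := sqr_ge0 (q z + 2 * dot z u); nra.
  have x2 := sqr_ge0 (x z).
  apply: le_trans (ler_wpM2l x2 d1) _.
  have -> : x z ^+ 2 * (`|g z - gb| / (2 * n%:R ^+ 2)) = (4 * n%:R ^+ 2)^-1 * (2 * (x z ^+ 2 * `|g z - gb|)).
    by rewrite !invfM; lra.
  rewrite ler_wpM2l//; move: d2 x2; move: `|g z - gb| (2 * _ + 8 * _) => dl rr d2 x2.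
  have ia : 0 < a^-1 by rewrite invr_gt0.
  have am : a * (a^-1 * dl - x z ^+ 2) ^+ 2 = a^-1 * dl ^+ 2 - 2 * (x z ^+ 2 * dl) + a * x z ^+ 4.
    have aV : a * a^-1 = 1 by rewrite divff// gt_eqF.
    transitivity ((a * a^-1) * (a^-1 * dl ^+ 2) - 2 * (a * a^-1) * (x z ^+ 2 * dl) + a * x z ^+ 4); first by lra.
    by rewrite aV; lra.
  have := mulr_ge0 (ltW a_gt0) (sqr_ge0 (a^-1 * dl - x z ^+ 2)).
  have := ler_wpM2l (ltW ia) d2.
  by rewrite am; lra.
apply: (@le_trans _ _ (\int[mu]_z G z)).
  apply: (@le_trans _ _ (\int[mu]_z `|dev z|)).
    by apply: le_normr_Rintegral => //; exact: (growth_integrable wint (leqnn 4) (up2 _ gdev)).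
  by apply: (mean_le wint) => //; exact: (up2 _ (growth_norm gdev)).
rewrite (mean_add wint); [|exact: growthZ|exact: growthZ].
rewrite !(mean_scale wint)// (mean_add wint)// mean_cst.
apply: lerD; first by rewrite ler_wpM2l// lerD2l.
rewrite ler_wpM2l// (mean_add wint); [|exact: growthZ|exact: growthZ].
rewrite !(mean_scale wint)// (mean_add wint); [|exact: growthZ|apply: growthZ; exact: (up2 _ gu2)].
rewrite !(mean_scale wint)//; last exact: (up2 _ gu2).
apply: lerD; first by rewrite ler_wpM2l// ltW.
rewrite [leLHS]mulrC ler_pM2r ?invr_gt0//.
rewrite (moments_var mm).
have hq := moments_quad mm sT.
have hu := quad_le u.
move: T2 u2 eta_dim; move: (\dim (direction D))%:R => k T2 u2 ed.
pose il := lambda^-1; pose ib := beta^-1.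
have lil : lambda * il = 1 by rewrite divff// gt_eqF.
have ib2 : 0 <= ib ^+ 2 by exact: sqr_ge0.
have T2' : normF T ^+ 2 <= k * (ib ^+ 2 * il ^+ 2 / 4).
  by apply: le_trans T2 _; rewrite !exprMn !invfM /ib /il !exprVn; lra.
have u2' : dot u u <= k * (ib ^+ 2 * il / 4).
  by apply: le_trans u2 _; rewrite !invfM /ib /il !exprVn; lra.
have ed' : k * (rho2 * il ^+ 2 / 2 + 2) <= 3 * eta ^+ 2.
  by apply: le_trans ed; rewrite !invfM /il !exprVn; lra.
have m1 := ler_wpM2l rho2_ge0 T2'.
have m2 := ler_wpM2l (ltW lambda_gt0) u2'.
have m3 := ler_wpM2l ib2 ed'.
have m4 : lambda * (k * (ib ^+ 2 * il / 4)) = k * ib ^+ 2 / 4.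
  by rewrite -[RHS]mul1r -lil; lra.
have -> : 3 / beta ^+ 2 = 3 * ib ^+ 2 by rewrite /ib exprVn.
rewrite m4 in m2; rewrite -/q in hq *.
lra.
Qed.

End OneCoordinate.

(** * Partial values as functions of the samples *)

Section PartialPhi.
Context {R : realType} (N n : nat) (D : set 'rV[R]_N) (B : 'rV[R]_N -> R).
Hypothesis D0 : D !=set0.
Hypothesis B_ge0 : forall x, D x -> 0 <= B x.
Context (lambda beta gamma : R).
Hypothesis lambda_gt0 : 0 < lambda.
Hypothesis beta_gt0 : 0 < beta.
Hypothesis gamma_gt0 : 0 < gamma.
Hypothesis n_gt0 : (0 < n)%N.
Implicit Types (P : pred 'I_n) (Z : 'I_n -> 'rV[R]_N).
Local Notation vec := (borel_rV R N).

Let n2 : 0 < (2 * n%:R)^-1 :> R. Proof. by rewrite invr_gt0 mulr_gt0// ltr0n. Qed.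

Lemma PhiE Z : Phi lambda D B beta gamma Z = partial_Phi D B lambda beta gamma xpredT Z.
Proof. by []. Qed.

Lemma partial_Phi_ext P Z Z' : (forall j, P j -> Z j = Z' j) ->
  partial_Phi D B lambda beta gamma P Z = partial_Phi D B lambda beta gamma P Z'.
Proof.
move=> ZZ'; congr inf; apply/seteqP; split => _ [t Dt [c _ <-]]; exists t => //; exists c => //;
  by rewrite /partial_objective; congr (_ * _ + _ + _); apply: eq_bigr => j Pj; rewrite ZZ'.
Qed.

(** Putting sample i back into the partial problem adds its squared residual. *)
Lemma Phi_split Z i (x : 'rV[R]_N) :
  Phi lambda D B beta gamma (fun j => if j == i then x else Z j) = inf [set partial_objective lambda beta (predC1 i) Z t c
    + gamma * B t + (2 * n%:R)^-1 * (c - dot x t) ^+ 2 | t in D & c in [set: R]].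
Proof.
have e t c : objective lambda (fun j => if j == i then x else Z j) t c beta + gamma * B t = partial_objective lambda beta (predC1 i) Z t c
    + gamma * B t + (2 * n%:R)^-1 * (c - dot x t) ^+ 2.
  rewrite /objective (bigD1 i)//= eqxx mulrDr.
  under eq_bigr => j ji do rewrite (negbTE ji).
  by rewrite /partial_objective; lra.
by congr inf; apply/seteqP; split => _ [t Dt [c _ <-]]; exists t => //; exists c; rewrite ?e.
Qed.

Let value_ge0 P Z t c : D t -> 0 <= partial_objective lambda beta P Z t c + gamma * B t.
Proof.
move=> Dt; have Bt := B_ge0 Dt; rewrite addr_ge0//; last by rewrite mulr_ge0// ltW.
rewrite addr_ge0//; first by rewrite mulr_ge0 ?(ltW n2)// sumr_ge0// => j _; exact: sqr_ge0.
by apply: mulr_ge0; [exact: ltW|apply: addr_ge0; [apply: mulr_ge0; [exact: ltW|exact: sqr_ge0]|exact: sqr_ge0]].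
Qed.

Let lb P Z : lbound [set partial_objective lambda beta P Z t c + gamma * B t | t in D & c in [set: R]] 0.
Proof. by move=> _ [t Dt [c _ <-]]; exact: value_ge0. Qed.

Lemma partial_Phi_ge0 P Z : 0 <= partial_Phi D B lambda beta gamma P Z.
Proof.
apply: lb_le_inf; last exact: lb.
by have [t Dt] := D0; exists (partial_objective lambda beta P Z t 0 + gamma * B t); exists t => //; exists 0.
Qed.

Lemma partial_Phi_le P Z t c : D t ->
  partial_Phi D B lambda beta gamma P Z <= partial_objective lambda beta P Z t c + gamma * B t.
Proof.
by move=> Dt; apply: ge_inf; [exists 0; exact: lb|exists t => //; exists c].
Qed.

Lemma partial_Phi_witness P Z (r : R) : partial_Phi D B lambda beta gamma P Z < r ->
  exists t c, D t /\ partial_objective lambda beta P Z t c + gamma * B t < r.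
Proof.
move=> /inf_lt[|_ [t Dt [c _ <-]] tr]; last by exists t, c.
by have [t Dt] := D0; exists (partial_objective lambda beta P Z t 0 + gamma * B t); exists t => //; exists 0.
Qed.

(** The objective at fixed (t, c) is continuous in the samples. *)
Let objective_near P Z t c : exists2 K : R, 0 <= K & forall (e : R) Z', 0 <= e -> e <= 1 ->
  (forall j k, `|Z' j 0 k - Z j 0 k| <= e) ->
  partial_objective lambda beta P Z' t c <= partial_objective lambda beta P Z t c + K * e.
Proof.
pose S : R := \sum_k `|t 0 k|; pose x j := c - dot (Z j) t.
have S0 : 0 <= S by apply: sumr_ge0.
exists ((2 * n%:R)^-1 * \sum_(j | P j) (2 * `|x j| * S + S ^+ 2)).
  by rewrite mulr_ge0 ?(ltW n2)// sumr_ge0// => j _; rewrite addr_ge0 ?sqr_ge0// !mulr_ge0.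
move=> e Z' e0 e1 ZZ'; rewrite /partial_objective.
suff H : \sum_(j | P j) (c - dot (Z' j) t) ^+ 2 <= \sum_(j | P j) (c - dot (Z j) t) ^+ 2
    + e * \sum_(j | P j) (2 * `|x j| * S + S ^+ 2).
  by have := ler_wpM2l (ltW n2) H; lra.
rewrite mulr_sumr -big_split /=; apply: ler_sum => j _.
have dy : `|dot (Z' j) t - dot (Z j) t| <= e * S.
  rewrite /dot -sumrB mulr_sumr; apply: le_trans (ler_norm_sum _ _ _) _.
  by apply: ler_sum => k _; rewrite -mulrBl normrM ler_wpM2r.
rewrite -/(x j).
have -> : c - dot (Z' j) t = x j - (dot (Z' j) t - dot (Z j) t) by rewrite /x; lra.
move: (dot (Z' j) t - dot (Z j) t) dy => y dy.
have y2 : y ^+ 2 <= (e * S) ^+ 2.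
  by rewrite -(real_normK (num_real y)) ler_pXn2r// nnegrE mulr_ge0.
have xy : - (x j * y) <= `|x j| * (e * S).
  by apply: le_trans (ler_norm _) _; rewrite normrN normrM ler_wpM2l.
have ee : e ^+ 2 <= e by rewrite expr2 ler_piMl.
have := ler_wpM2r (sqr_ge0 S) ee.
lra.
Qed.

(** If the infimum is below a level, so is the objective at some fixed (t, c), and it stays
   below for nearby samples. *)
Lemma measurable_partial_Phi (I : finType) (s : 'I_n -> I) P :
  measurable_fun [set: arr vec I] (fun z : arr vec I => partial_Phi D B lambda beta gamma P (fun j => z (s j))).
Proof.
apply: measurable_open_sublevel => c z /partial_Phi_witness[t [b [Dt tc]]].
have [K K0 HK] := objective_near P (fun j => z (s j)) t b.
set o := partial_objective _ _ _ _ _ _ + _ in tc.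
have K1 : 0 < K + 1 by rewrite ltr_wpDl.
pose e := Num.min 1 ((c - o) / (K + 1)).
have e0 : 0 < e by rewrite lt_min ltr01 divr_gt0// subr_gt0.
have e1 : e <= 1 by rewrite ge_min lexx.
have eK : e * (K + 1) <= c - o by rewrite -ler_pdivlMr// ge_min lexx orbT.
exists e => // z' zz'; apply: le_lt_trans (partial_Phi_le _ _ b Dt) _.
have := HK e (fun j => z' (s j)) (ltW e0) e1 (fun j k => ltW (zz' (s j) k)).
rewrite /o in eK; lra.
Qed.

End PartialPhi.

(** * Summation over the samples *)

Section ArrayComparison.
Context {R : realType} (N n : nat) (D : set 'rV[R]_N) (B : 'rV[R]_N -> R) (vartheta : R).
Hypothesis D0 : D !=set0.
Hypothesis bD : bounded_set D.
Hypothesis cD : convex_set D.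
Hypothesis oD : relatively_open D.
Hypothesis B_ge0 : forall x, D x -> 0 <= B x.
Hypothesis scB : self_concordant_barrier vartheta D B.
Context (lambda beta gamma : R).
Hypothesis lambda_gt0 : 0 < lambda.
Hypothesis beta_gt0 : 0 < beta.
Hypothesis gamma_gt0 : 0 < gamma.
Hypothesis n_gt0 : (0 < n)%N.
Context (Sigma : 'M[R]_N) (kappa rho2 eta : R).
Hypothesis quad_le : forall theta : 'rV[R]_N, quad Sigma theta <= lambda * dot theta theta.
Hypothesis kappa_ge0 : 0 <= kappa.
Hypothesis rho2_ge0 : 0 <= rho2.
Hypothesis eta_ge0 : 0 <= eta.
Hypothesis eta_dim : (\dim (direction D))%:R * (rho2 / (2 * lambda ^+ 2) + 2) <= 3 * eta ^+ 2.
Local Notation vec := (borel_rV R N).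
Context (I : finType) (mu : I -> probability vec R) (nu : probability (arr vec I) R).
Hypothesis nu_box : forall A : I -> set vec, (forall i, measurable (A i)) ->
  nu [set z | forall i, A i (z i)] = (\prod_i mu i (A i))%E.
Hypothesis mu_moments : forall i, moments Sigma lambda kappa rho2 (mu i).
(* theta0 serves as a competitor with intercept 0; it will be chosen to nearly attain the
   infimum in Lambda_ref, which takes the place of Lam. *)
Context (theta0 : 'rV[R]_N) (Lam : R).
Hypothesis D_theta0 : D theta0.
Hypothesis theta0_le : (1 + beta^-1) * (lambda * dot theta0 theta0 + gamma * B theta0) <= Lam.
Hypothesis Lam_ge1 : 1 <= Lam.
Hypothesis Lam_ge_inv : beta^-1 <= Lam.
Implicit Types (s : 'I_n -> I) (P : pred 'I_n) (z : arr vec I).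

Let nR : 0 < n%:R :> R. Proof. by rewrite ltr0n. Qed.
Let mw := @measurable_weight R N.
Let w0 := @weight_ge0 R N.
Let wint i := moments_weight (mu_moments i).
Local Notation tame := (tame (@weight R N)).
Local Notation sq_tame := (sq_tame (@weight R N)).

(** The map s selects which coordinates of the array are used as samples. *)
Definition value P s z : R := partial_Phi D B lambda beta gamma P (fun j => z (s j)).

Let value_ge0 P s z : 0 <= value P s z. Proof. exact: partial_Phi_ge0. Qed.

Lemma tame_coord i (f : vec -> R) : growth 4 f -> tame (fun z : arr vec I => f (z i)).
Proof.
move=> [mf [c c0 fc]]; split; first exact: measurableT_comp mf (measurable_coord i).
exists c => z; apply: le_trans (fc _) _; rewrite ler_wpM2l// /envelope.
rewrite -[leLHS]/(weight (z i)) (bigD1 i)//= addrCA lerDl addr_ge0// sumr_ge0// => j _.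
Qed.

Lemma integral_coord i (f : vec -> R) : growth 4 f ->
  \int[nu]_z f (z i) = \int[mu i]_x f x.
Proof.
move=> gf; rewrite (integral_avg nu_box mw w0 wint i (tame_coord i gf)).
rewrite -[RHS](integral_constant nu); apply: eq_Rintegral => z _.
by apply: eq_Rintegral => x _; rewrite /upd eqxx.
Qed.

Lemma tame_sum (J : Type) (r : seq J) (F : J -> arr vec I -> R) :
  (forall j, tame (F j)) -> tame (fun z => \sum_(j <- r) F j z).
Proof.
move=> tF; elim: r => [|j r IH].
  by under eq_fun do rewrite big_nil; exact: tame_cst.
by under eq_fun do rewrite big_cons; exact: tameD.
Qed.

Lemma integral_sum_tame (J : Type) (r : seq J) (F : J -> arr vec I -> R) :
  (forall j, tame (F j)) -> \int[nu]_z (\sum_(j <- r) F j z) = \sum_(j <- r) \int[nu]_z F j z.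
Proof.
move=> tF; elim: r => [|j r IH].
  by under eq_Rintegral do rewrite big_nil; rewrite big_nil integral_constant.
under eq_Rintegral do rewrite big_cons.
by rewrite big_cons (integral_tameD nu_box mw w0 wint) ?IH//; exact: tame_sum.
Qed.

Lemma sqr_sum_le (F : 'I_n -> R) : (\sum_j F j) ^+ 2 <= n%:R * \sum_j F j ^+ 2.
Proof.
have := dot_CS (\row_j F j) (const_mx 1); rewrite /dot.
under eq_bigr do rewrite !mxE mulr1.
under [X in _ <= X * _ -> _]eq_bigr do rewrite !mxE -expr2.
under [X in _ <= _ * X -> _]eq_bigr do rewrite !mxE mulr1.
by rewrite sumr_const card_ord mulrC.
Qed.

Let r0 : R := beta * (lambda * dot theta0 theta0) + gamma * B theta0.
Let four j (s : 'I_n -> I) z : R := dot (z (s j)) theta0 ^+ 4.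
Let Q s z : R := 2 * r0 ^+ 2 + (2 * n%:R)^-1 * \sum_j four j s z.

Let r0_ge0 : 0 <= r0.
Proof.
apply: addr_ge0; last by apply: mulr_ge0; [exact: ltW|exact: B_ge0].
by apply: mulr_ge0; [exact: ltW|apply: mulr_ge0; [exact: ltW|exact: dotxx_ge0]].
Qed.

(** Test the problem at theta0 with intercept 0, then use Cauchy-Schwarz for the mean of the
   squared residuals. *)
Let value_sqr_le P s z : value P s z ^+ 2 <= Q s z.
Proof.
have h1 : value P s z <= (2 * n%:R)^-1 * \sum_j dot (z (s j)) theta0 ^+ 2 + r0.
  have := @partial_Phi_le R N n D B B_ge0 lambda beta gamma lambda_gt0 beta_gt0 gamma_gt0 n_gt0 P (fun j => z (s j)) theta0 0 D_theta0.
  rewrite -/(value P s z) => /le_trans; apply.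
  rewrite /partial_objective norm2_sqr expr0n addr0 /r0 -addrA lerD2r ler_wpM2l ?invr_ge0 ?mulr_ge0//.
  rewrite [leRHS](bigID P)/= -[leLHS]addr0 lerD//.
    by apply: ler_sum => j _; rewrite sub0r sqrrN.
  by apply: sumr_ge0 => j _; exact: sqr_ge0.
have h2 := sqr_sum_le (fun j => dot (z (s j)) theta0 ^+ 2).
have e4 : \sum_j (dot (z (s j)) theta0 ^+ 2) ^+ 2 = \sum_j four j s z.
  by apply: eq_bigr => j _; rewrite -exprM.
rewrite e4 in h2; rewrite /Q; move: (value P s z) (value_ge0 P s z) h1 h2 => v v0.
have S20 : 0 <= \sum_j dot (z (s j)) theta0 ^+ 2 by apply: sumr_ge0 => j _; exact: sqr_ge0.
move: (\sum_j _) (\sum_j _) S20 => S4 S2 S20 h1 h2.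
have im0 : 0 <= (2 * n%:R)^-1 :> R by rewrite invr_ge0 mulr_ge0.
have im1 : (2 * n%:R)^-1 * (2 * n%:R) = 1 :> R by rewrite mulVf// gt_eqF// mulr_gt0.
have v2 : v ^+ 2 <= ((2 * n%:R)^-1 * S2 + r0) ^+ 2 by rewrite ler_pXn2r// nnegrE// addr_ge0// mulr_ge0.
have h3 := ler_wpM2l (sqr_ge0 ((2 * n%:R)^-1 : R)) h2.
have h4 : (2 * n%:R)^-1 ^+ 2 * (n%:R * S4) = (2 * n%:R)^-1 / 2 * S4 :> R.
  by rewrite -[RHS]mulr1 -[X in _ = _ * X]im1; lra.
rewrite h4 in h3; have := sqr_ge0 ((2 * n%:R)^-1 * S2 - r0).
lra.
Qed.

Lemma measurable_value P s : measurable_fun [set: arr vec I] (value P s).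
Proof. exact: measurable_partial_Phi. Qed.

Let g4 : growth 4 (fun x : vec => dot x theta0 ^+ 4).
Proof. exact: (growthX 4 (growth_dot theta0)). Qed.

Let tame_four j s : tame (four j s). Proof. exact: (tame_coord (s j) g4). Qed.

Let tame_fours s : tame (fun z => \sum_j four j s z). Proof. exact: tame_sum. Qed.

Let tame_Q s : tame (Q s).
Proof. by apply: tameD => //; [exact: tame_cst|exact: tameZ]. Qed.

Lemma sq_tame_value P s : sq_tame (value P s).
Proof.
split; first exact: measurable_value.
apply: (tame_le _ (tame_Q s)); first by apply: measurable_funX; exact: measurable_value.
move=> z; rewrite ger0_norm ?sqr_ge0//; apply: le_trans (ler_norm _); exact: value_sqr_le.
Qed.

Let d0 : R := dot theta0 theta0.
Let c1 : R := 8 * (1 + kappa) * (2 + kappa).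

Let value_second_moment P s : \int[nu]_z (value P s z ^+ 2) <= 2 * r0 ^+ 2 + 2^-1 * kappa * (lambda * d0) ^+ 2.
Proof.
apply: (@le_trans _ _ (\int[nu]_z Q s z)).
  by apply: (integral_tame_le nu_box mw w0 wint (sq_tame_value P s).2 (tame_Q s)) => z; exact: value_sqr_le.
rewrite (integral_tameD nu_box mw w0 wint) ?integral_constant; [|exact: tame_cst|exact: tameZ].
rewrite (integral_tameZ nu_box mw w0 wint)// integral_sum_tame//.
rewrite lerD2l; have im0 : 0 <= (2 * n%:R)^-1 :> R by rewrite invr_ge0 mulr_ge0.
apply: (@le_trans _ _ ((2 * n%:R)^-1 * \sum_(j < n) kappa * (lambda * d0) ^+ 2)).
  rewrite ler_wpM2l//; apply: ler_sum => j _.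
  by rewrite (integral_coord (s j) g4); exact: (moments_four (mu_moments (s j))).
rewrite sumr_const card_ord -[X in _ * X <= _]mulr_natl invfM.
by rewrite -[leLHS]mulrA mulKf ?gt_eqF// mulrA.
Qed.

Let tame_sqr P s : tame (fun z => value P s z ^+ 2). Proof. exact: (sq_tame_value P s).2. Qed.

Let bound4 P s z : R := fourth_bound beta kappa (value P s z).

Let bound4E P s : bound4 P s = (fun z => 8 * (1 + kappa) * beta^-1 ^+ 2 * value P s z ^+ 2).
Proof. by apply/funext => z; rewrite /bound4 /fourth_bound exprMn; lra. Qed.

Let tame_bound4 P s : tame (bound4 P s). Proof. by rewrite bound4E; exact: tameZ. Qed.

(** The second moment of the value is controlled by the competitor theta0. *)
Lemma fourth_bound_mean P s : \int[nu]_z fourth_bound beta kappa (value P s z) <= c1 * Lam ^+ 2.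
Proof.
rewrite -[leLHS]/(\int[nu]_z bound4 P s z) bound4E (integral_tameZ nu_box mw w0 wint)//.
have ib : 0 < beta^-1 by rewrite invr_gt0.
have bb : beta * beta^-1 = 1 by rewrite divff// gt_eqF.
have ld0 : 0 <= lambda * d0 by rewrite mulr_ge0 ?dotxx_ge0// ltW.
have gB0 : 0 <= gamma * B theta0 by apply: mulr_ge0; [exact: ltW|exact: B_ge0].
have t1 : r0 * beta^-1 <= Lam.
  apply: le_trans theta0_le.
  have -> : r0 * beta^-1 = (beta * beta^-1) * (lambda * d0) + gamma * B theta0 * beta^-1 by rewrite /r0 /d0; lra.
  rewrite bb -/d0.
  by have := mulr_ge0 (ltW ib) ld0; lra.
have t2 : (lambda * d0) * beta^-1 <= Lam.
  apply: le_trans theta0_le; rewrite -/d0.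
  by have := mulr_ge0 (ltW ib) gB0; lra.
have s1 : (r0 * beta^-1) ^+ 2 <= Lam ^+ 2.
  by rewrite ler_pXn2r// nnegrE; [apply: mulr_ge0 => //; exact: ltW|apply: le_trans Lam_ge1].
have s2 : ((lambda * d0) * beta^-1) ^+ 2 <= Lam ^+ 2.
  by rewrite ler_pXn2r// nnegrE; [apply: mulr_ge0 => //; exact: ltW|apply: le_trans Lam_ge1].
have k1 : 0 <= 8 * (1 + kappa) * beta^-1 ^+ 2.
  by apply: mulr_ge0; [apply: mulr_ge0 => //; exact: addr_ge0|exact: sqr_ge0].
apply: le_trans (ler_wpM2l k1 (value_second_moment P s)) _.
have s3 : beta^-1 ^+ 2 * (2 * r0 ^+ 2 + 2^-1 * kappa * (lambda * d0) ^+ 2) <= (2 + kappa) * Lam ^+ 2.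
  have := ler_wpM2l kappa_ge0 s2; have := mulr_ge0 kappa_ge0 (sqr_ge0 Lam).
  by move: s1; lra.
have k2 : 0 <= 8 * (1 + kappa) by apply: mulr_ge0 => //; exact: addr_ge0.
by have := ler_wpM2l k2 s3; rewrite /c1 !mulrA.
Qed.

Let swap_const : R := (3 * ((Num.sqrt gamma)^-1 / Num.sqrt n%:R ^+ 3) * (1 + c1)
  + (4 * n%:R ^+ 2)^-1 * (eta * (c1 + 3))) * Lam ^+ 2.

Let swap P s z : R := swap_bound n beta gamma kappa eta (value P s z).

Let swapE P s : swap P s = (fun z => (3 * ((Num.sqrt gamma)^-1 / Num.sqrt n%:R ^+ 3)
    + (4 * n%:R ^+ 2)^-1 * eta) * bound4 P s z
  + (3 * ((Num.sqrt gamma)^-1 / Num.sqrt n%:R ^+ 3) + (4 * n%:R ^+ 2)^-1 * (eta * (3 / beta ^+ 2)))).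
Proof. by apply/funext => z; rewrite /swap /swap_bound -/(bound4 P s z); lra. Qed.

Let tame_swap P s : tame (swap P s).
Proof. by rewrite swapE; apply: tameD => //; [exact: tameZ|exact: tame_cst]. Qed.

Let cub0 : 0 <= 3 * ((Num.sqrt gamma)^-1 / Num.sqrt n%:R ^+ 3).
Proof. by rewrite mulr_ge0// mulr_ge0 ?invr_ge0 ?exprn_ge0 ?sqrtr_ge0. Qed.

Let quart0 : 0 <= (4 * n%:R ^+ 2)^-1 :> R.
Proof. by rewrite invr_ge0 mulr_ge0// sqr_ge0. Qed.

Let swap_mean P s : \int[nu]_z swap P s z <= swap_const.
Proof.
rewrite swapE (integral_tameD nu_box mw w0 wint) ?integral_constant; [|exact: tameZ|exact: tame_cst].
rewrite (integral_tameZ nu_box mw w0 wint)//.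
have h := fourth_bound_mean P s; rewrite -[leLHS]/(\int[nu]_z bound4 P s z) in h.
have L1 : 1 <= Lam ^+ 2 by rewrite exprn_ege1.
have Lb : 3 / beta ^+ 2 <= 3 * Lam ^+ 2.
  rewrite ler_wpM2l// -exprVn ler_pXn2r// nnegrE ?invr_ge0 ?(ltW beta_gt0)//.
  exact: le_trans Lam_ge1.
rewrite /swap_const; set q := (4 * n%:R ^+ 2)^-1; set c := 3 * _.
have p1 := ler_wpM2l cub0 h; have p2 := ler_wpM2l cub0 L1.
have qe : 0 <= q * eta by exact: mulr_ge0.
have p3 := ler_wpM2l qe h; have p4 := ler_wpM2l qe Lb.
rewrite -/c in p1 p2; move: (\int[nu]_z bound4 P s z) p1 p3 => b p1 p3.
lra.
Qed.

Section Coordinate.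
Context (s : 'I_n -> I) (i : 'I_n).
Hypothesis s_inj : injective s.

Let Psi z (x : vec) : R := Phi lambda D B beta gamma (fun j => if j == i then (x : 'rV[R]_N) else z (s j)).

Let value_upd z x : value xpredT s (upd z (s i) x) = Psi z x.
Proof.
rewrite /value -PhiE /Psi; congr (Phi _ _ _ _ _ _); apply/funext => j.
by rewrite /upd (inj_eq s_inj).
Qed.

Let measurable_Psi z : measurable_fun [set: vec] (Psi z).
Proof.
rewrite (_ : Psi z = value xpredT s \o (fun x => upd z (s i) x)); last by apply/funext => x /=; rewrite value_upd.
exact: measurableT_comp (measurable_value _ _) (measurable_section _ _).
Qed.

Lemma value_leave_one_out z x : value (predC1 i) s (upd z (s i) x) = value (predC1 i) s z.
Proof.
by apply: partial_Phi_ext => j /= ji; rewrite /upd (inj_eq s_inj) (negbTE ji).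
Qed.

(** The coordinates s i and s' i play the same role for two selections that agree off i, so the
   averages of the two values are close to the same constant. *)
Lemma value_average z : exists c0 : R, forall s' : 'I_n -> I, injective s' ->
  (forall j, j != i -> s' j = s j) ->
  `|avg mu (s' i) (value xpredT s') z - c0| <= swap (predC1 i) s z.
Proof.
have [c0 Hc0] := one_coordinate D0 bD cD oD B_ge0 scB lambda_gt0 beta_gt0 gamma_gt0 n_gt0 quad_le
  kappa_ge0 rho2_ge0 eta_ge0 eta_dim (predC1 i) (fun j => z (s j)).
exists c0 => s' s'_inj ss'.
have mP : measurable_fun [set: vec] (fun x : vec => inf [set partial_objective lambda beta (predC1 i) (fun j => z (s j)) t c
    + gamma * B t + (2 * n%:R)^-1 * (c - dot x t) ^+ 2 | t in D & c in [set: R]]).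
  rewrite (_ : (fun x : vec => _) = Psi z); first exact: measurable_Psi.
  by apply/funext => x; rewrite /Psi (Phi_split D B lambda beta gamma (fun j => z (s j)) i x).
have [_ h _] := Hc0 (mu (s' i)) (mu_moments _) mP.
rewrite -[leRHS]/(swap_bound n beta gamma kappa eta (value (predC1 i) s z)) in h *.
apply: le_trans h; rewrite le_eqVlt; apply/orP; left; apply/eqP; congr `|_ - _|.
apply: eq_Rintegral => x _; rewrite -(Phi_split D B lambda beta gamma (fun j => z (s j)) i x).
rewrite /value -PhiE; congr (Phi _ _ _ _ _ _); apply/funext => j.
by rewrite /upd (inj_eq s'_inj); case: (eqVneq j i) => // ji; rewrite ss'.
Qed.

Lemma value_deviation : \int[nu]_z ((value xpredT s z - value (predC1 i) s z) ^+ 2) <= c1 * Lam ^+ 2 / (4 * n%:R ^+ 2).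
Proof.
have sB : sq_tame (fun z => value xpredT s z - value (predC1 i) s z).
  by apply: sq_tameB => //; exact: sq_tame_value.
rewrite (integral_avg nu_box mw w0 wint (s i) sB.2).
have tav := tame_avg nu_box mw w0 wint (s i) sB.2.
apply: (@le_trans _ _ (\int[nu]_z ((4 * n%:R ^+ 2)^-1 * bound4 (predC1 i) s z))); last first.
  rewrite (integral_tameZ nu_box mw w0 wint)// [leRHS]mulrC; apply: ler_wpM2l => //; exact: fourth_bound_mean.
apply: (integral_tame_le nu_box mw w0 wint) => //; first exact: tameZ.
move=> z; have [c0 Hc0] := one_coordinate D0 bD cD oD B_ge0 scB lambda_gt0 beta_gt0 gamma_gt0 n_gt0 quad_le
  kappa_ge0 rho2_ge0 eta_ge0 eta_dim (predC1 i) (fun j => z (s j)).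
have mP : measurable_fun [set: vec] (fun x : vec => inf [set partial_objective lambda beta (predC1 i) (fun j => z (s j)) t c
    + gamma * B t + (2 * n%:R)^-1 * (c - dot x t) ^+ 2 | t in D & c in [set: R]]).
  rewrite (_ : (fun x : vec => _) = Psi z); first exact: measurable_Psi.
  by apply/funext => x; rewrite /Psi (Phi_split D B lambda beta gamma (fun j => z (s j)) i x).
have [_ _ h] := Hc0 (mu (s i)) (mu_moments _) mP.
rewrite mulrC; apply: le_trans h; rewrite le_eqVlt; apply/orP; left; apply/eqP.
apply: eq_Rintegral => x _; rewrite value_leave_one_out value_upd /Psi.
by rewrite (Phi_split D B lambda beta gamma (fun j => z (s j)) i x).
Qed.

(** Average each value over its own i-th sample before comparing. *)
Lemma value_swap s' : injective s' -> (forall j, j != i -> s' j = s j) ->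
  `|\int[nu]_z value xpredT s z - \int[nu]_z value xpredT s' z| <= 2 * swap_const.
Proof.
move=> s'_inj ss'.
have tv s1 : tame (value xpredT s1) by apply: sq_tame_tame => //; exact: sq_tame_value.
rewrite (integral_avg nu_box mw w0 wint (s i) (tv s)) (integral_avg nu_box mw w0 wint (s' i) (tv s')).
have ta s1 : tame (avg mu (s1 i) (value xpredT s1)) := tame_avg nu_box mw w0 wint (s1 i) (tv s1).
rewrite -(integral_tameB nu_box mw w0 wint (ta s) (ta s')).
have tB := tameB w0 (ta s) (ta s').
apply: (@le_trans _ _ (\int[nu]_z (2 * swap (predC1 i) s z))); last first.
  by rewrite (integral_tameZ nu_box mw w0 wint)// ler_wpM2l//; exact: swap_mean.
have t2 : tame (fun z => 2 * swap (predC1 i) s z) by exact: tameZ.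
have key z : `|avg mu (s i) (value xpredT s) z - avg mu (s' i) (value xpredT s') z| <= 2 * swap (predC1 i) s z.
  have [c0 Hc] := value_average z.
  have := Hc s s_inj (fun _ _ => erefl); have := Hc s' s'_inj ss'.
  by rewrite !ler_norml => /andP[? ?] /andP[? ?]; apply/andP; split; lra.
apply: le_trans (le_normr_Rintegral _ _) _ => //; first exact: (tame_integrable nu_box mw w0 wint tB).
apply: (integral_tame_le nu_box mw w0 wint) => //.
apply: (tame_le _ t2); first by apply: measurableT_comp => //; exact: tB.1.
by move=> z; rewrite normr_id; apply: le_trans (key z) (ler_norm _).
Qed.

End Coordinate.

(** Efron-Stein, comparing with the values that leave out one sample. *)
Lemma value_variance s : injective s ->
  \int[nu]_z (value xpredT s z ^+ 2) - (\int[nu]_z value xpredT s z) ^+ 2 <= c1 * Lam ^+ 2 / (4 * n%:R).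
Proof.
move=> s_inj.
(* For a coordinate that the selection s does not use, any constant may serve as comparison
   function. *)
pose c t z := if [pick i | s i == t] is Some i then value (predC1 i) s z else 0.
have cs i : c (s i) = value (predC1 i) s.
  apply/funext => z; rewrite /c; case: pickP => [j|/(_ i)]; last by rewrite eqxx.
  by rewrite (inj_eq s_inj) => /eqP ->.
have sc t : sq_tame (c t).
  by rewrite /c; case: pickP => [i _|_]; [exact: sq_tame_value|exact: sq_tame_cst].
have := efron_stein nu_box mw w0 wint (s := map s (enum 'I_n)) (sq_tame_value xpredT s) sc.
rewrite big_map big_enum /= => ES; apply: le_trans (ES _ _) _.
- move=> t z x; rewrite /c; case: pickP => // i /eqP <-; exact: value_leave_one_out.
- move=> t z x ts; apply: partial_Phi_ext => j _; rewrite /upd; case: eqP => // sj.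
  by case/mapP: ts; exists j; rewrite ?mem_enum.
apply: (@le_trans _ _ (\sum_(i < n) c1 * Lam ^+ 2 / (4 * n%:R ^+ 2))).
  by apply: ler_sum => i _; rewrite cs; exact: value_deviation.
rewrite sumr_const card_ord -[X in X <= _]mulr_natl le_eqVlt; apply/orP; left; apply/eqP.
rewrite mulrCA (_ : 4 * n%:R ^+ 2 = n%:R * (4 * n%:R)); last by lra.
by rewrite [(n%:R * _)^-1]invfM mulVKf// gt_eqF.
Qed.

(** Lindeberg's replacement: the selection h k takes the first k samples from s' and the others
   from s, and consecutive selections differ in one sample. *)
Lemma value_comparison s s' : injective s -> injective s' -> (forall j k, s j != s' k) ->
  `|\int[nu]_z value xpredT s z - \int[nu]_z value xpredT s' z| <= n%:R * (2 * swap_const).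
Proof.
move=> s_inj s'_inj disj.
pose h k (j : 'I_n) := if (j < k)%N then s' j else s j.
have h_inj k : injective (h k).
  move=> j l; rewrite /h; case: ifP => _; case: ifP => _; first exact: s'_inj.
  - by move/esym/eqP; rewrite (negbTE (disj _ _)).
  - by move/eqP; rewrite (negbTE (disj _ _)).
  - exact: s_inj.
have step k : (k <= n)%N ->
    `|\int[nu]_z value xpredT s z - \int[nu]_z value xpredT (h k) z| <= k%:R * (2 * swap_const).
  elim: k => [_|k IH kn].
    by rewrite (_ : h 0 = s) ?subrr ?normr0 ?mul0r//; apply/funext.
  have hk := @value_swap (h k) (Ordinal kn) (h_inj k) (h k.+1) (h_inj k.+1).
  rewrite -natr1 mulrDl mul1r.
  apply: le_trans (ler_distD (\int[nu]_z value xpredT (h k) z) _ _) _.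
  apply: lerD; first exact: IH (ltnW kn).
  apply: hk => j jk; rewrite /h ltnS leq_eqVlt; case: eqP => // jk'.
  by case/eqP: jk; apply/val_inj.
have := step n (leqnn n); rewrite (_ : h n = s')//; apply/funext => j.
by rewrite /h ltn_ord.
Qed.

End ArrayComparison.

(** * From random vectors to the law of the array *)

Section ArrayLaw.
Context d (T : measurableType d) (R : realType) (P : probability T R) (N : nat).
Local Notation vec := (borel_rV R N).
Context (I : finType) (X Y : I -> {RV P >-> vec}).
Hypothesis X_indep : mutually_independent X.
Hypothesis X_law : forall i, same_law (X i) (Y i).

Definition array_of (w : T) : arr vec I := fun i => X i w.

Lemma measurable_array_of : measurable_fun [set: T] array_of.
Proof. by apply: measurable_to_arr => i; exact: measurable_funPT. Qed.

Lemma array_of_mfun : array_of \in @mfun _ _ T (arr vec I).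
Proof. by rewrite inE; exact: measurable_array_of. Qed.

Definition array_rv : {RV P >-> arr vec I} := mfun_Sub array_of_mfun.

(** Independence of the whole family, read on boxes. *)
Lemma array_law_box (A : I -> set vec) : (forall i, measurable (A i)) ->
  distribution P array_rv [set z | forall i, A i (z i)] = (\prod_i distribution P (Y i) (A i))%E.
Proof.
move=> mA; have := X_indep [set: I]%SET mA.
rewrite (_ : \bigcap_(i in _) _ = array_rv @^-1` [set z | forall i, A i (z i)]); last first.
  apply/seteqP; split => [w h i|w h i _]; last exact: h.
  by apply: h; rewrite /= inE.
move=> e; apply: (etrans e); rewrite (eq_bigl xpredT) => [|i]; last by rewrite inE.
by apply: eq_bigr => i _; exact: X_law.
Qed.

End ArrayLaw.

Section Deviation.
Context d d' {T : measurableType d} {Y : measurableType d'} {R : realType}.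
Context (P : probability T R) (X : {RV P >-> Y}) (F : Y -> R).
Hypothesis F_int : (distribution P X).-integrable setT (EFin \o F).
Hypothesis F2_int : (distribution P X).-integrable setT (EFin \o (fun y => F y ^+ 2)).

(** Chebyshev: on the event, F X is at distance more than t from its mean m. *)
Lemma deviation_bound (b t : R) : let m := \int[distribution P X]_y F y in `|m| <= b -> 0 < t ->
  (P [set w | (b + t < `|F (X w)|)%R] <= (t ^- 2 * \int[distribution P X]_y ((F y - m) ^+ 2))%:E)%E.
Proof.
move=> m mb t0.
have mF : measurable_fun [set: T] (fun w => F (X w)).
  apply: measurableT_comp; last exact: measurable_funPT.
  by apply/measurable_EFinP; exact: (measurable_int _ F_int).
have F_mfun : (fun w => F (X w)) \in @mfun _ _ T R by rewrite inE.
have := chebyshev (mfun_Sub F_mfun : {RV P >-> R}) t0.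
rewrite /= (expectation_law F_int) (variance_law F_int F2_int) -/m -EFinM => cheb.
apply: le_trans cheb; apply: le_measure; rewrite ?inE.
- have mg : measurable_fun [set: T] (fun w => `|F (X w)|) by exact: measurableT_comp.
  have := mg measurableT `]b + t, +oo[%classic (measurable_itv _).
  by rewrite setTI; congr measurable; apply/seteqP; split => w /=; rewrite in_itv/= andbT.
- have mg : measurable_fun [set: T] (fun w => `|F (X w) - m|).
    by apply: measurableT_comp => //; exact: measurable_funB.
  have := mg measurableT `[t, +oo[%classic (measurable_itv _).
  by rewrite setTI; congr measurable; apply/seteqP; split => w /=; rewrite in_itv/= andbT.
- move=> w /= h; have := ler_normD (F (X w) - m) m; rewrite subrK.
  by move: mb h; move: (`|F (X w)|) (`|m|) (`|F (X w) - m|) => ? ? ?; lra.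
Qed.

End Deviation.

Section CenteredSquares.
Context {d} {X : measurableType d} {I : finType} {R : realType}.
Context (mu : I -> probability X R) (nu : probability (arr X I) R).
Hypothesis nu_box : forall A : I -> set X, (forall i, measurable (A i)) ->
  nu [set z | forall i, A i (z i)] = (\prod_i mu i (A i))%E.
Context (h : X -> R).
Hypothesis mh : measurable_fun setT h.
Hypothesis h_ge0 : forall x, 0 <= h x.
Hypothesis h_int : forall i, (mu i).-integrable setT (EFin \o h).
Implicit Types F G : arr X I -> R.

Lemma sq_tame_center F : sq_tame h F -> sq_tame h (fun z => F z - \int[nu]_z F z).
Proof. by move=> sF; apply: sq_tameB => //; exact: sq_tame_cst. Qed.

Lemma variance_tame F : sq_tame h F ->
  \int[nu]_z ((F z - \int[nu]_z F z) ^+ 2) = \int[nu]_z (F z ^+ 2) - (\int[nu]_z F z) ^+ 2.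
Proof.
move=> sF; have tF := sq_tame_tame h_ge0 sF; set m := \int[nu]_z F z.
transitivity (\int[nu]_z (F z ^+ 2 - (2 * m) * F z + m ^+ 2)); first by apply: eq_Rintegral => z _; lra.
have t1 := tameZ h_ge0 (2 * m) tF; have t2 := tame_cst (I := I) h_ge0 (m ^+ 2).
rewrite (integral_tameD nu_box mh h_ge0 h_int (tameB h_ge0 sF.2 t1) t2).
rewrite (integral_tameB nu_box mh h_ge0 h_int sF.2 t1) integral_constant.
by rewrite (integral_tameZ nu_box mh h_ge0 h_int (2 * m) tF) -/m; lra.
Qed.

Lemma variance_sub_le F G : sq_tame h F -> sq_tame h G ->
  \int[nu]_z ((F z - G z - \int[nu]_z (F z - G z)) ^+ 2) <=
  2 * \int[nu]_z ((F z - \int[nu]_z F z) ^+ 2) + 2 * \int[nu]_z ((G z - \int[nu]_z G z) ^+ 2).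
Proof.
move=> sF sG; have cF := sq_tame_center sF; have cG := sq_tame_center sG.
have sB := sq_tameB h_ge0 sF sG; have cB := sq_tame_center sB.
have tF := tameZ h_ge0 2 cF.2; have tG := tameZ h_ge0 2 cG.2.
rewrite -(integral_tameZ nu_box mh h_ge0 h_int 2 cF.2) -(integral_tameZ nu_box mh h_ge0 h_int 2 cG.2).
rewrite -(integral_tameD nu_box mh h_ge0 h_int tF tG).
apply: (integral_tame_le nu_box mh h_ge0 h_int cB.2 (tameD h_ge0 tF tG)) => z.
rewrite (integral_tameB nu_box mh h_ge0 h_int (sq_tame_tame h_ge0 sF) (sq_tame_tame h_ge0 sG)).
move: (\int[nu]_z F z) (\int[nu]_z G z) => a b.
have := sqr_ge0 ((F z - a) + (G z - b)); nra.
Qed.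

End CenteredSquares.

(** * The comparison theorem *)

Section Constants.
Context {R : realType}.

(** The second factor bounds the mean of (Phi0 / beta)^2 by a multiple of Lambda^2, and the
   first is that of fourth_bound. *)
Definition value_const (kappa : R) : R := 8 * (1 + kappa) * (2 + kappa).

Definition comparison_const (kappa : R) : R := 12 * (1 + value_const kappa).

Lemma value_const_ge0 (kappa : R) : 0 <= kappa -> 0 <= value_const kappa.
Proof. by move=> k0; rewrite !mulr_ge0// addr_ge0. Qed.

(** n swaps turn n^(-3/2) gamma^(-1/2) into (n gamma)^(-1/2), and n^(-2) into n^(-1). *)
Lemma swap_total (n : nat) (gamma c1 eta Lam : R) : (0 < n)%N -> 0 < gamma -> 0 <= c1 ->
  0 <= eta ->
  n%:R * (2 * ((3 * ((Num.sqrt gamma)^-1 / Num.sqrt n%:R ^+ 3) * (1 + c1)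
  + (4 * n%:R ^+ 2)^-1 * (eta * (c1 + 3))) * Lam ^+ 2))
  <= 12 * (1 + c1) * Lam ^+ 2 * ((Num.sqrt (n%:R * gamma))^-1 + eta / n%:R).
Proof.
move=> n0 g0 c0 e0; have nR : 0 < n%:R :> R by rewrite ltr0n.
have sn : 0 < Num.sqrt n%:R :> R by rewrite sqrtr_gt0.
have sn2 : Num.sqrt n%:R ^+ 2 = n%:R :> R by rewrite sqr_sqrtr// ltW.
have e1 : n%:R * ((Num.sqrt gamma)^-1 / Num.sqrt n%:R ^+ 3) = (Num.sqrt (n%:R * gamma))^-1.
  have cancel r q : 0 < r -> r ^+ 2 * (q / r ^+ 3) = r^-1 * q :> R.
    by move=> r0; rewrite (exprSr r 2) invfM mulrCA mulVKf 1?mulrC// gt_eqF// exprn_gt0.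
  rewrite sqrtrM ?(ltW nR)// [RHS]invfM -(cancel _ _ sn); by rewrite sn2.
have e2 : n%:R * (4 * n%:R ^+ 2)^-1 = 4^-1 / n%:R :> R.
  rewrite (_ : 4 * n%:R ^+ 2 = n%:R * (4 * n%:R)); last by lra.
  by rewrite [(n%:R * _)^-1]invfM mulVKf ?gt_eqF// invfM.
have a0 : 0 <= (Num.sqrt (n%:R * gamma))^-1 by rewrite invr_ge0 sqrtr_ge0.
have b0 : 0 <= eta / n%:R by rewrite divr_ge0// ltW.
have -> : n%:R * (2 * ((3 * ((Num.sqrt gamma)^-1 / Num.sqrt n%:R ^+ 3) * (1 + c1)
  + (4 * n%:R ^+ 2)^-1 * (eta * (c1 + 3))) * Lam ^+ 2))
  = Lam ^+ 2 * (6 * (1 + c1) * (n%:R * ((Num.sqrt gamma)^-1 / Num.sqrt n%:R ^+ 3))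
     + 2 * (n%:R * (4 * n%:R ^+ 2)^-1) * (eta * (c1 + 3))) by lra.
rewrite e1 e2; move: (Num.sqrt (n%:R * gamma))^-1 a0 => a a0.
have L0 := sqr_ge0 Lam; have La := mulr_ge0 L0 a0; have Lb := mulr_ge0 L0 b0.
have := mulr_ge0 La c0; have := mulr_ge0 Lb c0.
lra.
Qed.

Lemma two_variances (c1 X a b : R) : 0 <= c1 -> 0 <= X -> a <= c1 / 4 * X -> b <= c1 / 4 * X ->
  a + b <= 12 * (1 + c1) * X /\ 2 * a + 2 * b <= 12 * (1 + c1) * X.
Proof.
move=> c0 X0 ha hb; have := mulr_ge0 c0 X0.
have -> : 12 * (1 + c1) * X = 12 * X + 12 * (c1 * X) by lra.
have cX : c1 / 4 * X = 4^-1 * (c1 * X) by lra.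
rewrite cX in ha hb; move: (c1 * X) ha hb => Y ha hb Y0; split; lra.
Qed.

Lemma scale_total (C L m t : R) : t ^- 2 * (C * (L / m)) = C * L / (m * t ^+ 2).
Proof. by rewrite [(m * _)^-1]invfM mulrC -!mulrA. Qed.

End Constants.

Theorem theorem2p9 (R : realType) (Kfeat : R) (Kfeat_gt0 : 0 < Kfeat) :
  exists C n0 : R,
  forall (N n : nat) (beta gamma tau : R) (Sigma : 'M[R]_N)
    (d : measure_display) (T : measurableType d) (P : probability T R)
    (W G : {RV P >-> borel_rV R N}) (Ws Gs : 'I_n -> {RV P >-> borel_rV R N}),
    (1 <= N)%N -> (1 <= n)%N -> 0 < beta -> 0 < gamma -> 0 <= tau ->
    regular_feature Kfeat tau Sigma W ->
    centered_gaussian Sigma G ->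
    (forall i, same_law (Ws i) W) ->
    (forall i, same_law (Gs i) G) ->
    mutually_independent
      (fun s : 'I_n + 'I_n => match s with inl i => Ws i | inr i => Gs i end) ->
  forall (D : set 'rV[R]_N) (B : 'rV[R]_N -> R) (vartheta : R),
    D !=set0 -> bounded_set D -> convex_set D -> relatively_open D ->
    (forall theta, D theta -> 0 <= B theta) ->
    1 <= vartheta -> self_concordant_barrier vartheta D B ->
  let lambda := op_norm Sigma in
  let PhiW := fun w => Phi lambda D B beta gamma (fun i => Ws i w) in
  let PhiG := fun w => Phi lambda D B beta gamma (fun i => Gs i w) in
  let Lambda := Lambda_ref lambda D B beta gamma in
  let bound := C * Lambda ^+ 2 * rate n lambda D tau gamma in
  [/\ n0 <= n%:R * gamma ->
        (`| 'E_P[PhiW] - 'E_P[PhiG] | <= bound%:E)%E,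
      ('V_P[PhiW] + 'V_P[PhiG] <= (C * (Lambda ^+ 2 / n%:R))%:E)%E &
      n0 <= n%:R * gamma ->
        forall t : R, 0 < t ->
          (P [set w | (bound + t < `|PhiW w - PhiG w|)%R]
             <= (C * Lambda ^+ 2 / (n%:R * t ^+ 2))%:E)%E].
Proof.
pose kappa := Kfeat ^+ 4 + 3; pose c1 := value_const kappa.
have K4 : 0 <= Kfeat ^+ 4 by rewrite exprn_ge0// ltW.
have kappa_ge0 : 0 <= kappa by rewrite addr_ge0.
have c1_ge0 : 0 <= c1 := value_const_ge0 kappa_ge0.
exists (comparison_const kappa), 0.
move=> N n beta gamma tau Sigma d T P W G Ws Gs _ n_gt0 beta_gt0 gamma_gt0 tau_ge0 fW gG lawW lawG indep.
move=> D B vartheta D0 bD cD oD B_ge0 _ scB lambda PhiW PhiG Lambda bound.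
have lambda_gt0 : 0 < lambda by have [_ _ ? _ _] := fW.
have nR : 0 < n%:R :> R by rewrite ltr0n.
(* Bounds the variance of quadratic forms for both laws: tau^2 for W and 2 lambda^2 for G. *)
pose rho2 := tau ^+ 2 + 2 * lambda ^+ 2.
have rho2_ge0 : 0 <= rho2 by apply: addr_ge0; [exact: sqr_ge0|apply: mulr_ge0 => //; exact: sqr_ge0].
pose eta := Num.sqrt (\dim (direction D))%:R * (tau / lambda + 1).
have tl0 : 0 <= tau / lambda + 1 by rewrite addr_ge0// divr_ge0// ltW.
have eta_ge0 : 0 <= eta by rewrite mulr_ge0// sqrtr_ge0.
have eta_dim : (\dim (direction D))%:R * (rho2 / (2 * lambda ^+ 2) + 2) <= 3 * eta ^+ 2.
  rewrite /eta exprMn sqr_sqrtr ?ler0n// [leRHS]mulrCA ler_wpM2l ?ler0n//.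
  have -> : rho2 / (2 * lambda ^+ 2) = 2^-1 * (tau / lambda) ^+ 2 + 1.
    have l2 : lambda ^+ 2 / lambda ^+ 2 = 1 by rewrite divff// expf_neq0// gt_eqF.
    by rewrite expr_div_n /rho2 [(2 * _)^-1]invfM; move: l2; lra.
  have : 0 <= tau / lambda by rewrite divr_ge0// ltW.
  nra.
pose S := [set lambda * norm2 theta ^+ 2 + gamma * B theta | theta in D].
have S_ge0 x : S x -> 0 <= x.
  move=> [th Dth <-]; apply: addr_ge0; apply: mulr_ge0; rewrite ?sqr_ge0//; first exact: ltW.
    exact: ltW.
  exact: B_ge0.
have S0 : S !=set0 by have [th Dth] := D0; exists (lambda * norm2 th ^+ 2 + gamma * B th), th.
have infS0 : 0 <= inf S by apply: lb_le_inf => // x; exact: S_ge0.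
have [theta0 Dth0 th0le] : exists2 theta0, D theta0 &
    lambda * dot theta0 theta0 + gamma * B theta0 <= 1 + inf S.
  have [|_ [th Dth <-] /ltW h] := @inf_lt R S (1 + inf S) S0; first by rewrite ltrDr.
  by exists th => //; rewrite -norm2_sqr.
have ib : 0 < beta^-1 by rewrite invr_gt0.
have LE : Lambda = (1 + beta^-1) * (1 + inf S) by [].
have Lam_le : (1 + beta^-1) * (lambda * dot theta0 theta0 + gamma * B theta0) <= Lambda.
  by rewrite LE ler_wpM2l// addr_ge0// ltW.
have bS := mulr_ge0 (ltW ib) infS0.
have Lam_ge1 : 1 <= Lambda by rewrite LE; lra.
have Lam_inv : beta^-1 <= Lambda by rewrite LE; lra.
pose I : finType := ('I_n + 'I_n)%type.
pose X (s : I) : {RV P >-> borel_rV R N} := match s with inl i => Ws i | inr i => Gs i end.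
pose Y (s : I) : {RV P >-> borel_rV R N} := match s with inl _ => W | inr _ => G end.
have X_law s : same_law (X s) (Y s) by case: s => i; [exact: lawW|exact: lawG].
pose Z := array_rv X; pose nu : probability (arr (borel_rV R N) I) R := distribution P Z.
pose mu s : probability (borel_rV R N) R := distribution P (Y s).
have nu_box A : (forall i, measurable (A i)) -> nu [set z | forall i, A i (z i)] = (\prod_i mu i (A i))%E.
  exact: (array_law_box indep X_law).
have sS := feature_symmetric fW; have pS := feature_psd fW.
have mu_moments s : moments Sigma lambda kappa rho2 (mu s).
  case: s => i; rewrite /mu /Y.
    by apply: (feature_moments fW); [rewrite /kappa lerDl|rewrite /rho2 lerDl mulr_ge0// sqr_ge0].
  apply: (gaussian_moments _ pS sS); [exact: gG|by rewrite /kappa lerDr|by rewrite /rho2 lerDr sqr_ge0].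
have quad_le th : quad Sigma th <= lambda * dot th th by exact: quad_op_norm.
have mw := @measurable_weight R N; have w0 := @weight_ge0 R N.
have wint s := moments_weight (mu_moments s).
pose V (s : 'I_n -> I) := value D B lambda beta gamma xpredT s.
have sV s : sq_tame weight (V s).
  exact: (sq_tame_value D0 B_ge0 lambda_gt0 beta_gt0 gamma_gt0 n_gt0 Dth0).
have tV s := sq_tame_tame w0 (sV s).
have int (F : arr (borel_rV R N) I -> R) : tame weight F -> nu.-integrable setT (EFin \o F).
  exact: (tame_integrable nu_box mw w0 wint).
have inl_inj : injective (@inl 'I_n 'I_n) by move=> ? ? [].
have inr_inj : injective (@inr 'I_n 'I_n) by move=> ? ? [].
pose L : 'I_n -> I := inl; pose Rr : 'I_n -> I := inr.
have comp : `|\int[nu]_z V L z - \int[nu]_z V Rr z| <= bound.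
  have h := value_comparison D0 bD cD oD B_ge0 scB lambda_gt0 beta_gt0 gamma_gt0 n_gt0 quad_le kappa_ge0
    rho2_ge0 eta_ge0 eta_dim nu_box mu_moments Dth0 Lam_le Lam_ge1 Lam_inv inl_inj inr_inj (fun _ _ => isT).
  apply: le_trans h _; rewrite /bound /rate -/eta.
  exact: (swap_total Lambda n_gt0 gamma_gt0 c1_ge0 eta_ge0).
have var s : injective s -> \int[nu]_z ((V s z - \int[nu]_z V s z) ^+ 2) <= c1 * Lambda ^+ 2 / (4 * n%:R).
  move=> s_inj; rewrite (variance_tame nu_box mw w0 wint (sV s)).
  exact: (value_variance D0 bD cD oD B_ge0 scB lambda_gt0 beta_gt0 gamma_gt0 n_gt0 quad_le kappa_ge0
    rho2_ge0 eta_ge0 eta_dim nu_box mu_moments Dth0 Lam_le Lam_ge1 s_inj).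
have PhiWE : PhiW = fun w => V L (Z w) by [].
have PhiGE : PhiG = fun w => V Rr (Z w) by [].
have EV s : ('E_P[fun w => V s (Z w)] = (\int[nu]_z V s z)%:E)%E by exact: expectation_law (int _ (tV s)).
have VV s : ('V_P[fun w => V s (Z w)] = (\int[nu]_z ((V s z - \int[nu]_z V s z) ^+ 2))%:E)%E.
  exact: variance_law (int _ (tV s)) (int _ (sV s).2).
have Ln0 : 0 <= Lambda ^+ 2 / n%:R by rewrite divr_ge0 ?sqr_ge0// ltW.
have vE : c1 * Lambda ^+ 2 / (4 * n%:R) = c1 / 4 * (Lambda ^+ 2 / n%:R) by rewrite invfM mulrACA.
rewrite vE in var.
have [vsum vsum2] := two_variances c1_ge0 Ln0 (var L inl_inj) (var Rr inr_inj).
split=> [_||_ t t0].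
- by rewrite PhiWE PhiGE !EV -EFinB lee_fin.
- by rewrite PhiWE PhiGE !VV -EFinD lee_fin.
- pose F z := V L z - V Rr z.
  have sF : sq_tame weight F by exact: sq_tameB.
  have mF : `|\int[nu]_z F z| <= bound by rewrite (integral_tameB nu_box mw w0 wint (tV L) (tV Rr)).
  have dev := deviation_bound (int _ (sq_tame_tame w0 sF)) (int _ sF.2) mF t0.
  apply: le_trans dev _; rewrite lee_fin.
  have it : 0 <= t ^- 2 by rewrite invr_ge0 sqr_ge0.
  have h := le_trans (variance_sub_le nu_box mw w0 wint (sV L) (sV Rr)) vsum2.
  apply: le_trans (ler_wpM2l it h) _.
  by rewrite scale_total.
Qed.
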